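(* Let $p\neq2$ and let $L_{\mathbb{Z}_p}=\{A\in M_2(\mathbb{Z}_p):{}^tA=A\}$ with quadratic form $Q(A)=\det A$ (this lattice is unimodular, so $\mathrm{SO}'(L_{\mathbb{Z}_p})=\mathrm{SO}(L_{\mathbb{Z}_p})$). Let $q\in\mathbb{Z}_p\setminus\{0\}$. Then for every integer $s\ge1$, $$\sum_{S}|d(S^\perp_{\mathbb{Z}_p})|_p^{-s/2}\,(1-p^{-s})\,\zeta_p(S^\perp_{\mathbb{Z}_p};s)=|q|_p^{\frac{s-1}{2}}\,\lambda_p(L_{\mathbb{Z}_p};s-1)^{-1}\,\mu_p(L_{\mathbb{Z}_p},\langle q\rangle,L_{\mathbb{Z}_p};s-1),$$ where $S$ runs through representatives of the $\mathrm{SO}(L_{\mathbb{Z}_p})$-orbits of vectors $S\in L_{\mathbb{Z}_p}$ with $\det S=q$, and $S^\perp_{\mathbb{Z}_p}=\{A\in L_{\mathbb{Z}_p}:\langle A,S\rangle=0\}$ with the restricted form.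
   Context: Bilinear form $\langle v,w\rangle=Q(v+w)-Q(v)-Q(w)$; $d(\Lambda)$ is the determinant of the Gram matrix of $\langle\,,\rangle$ in a $\mathbb{Z}_p$-basis of $\Lambda$. For a rank-2 lattice $\Lambda$ with quadratic form $Q$ such that $E:=\mathrm{vol}\{v\in\Lambda:Q(v)\in\mathbb{Z}_p^\times\}\neq0$ (Haar measure $dv$ with $\mathrm{vol}(\Lambda)=1$), the normalized local zeta function is $\zeta_p(\Lambda;s)=\frac1E\int_\Lambda|Q(v)|_p^{s-1}dv$. $\langle q\rangle$ is $\mathbb{Z}_p$ with $Q(x)=qx^2$. Canonical measures: for non-degenerate quadratic spaces $M$ (dim $n$, Gram matrix $B$ in a basis $f_j$) and $L$ (dim $m\ge n$, Gram matrix $A$ in a basis $e_i$) over $\mathbb{Q}_p$ (Haar measure with $\mathrm{vol}(\mathbb{Z}_p)=1$), the canonical measure on $\mathrm{Hom}(M,L)$ is $|\det A|^{n/2}|\det B|^{-m/2}\prod dx_{ij}$ (coordinates $\alpha(f_j)=\sum_ix_{ij}e_i$), the canonical measure on quadratic forms $\sum_{i\le j}q_{ij}y_iy_j$ on $M$ is $|\det B|^{-(n+1)/2}\prod_{i\le j}dq_{ij}$, and the canonical measure $\mu_{L,M}$ on $\mathrm{Isom}(M,L)(\mathbb{Q}_p)=\{\alpha:Q_L\circ\alpha=Q_M\}$ is the fibre measure of $\alpha\mapsto Q_L\circ\alpha$ over $Q_M$; the canonical measure on $\mathrm{SO}(L_{\mathbb{Q}_p})$ is the restriction of $\mu_{L,L}$.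 $\mathrm{SO}(L_{\mathbb{Z}_p})$ is the stabilizer of $L_{\mathbb{Z}_p}$ and $\mathrm{SO}'(L_{\mathbb{Z}_p})$ the kernel of $\mathrm{SO}(L_{\mathbb{Z}_p})\to\mathrm{Aut}(L^*/L)$. $H$ is the hyperbolic plane $\mathbb{Z}_p^2$, $Q(x,y)=xy$, $H^s$ the orthogonal sum of $s$ copies. For $s\in\mathbb{Z}_{\ge0}$: $\mu_p(L_{\mathbb{Z}_p},M_{\mathbb{Z}_p},L_{\mathbb{Z}_p};s):=\mu_{L\perp H^s,M}\big(\{\alpha\in\mathrm{Isom}(M,L\perp H^s)(\mathbb{Q}_p):\alpha(M_{\mathbb{Z}_p})\subseteq L_{\mathbb{Z}_p}\perp H^s\}\big)$ and $\lambda_p(L_{\mathbb{Z}_p};s):=\mathrm{vol}(\mathrm{SO}'(L_{\mathbb{Z}_p}\perp H^s))/\prod_{i=1}^s(1-p^{-2i})$. *)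

(* Defs.v *)
From Stdlib Require Import Reals ClassicalEpsilon.
From Coquelicot Require Import Lim_seq Rbar.
From HB Require Import structures.
From mathcomp Require Import all_boot all_order all_algebra.
From mathcomp Require Import Rstruct.

Set Implicit Arguments.
Unset Strict Implicit.
Unset Printing Implicit Defensive.

(* p-adic integers, represented by their coherent sequences of        *)
(* residues: x k is the residue of x mod p^k, in [0, p^k).            *)

Definition padic := nat -> int.

Section IntPart.
Local Open Scope ring_scope.
Variable p : nat.

Definition pk (k : nat) : int := (p ^ k)%N%:Z.
Definition red (k : nat) (z : int) : int := (z %% pk k)%Z.

Definition is_zp (x : padic) : Prop := forall k, x k = red k (x k.+1).
Definition zeq (x y : padic) : Prop := forall k, x k = y k.
Definition zint (z : int) : padic := fun k => red k z.
Definition zero : padic := fun _ => 0.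

Definition zvec (n : nat) (v : nat -> padic) : Prop :=
  forall i, (i < n)%N -> is_zp (v i).
Definition zmat (m n : nat) (a : nat -> nat -> padic) : Prop :=
  forall i j, (i < m)%N -> (j < n)%N -> is_zp (a i j).

Definition lin (x : padic) (u : nat -> padic) (y : padic) (w : nat -> padic)
  : nat -> padic := fun i k => red k (x k * u i k + y k * w i k).
Definition vadd (v w : nat -> padic) : nat -> padic :=
  fun i k => red k (v i k + w i k).
Definition matvec (n : nat) (a : nat -> nat -> padic) (v : nat -> padic)
  : nat -> padic := fun i k => red k (\sum_(j < n) a i j k * v j k).
Definition matmul (n : nat) (a b : nat -> nat -> padic) : nat -> nat -> padic :=
  fun i j k => red k (\sum_(l < n) a i l k * b l j k).
Definition idmat : nat -> nat -> padic :=
  fun i j => zint (if i == j then 1 else 0).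

Definition qeval (n : nat) (c : nat -> nat -> padic) (v : nat -> padic)
  : padic :=
  fun k => red k (\sum_(i < n) \sum_(j < n | (i <= j)%N) c i j k * v i k * v j k).
Definition beval (n : nat) (c : nat -> nat -> padic) (v w : nat -> padic)
  : padic :=
  fun k => red k (qeval n c (vadd v w) k - qeval n c v k - qeval n c w k).
Definition gram (n : nat) (c : nat -> nat -> padic) : nat -> nat -> padic :=
  fun i j k => red k (if i == j then 2 * c i i k
                      else if (i < j)%N then c i j k else c j i k).

Definition resmx (n : nat) (a : nat -> nat -> padic) (k : nat) : 'M[int]_n :=
  \matrix_(i < n, j < n) a i j k.
Definition detz (n : nat) (a : nat -> nat -> padic) : padic :=
  fun k => red k (\det (resmx n a k)).
Definition adjz (n : nat) (a : nat -> nat -> padic) : nat -> nat -> padic :=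
  fun i j k => match insub i, insub j with
               | Some i', Some j' => red k (\adj (resmx n a k) i' j')
               | _, _ => 0 end.

Definition embN (x : nat) : padic := fun k => red k x%:Z.

End IntPart.

Definition Rlim (u : nat -> R) : R := real (Lim_seq u).

(* p-adic absolute value |x|_p (limit of an eventually constant sequence,
   or of p^-k -> 0 when x = 0) *)
Definition absp (p : nat) (x : padic) : R :=
  Rlim (fun k => if x k == 0%R then Rinv (INR (p ^ k))
                 else Rinv (INR (p ^ logn p (absz (x k))))).

Definition Rind (P : Prop) : R :=
  if excluded_middle_informative P then 1%R else 0%R.

(* Haar integral over Z_p^n (vol Z_p^n = 1) of a continuous function,
   as a limit of Riemann sums over the residues mod p^r. *)
Definition haarV (p n : nat) (F : (nat -> padic) -> R) : R :=
  Rlim (fun r => Rmult (Rinv (INR ((p ^ r) ^ n)))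
     (\sum_(x : {ffun 'I_n -> 'I_(p ^ r)})
        F (fun i => oapp (fun j : 'I_n => embN p (x j)) (zero) (insub i)))%R).

Definition haarM (p m n : nat) (F : (nat -> nat -> padic) -> R) : R :=
  Rlim (fun r => Rmult (Rinv (INR ((p ^ r) ^ (m * n))))
     (\sum_(x : {ffun 'I_m * 'I_n -> 'I_(p ^ r)})
        F (fun i j => match insub i, insub j with
                      | Some i', Some j' => embN p (x (i', j'))
                      | _, _ => zero end))%R).

(* L : dimension m, coefficients cL ; M : dimension n, coefficients cM *)
(* alpha in Hom(M,L) is the matrix (x_ij), alpha(f_j) = sum_i x_ij e_i *)

Definition col (a : nat -> nat -> padic) (j : nat) : nat -> padic :=
  fun i => a i j.

Definition pullback (p m : nat) (cL : nat -> nat -> padic)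
  (a : nat -> nat -> padic) : nat -> nat -> padic :=
  fun i j => if i == j then qeval p m cL (col a i)
             else beval p m cL (col a i) (col a j).

Definition isom (p m : nat) (cL : nat -> nat -> padic) (n : nat)
  (cM : nat -> nat -> padic) (a : nat -> nat -> padic) : Prop :=
  forall i j, (i <= j < n)%N -> zeq (pullback p m cL a i j) (cM i j).

(* Q_L o alpha lies in the ball U_k of radius p^-k around Q_M
   (in the coordinates q_ij, i <= j) *)
Definition near_form (p m : nat) (cL : nat -> nat -> padic) (n : nat)
  (cM : nat -> nat -> padic) (k : nat) (a : nat -> nat -> padic) : Prop :=
  forall i j, (i <= j < n)%N -> pullback p m cL a i j k = cM i j k.

Definition near_set (p m n r : nat) (X : (nat -> nat -> padic) -> Prop)
  (a : nat -> nat -> padic) : Prop :=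
  exists g, X g /\ forall i j, (i < m)%N -> (j < n)%N -> a i j r = g i j r.

(* canonical measure density factors *)
Definition homfac (p m : nat) (cL : nat -> nat -> padic) (n : nat)
  (cM : nat -> nat -> padic) : R :=
  Rmult (Rpower (absp p (detz p m (gram p m cL))) (INR n / 2))
        (Rpower (absp p (detz p n (gram p n cM))) (- INR m / 2)).
Definition qffac (p n : nat) (cM : nat -> nat -> padic) : R :=
  Rpower (absp p (detz p n (gram p n cM))) (- (INR n + 1) / 2).

(* Fibre measure mu_{L,M}(X) of a compact set X of integral isometries
   (X contained in the fibre over Q_M of alpha |-> Q_L o alpha):
   mu(X) = lim_r lim_k vol(T_r cap pi^-1(U_k)) / vol(U_k),
   where T_r = {alpha : alpha = g mod p^r for some g in X}. *)
Definition fibre (p m : nat) (cL : nat -> nat -> padic) (n : nat)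
  (cM : nat -> nat -> padic) (X : (nat -> nat -> padic) -> Prop) : R :=
  Rlim (fun r => Rlim (fun k =>
    Rdiv (Rmult (homfac p m cL n cM)
                (haarM p m n (fun a =>
                    Rind (near_form p m cL n cM k a /\ near_set p m n r X a))))
         (Rmult (qffac p n cM) (Rinv (INR ((p ^ k) ^ (n * (n + 1) %/ 2))))))).

(* The lattices L = Sym_2(Z_p) with Q = det and L _|_ H^t             *)
(* A symmetric matrix [[a, c], [c, b]] is the vector (a, b, c) = (v 0, *)
(* v 1, v 2); Q = a b - c^2.  Coordinates 3+2i, 4+2i (i < t) are the  *)
(* i-th hyperbolic plane, Q(x, y) = x y.                              *)

Definition dimLH (t : nat) : nat := 3 + 2 * t.

Definition coefLH_int (t i j : nat) : int :=
  if (i == 0%N) && (j == 1%N) then 1%R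
  else if (i == 2%N) && (j == 2%N) then (-1)%R
  else if [&& (3 <= i)%N, odd i, j == i.+1 & (j < dimLH t)%N] then 1%R
  else 0%R.

Definition coefLH (p t : nat) : nat -> nat -> padic :=
  fun i j => zint p (coefLH_int t i j).

Definition QL (p : nat) (S : nat -> padic) : padic := qeval p 3 (coefLH p 0) S.
Definition BL (p : nat) (S T : nat -> padic) : padic :=
  beval p 3 (coefLH p 0) S T.

(* SO(L_Zp _|_ H^t): stabilizer of the lattice in SO(L_Qp _|_ H^t) *)
Definition SOset (p t : nat) (g : nat -> nat -> padic) : Prop :=
  let N := dimLH t in
  [/\ zmat p N N g,
      isom p N (coefLH p t) N (coefLH p t) g,
      zeq (detz p N g) (zint p 1) &
      exists h, zmat p N N h /\
        (forall i j, (i < N)%N -> (j < N)%N ->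
           zeq (matmul p N g h i j) (idmat p i j) /\
           zeq (matmul p N h g i j) (idmat p i j))].

(* SO'(L_Zp _|_ H^t): kernel of the action on the discriminant group
   L^*/L, where L^* = G^{-1} Z_p^N = det(G)^{-1} adj(G) Z_p^N:
   g acts trivially iff (g - 1) adj(G) z is in det(G) Z_p^N for all z. *)
Definition SO'set (p t : nat) (g : nat -> nat -> padic) : Prop :=
  let N := dimLH t in
  let G := gram p N (coefLH p t) in
  SOset p t g /\
  forall z, zvec p N z -> exists y, zvec p N y /\
    forall i, (i < N)%N ->
      let w := matvec p N (adjz p N G) z in
      zeq (fun k => red p k (matvec p N g w i k - w i k)%R)
          (fun k => red p k (detz p N G k * y i k)%R).

Fixpoint prodfac (p t : nat) : R :=
  match t with
  | O => 1%R
  | S t' => Rmult (prodfac p t') (Rminus 1 (Rinv (INR (p ^ (2 * t)))))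
  end.

Definition lambda_p (p t : nat) : R :=
  Rdiv (fibre p (dimLH t) (coefLH p t) (dimLH t) (coefLH p t) (SO'set p t))
       (prodfac p t).

Definition coefq (q : padic) : nat -> nat -> padic := fun _ _ => q.

Definition mu_p (p : nat) (q : padic) (t : nat) : R :=
  let N := dimLH t in
  fibre p N (coefLH p t) 1 (coefq q)
    (fun a => zmat p N 1 a /\ isom p N (coefLH p t) 1 (coefq q) a).

Definition inL (p : nat) (S : nat -> padic) : Prop := zvec p 3 S.

Definition inPerp (p : nat) (S A : nat -> padic) : Prop :=
  inL p A /\ zeq (BL p A S) (zero).

Definition isBasis (p : nat) (S u w : nat -> padic) : Prop :=
  [/\ inPerp p S u, inPerp p S w,
      (forall A, inPerp p S A -> exists x y, is_zp p x /\ is_zp p y /\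
          forall i, (i < 3)%N -> zeq (A i) (lin p x u y w i)) &
      (forall x y x' y', is_zp p x -> is_zp p y -> is_zp p x' -> is_zp p y' ->
          (forall i, (i < 3)%N -> zeq (lin p x u y w i) (lin p x' u y' w i)) ->
          zeq x x' /\ zeq y y')].

Definition perpBasis (p : nat) (S : nat -> padic)
  : (nat -> padic) * (nat -> padic) :=
  epsilon (inhabits (fun _ => zero, fun _ => zero))
          (fun uw => isBasis p S uw.1 uw.2).

Definition absd (p : nat) (S : nat -> padic) : R :=
  let u := (perpBasis p S).1 in let w := (perpBasis p S).2 in
  absp p (fun k => red p k (BL p u u k * BL p w w k - BL p u w k * BL p w u k)%R).

(* zeta_p(S^perp; s) for an integer s >= 1, with the Haar measure on
   S^perp = Z_p u + Z_p w normalised by vol = 1 *)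
Definition zeta_perp (p : nat) (S : nat -> padic) (s : nat) : R :=
  let u := (perpBasis p S).1 in let w := (perpBasis p S).2 in
  let Qv := fun xy : nat -> padic => QL p (lin p (xy 0%N) u (xy 1%N) w) in
  Rdiv (haarV p 2 (fun xy => absp p (Qv xy) ^ (s - 1)))
       (haarV p 2 (fun xy => if Qv xy 1%N != 0%R then 1%R else 0%R)).

Definition SOequiv (p : nat) (S S' : nat -> padic) : Prop :=
  exists g, SOset p 0 g /\ forall i, (i < 3)%N -> zeq (matvec p 3 g S i) (S' i).

Definition orbit_reps (p : nat) (q : padic) (reps : seq (nat -> padic)) : Prop :=
  [/\ (forall S, List.In S reps -> inL p S /\ zeq (QL p S) q),
      (forall S, inL p S -> zeq (QL p S) q ->
          exists S', List.In S' reps /\ SOequiv p S' S) &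
      (forall i j, (i < size reps)%N -> (j < size reps)%N -> i <> j ->
          ~ SOequiv p (nth (fun _ => zero) reps i) (nth (fun _ => zero) reps j))].

(* Main.v *)
(** All quantities depend only on [p], [s], the valuation [v] of [q] and the
    class of the unit part of [q] modulo squares.  Put [X = p^-s].

    Orbits: a vector [S] of determinant [q] is [p^l] times a primitive vector,
    and primitive vectors of equal determinant are conjugate, so the orbits are
    represented by [p^l (1, q/p^(2l), 0)] with [2l <= v].  The orthogonal
    complement of such a vector is isometric to the binary form
    [- (q/p^(2l)) a^2 - c^2], whose zeta integral is computed by a recursion
    that lowers the valuation of the first coefficient by 2.

    Measures: Hensel's lemma for [X^T G X = B] turns both canonical volumes into
    point counts over [F_p].  This gives [lambda_p = 1 - X^2] from the order of
    the finite orthogonal group; for [mu_p], splitting the solutions of [Q = q]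
    into primitive ones and multiples of [p] gives a recursion in [v] with step
    2.  The identity then reduces to one between rational functions of [p] and
    [X], proved by induction on [v] with step 2. *)

(* Oddness of [p] is what permits division by 2: a form may be replaced by its Gram matrix modulo
   every [p^k], the derivative of [X^T G X] is onto the symmetric matrices, and the hyperbolic plane
   becomes [<2, -2>]. The exponent [e = s - 1] of [|Q|] is also the number of hyperbolic planes,
   which is why one [X = p^-(e+1)] governs both sides.

   Two things resist plain point counting. The fibre [Q = q] is singular modulo [p] at multiples of
   [p], so a solution modulo [p^k] determines an exact one only up to [p^(k-v)]. And [|Q|^e] is not
   locally constant near the zeros of [Q], so the Riemann sums of the zeta integral need not
   stabilise; they obey linear recursions, and their limits come from a contraction argument.

   The sides are tied together by one bit: whether minus the unit part of [q] is a square modulo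
   [p]. It decides both the number of points on the quadric and the isotropy modulo [p] of a
   unimodular complement, and it matters only for even [v]. *)
Require Import Defs.
From Stdlib Require Import Reals ClassicalEpsilon FunctionalExtensionality.
From Coquelicot Require Import Lim_seq Rbar.
From HB Require Import structures.
From mathcomp Require Import all_boot all_order all_algebra.
From mathcomp Require Import Rstruct.
From mathcomp Require Import ring lra zify.

Set Implicit Arguments.
Unset Strict Implicit.
Unset Printing Implicit Defensive.

Import Order.TTheory GRing.Theory Num.Theory.
Local Open Scope ring_scope.

(** * Sums over residues *)

Section ResidueSums.

Lemma split_ord_proof d d' (i : 'I_d) (j : 'I_d') : (i + d * j < d * d')%N.
Proof.
have := ltn_ord i; have := ltn_ord j; case: d i => [[]//|d] i lj li.
by rewrite -addnS (@leq_trans (d.+1 * j.+1)) ?leq_mul // mulnS; lia.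
Qed.

Definition glue_ord d d' (u : 'I_d * 'I_d') : 'I_(d * d') :=
  Ordinal (split_ord_proof u.1 u.2).

Lemma glue_ord_bij d d' : bijective (@glue_ord d d').
Proof.
have dgt0 (i : 'I_(d * d')) : (0 < d)%N.
  by move: (leq_trans (ltn0Sn i) (ltn_ord i)); rewrite muln_gt0 => /andP[].
have modP (i : 'I_(d * d')) : (i %% d < d)%N by rewrite ltn_mod (dgt0 i).
have divP (i : 'I_(d * d')) : (i %/ d < d')%N.
  by rewrite ltn_divLR ?(dgt0 i) // (mulnC d') ltn_ord.
exists (fun i => (Ordinal (modP i), Ordinal (divP i))) => [[i j]|i].
  have d0 : (0 < d)%N := leq_trans (ltn0Sn i) (ltn_ord i).
  congr (_, _); apply: val_inj => /=.
    by rewrite mulnC addnC modnMDl modn_small.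
  by rewrite mulnC addnC divnMDl // divn_small // addn0.
by apply: val_inj; rewrite /= addnC mulnC -divn_eq.
Qed.

Lemma sum_ord_glue d d' (f : nat -> R) :
  \sum_(x < d * d') f x = \sum_(i < d) \sum_(j < d') f (i + d * j)%N.
Proof.
rewrite pair_big /= (reindex (@glue_ord d d')) //=.
exact/onW_bij/glue_ord_bij.
Qed.

Definition zmx m n d (x : 'M['I_d]_(m, n)) : 'M[int]_(m, n) :=
  map_mx (fun i : 'I_d => (i : nat)%:Z) x.

(** Residues are summed through their integer representatives in [[0, d)], so that summands for
    different moduli [p^k] live on one type and no ring maps between quotients are needed. *)
Definition sumM m n d (f : 'M[int]_(m, n) -> R) : R :=
  \sum_(x : 'M['I_d]_(m, n)) f (zmx x).

(** The low digit [x] modulo [d] and the high digit [y] are separated. With [d = p^k] this is the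
    setting of Hensel lifting; with [d = p] it isolates the multiples of [p]. *)
Lemma sumM_glue m n d d' (f : 'M[int]_(m, n) -> R) :
  sumM (d * d') f = sumM d (fun x => sumM d' (fun y => f (x + d%:Z *: y))).
Proof.
rewrite /sumM pair_big /=.
have [h hK Kh] := @glue_ord_bij d d'.
pose g (u : 'M['I_d]_(m, n) * 'M['I_d']_(m, n)) : 'M['I_(d * d')]_(m, n) :=
  \matrix_(i, j) glue_ord (u.1 i j, u.2 i j).
rewrite (reindex g) /=; last first.
  apply: onW_bij; exists (fun x => (map_mx (fst \o h) x, map_mx (snd \o h) x)).
    by move=> [x y]; congr (_, _); apply/matrixP=> i j; rewrite !mxE /= hK.
  by move=> x; apply/matrixP=> i j; rewrite !mxE /= -surjective_pairing Kh.
apply: eq_bigr => -[x y] _ /=; congr f; apply/matrixP=> i j; rewrite !mxE /=.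
by rewrite PoszD PoszM.
Qed.

Definition periodic m n (d : nat) (T : Type) (f : 'M[int]_(m, n) -> T) :=
  forall x y, f (x + d%:Z *: y) = f x.

Lemma eq_sumM m n d (f g : 'M[int]_(m, n) -> R) :
  f =1 g -> sumM d f = sumM d g.
Proof. by move=> fg; apply: eq_bigr => x _; rewrite fg. Qed.

Lemma sumM_const m n d (c : R) : sumM d (fun _ : 'M[int]_(m, n) => c) = (d ^ (m * n))%:R * c.
Proof. by rewrite /sumM sumr_const card_mx card_ord mulr_natl. Qed.

Lemma sumM_periodic m n d d' (f : 'M[int]_(m, n) -> R) : periodic d f ->
  sumM (d * d') f = (d' ^ (m * n))%:R * sumM d f.
Proof.
move=> pf; rewrite sumM_glue /sumM mulr_sumr; apply: eq_bigr => x _.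
rewrite -/(sumM d' (fun y => f (zmx x + d%:Z *: y))).
by rewrite (eq_sumM _ (g := fun _ => f (zmx x))) ?sumM_const.
Qed.

Lemma sumM_Zp m n d (g : 'M['Z_d]_(m, n) -> R) : (1 < d)%N ->
  sumM d (fun x => g (map_mx intr x)) = \sum_y g y.
Proof.
move=> d1; have e := Zp_cast d1.
rewrite (reindex (fun x : 'M['I_d]_(m, n) => map_mx (cast_ord (esym e)) x)) /=.
  apply: eq_bigr => x _; congr g; apply/matrixP=> i j; rewrite !mxE.
  by rewrite -pmulrn -[RHS]natr_Zp.
apply: onW_bij; exists (map_mx (cast_ord e)).
  by move=> x; apply/matrixP=> i j; rewrite !mxE; apply: val_inj.
by move=> x; apply/matrixP=> i j; rewrite !mxE; apply: val_inj.
Qed.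

Lemma sumM_Fp m n p (g : 'M['F_p]_(m, n) -> R) : prime p ->
  sumM p (fun x => g (map_mx intr x)) = \sum_y g y.
Proof.
by move=> pr; rewrite -{1}(pdiv_id pr) sumM_Zp // pdiv_id // prime_gt1.
Qed.

Lemma intr_Zp_eq0 d (z : int) : (1 < d)%N -> (z%:~R == 0 :> 'Z_d) = (d %| z)%Z.
Proof.
move=> d1; rewrite dvdzE; case: z => n /=.
  by rewrite -pmulrn -val_eqE /= val_Zp_nat.
by rewrite NegzE mulrNz oppr_eq0 -pmulrn -val_eqE /= val_Zp_nat.
Qed.

Lemma intr_Fp_eq0 p (z : int) : prime p -> (z%:~R == 0 :> 'F_p) = (p %| z)%Z.
Proof.
by move=> pr; rewrite (intr_Zp_eq0 (d := pdiv p)) pdiv_id // prime_gt1.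
Qed.

Lemma intr_Fp_eq p (x y : int) : prime p ->
  (x%:~R == y%:~R :> 'F_p) = (x == y %[mod p])%Z.
Proof. by move=> pr; rewrite -subr_eq0 -mulrzBr intr_Fp_eq0 // eqz_mod_dvd. Qed.

Lemma intr_Zp_eq d (x y : int) : (1 < d)%N ->
  (x%:~R == y%:~R :> 'Z_d) = (x == y %[mod d])%Z.
Proof. by move=> pr; rewrite -subr_eq0 -mulrzBr intr_Zp_eq0 // eqz_mod_dvd. Qed.

Definition ind (b : bool) : R := b%:R.

Lemma sum_ind (T : finType) (P : pred T) : \sum_x ind (P x) = #|P|%:R.
Proof.
rewrite -sum1_card natr_sum [RHS]big_mkcond /=; apply: eq_bigr => x _.
by rewrite /ind -[x \in P]/(P x); case: (P x).
Qed.

End ResidueSums.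

(** * Orthogonal groups and spheres over a finite field *)

Section OrthogonalGroup.

Variable F : finFieldType.
Hypothesis two_neq0 : 2%:R != 0 :> F.

Definition bil n (G : 'M[F]_n) (x y : 'cV[F]_n) : F := (x^T *m G *m y) 0 0.

Lemma bilE n (G : 'M[F]_n) x y : x^T *m G *m y = (bil G x y)%:M.
Proof. by rewrite [LHS]mx11_scalar. Qed.

Definition sphere n (G : 'M[F]_n) (c : F) : pred 'cV[F]_n :=
  fun x => bil G x x == c.

Definition isometry n (G : 'M[F]_n) : pred 'M[F]_n :=
  fun X => X^T *m G *m X == G.

Lemma bilDl n (G : 'M[F]_n) x y z : bil G (x + y) z = bil G x z + bil G y z.
Proof. by rewrite /bil linearD /= !mulmxDl mxE. Qed.
Lemma bilDr n (G : 'M[F]_n) x y z : bil G z (x + y) = bil G z x + bil G z y.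
Proof. by rewrite /bil mulmxDr mxE. Qed.
Lemma bilNl n (G : 'M[F]_n) x z : bil G (- x) z = - bil G x z.
Proof. by rewrite /bil linearN /= !mulNmx mxE. Qed.
Lemma bilNr n (G : 'M[F]_n) x z : bil G z (- x) = - bil G z x.
Proof. by rewrite /bil mulmxN mxE. Qed.
Lemma bilC n (G : 'M[F]_n) x y : G^T = G -> bil G x y = bil G y x.
Proof.
move=> sG; rewrite /bil.
have -> : y^T *m G *m x = (x^T *m G *m y)^T by rewrite !trmx_mul trmxK sG mulmxA.
by rewrite [RHS]mxE.
Qed.

(** [T] is the reflection along the anisotropic vector [w]. Being an involution, it supplies its own
    inverse wherever a bijection is needed. *)
Lemma reflection n (G : 'M[F]_n) (w : 'cV_n) : G^T = G -> bil G w w != 0 ->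
  let T := 1%:M - (2%:R / bil G w w) *: (w *m w^T *m G) in
  [/\ T *m T = 1%:M, isometry G T &
      forall x, T *m x = x - (2%:R * bil G w x / bil G w w) *: w].
Proof.
move=> sG wn0 T; set b := bil G w w in wn0 T *.
pose M := w *m w^T *m G; pose t := 2%:R / b.
have tb : t * b = 2%:R by rewrite /t divfK.
have MM : M *m M = b *: M.
  rewrite /M -!mulmxA (mulmxA w^T G) (mulmxA (w^T *m G) w) bilE -/b.
  by rewrite mul_scalar_mx -!scalemxAr.
have GM : M^T *m G = G *m M by rewrite /M !trmx_mul trmxK sG !mulmxA.
have T2 : T *m T = 1%:M.
  rewrite /T -/M -/t mulmxBl mul1mx mulmxBr mulmx1 -scalemxAl -scalemxAr MM !scalerA -mulrA tb.
  rewrite -scalerBl (_ : t - t * 2%:R = - t); last by ring.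
  by rewrite scaleNr opprK subrK.
split=> //.
  rewrite /isometry.
  have Tt : T^T = 1%:M - t *: M^T by rewrite /T linearB /= linearZ /= trmx1.
  have -> : T^T *m G *m T = (T *m T)^T *m G.
    rewrite trmx_mul -!mulmxA; congr (_ *m _).
    by rewrite Tt /T -/M -/t mulmxBr mulmxBl mulmx1 mul1mx -scalemxAl -scalemxAr GM.
  by rewrite T2 trmx1 mul1mx.
move=> x; rewrite mulmxBl mul1mx -scalemxAl -/M /M -!mulmxA [w^T *m _]mulmxA bilE.
by rewrite mul_mx_scalar scalerA mulrAC.
Qed.

(** The norms of [u - v] and [u + v] add up to [4c], which is nonzero, so one of them is
    anisotropic. The reflection along [u - v] sends [u] to [v]; the one along [u + v] sends [u] to
    [-v] and is then negated. *)
Lemma sphere_transitive n (G : 'M[F]_n) (u v : 'cV_n) c : G^T = G -> c != 0 ->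
  sphere G c u -> sphere G c v ->
  exists2 T, T *m T = 1%:M /\ isometry G T & T *m u = v.
Proof.
move=> sG c0 /eqP uc /eqP vc.
have Euv w : w = v \/ w = - v -> bil G (u - w) (u - w) = 2%:R * (c - bil G u w).
  move=> wv; rewrite !(bilDl, bilDr, bilNl, bilNr) (bilC w u sG) uc.
  have -> : bil G w w = c by case: wv => ->; rewrite ?(bilNl, bilNr) ?opprK.
  ring.
have move_to w : w = v \/ w = - v -> bil G (u - w) (u - w) != 0 ->
    exists2 T, T *m T = 1%:M /\ isometry G T & T *m u = w.
  move=> wv n0; have [T2 To Tx] := reflection sG n0.
  eexists; first by split; [exact: T2 | exact: To].
  rewrite Tx; have -> : 2%:R * bil G (u - w) u = bil G (u - w) (u - w).
    by rewrite (Euv w wv) bilDl bilNl uc (bilC w u sG).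
  by rewrite divff // scale1r opprB addrC subrK.
have [uv|] := boolP (bil G (u - v) (u - v) == 0); last first.
  by move/move_to; apply; left.
have n0 : bil G (u - - v) (u - - v) != 0.
  move: uv; rewrite !Euv ?bilNr; [|by right|by left].
  rewrite !mulf_eq0 (negbTE two_neq0) /= subr_eq0 => /eqP <-.
  by rewrite opprK -mulr2n -mulr_natl mulf_neq0.
have [T [T2 To] Tu] := move_to _ (or_intror erefl) n0.
exists (- T); last by rewrite mulNmx Tu opprK.
split; first by rewrite mulNmx mulmxN opprK.
have -> : isometry G (- T) = isometry G T; last by [].
by rewrite /isometry (_ : (- T)^T = - T^T) ?mulNmx ?mulmxN ?mulNmx ?opprK // linearN.
Qed.

Definition dsum n (a : F) (G : 'M[F]_n) : 'M[F]_(1 + n) := block_mx a%:M 0 0 G.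

Lemma bil_dsum n a (G : 'M[F]_n) (x y : 'cV_1) u v :
  bil (dsum a G) (col_mx x u) (col_mx y v) = a * x 0 0 * y 0 0 + bil G u v.
Proof.
rewrite /bil /dsum tr_col_mx mul_row_block !mulmx0 addr0 add0r mul_row_col mxE.
congr (_ + _); rewrite [x]mx11_scalar [y]mx11_scalar tr_scalar_mx -!scalar_mxM.
by rewrite !mxE eqxx !mulr1n [x 0 0 * a]mulrC.
Qed.

(** An isometry that fixes a vector of nonzero norm [a] preserves its orthogonal complement: the
    upper right block [B] satisfies [a B = 0]. *)
Lemma isometry_fix n a (G : 'M[F]_n) (X : 'M_(1 + n)) : a != 0 ->
  isometry (dsum a G) X && (lsubmx X == col_mx 1%:M 0) =
  (X == block_mx 1%:M 0 0 (drsubmx X)) && isometry G (drsubmx X).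
Proof.
move=> a0; apply/idP/idP.
  case/andP=> iX /eqP lX.
  have eX : X = block_mx 1%:M (usubmx (rsubmx X)) 0 (drsubmx X).
    suff e : X = block_mx 1%:M (usubmx (rsubmx X)) 0 (dsubmx (rsubmx X)).
      by rewrite [X in drsubmx X]e block_mxKdr.
    by rewrite block_mxEh -lX vsubmxK hsubmxK.
  move: iX; rewrite {1}eX; set B := usubmx _; set D := drsubmx X.
  rewrite /isometry /dsum tr_block_mx !mulmx_block !trmx0 !trmx1.
  rewrite !mul0mx !mulmx0 !mul1mx !addr0 !mulmx1 ?add0r.
  move=> /eqP/eq_block_mx[_ aB _ DGD].
  have B0 : B = 0.
    apply/eqP; move/eqP: aB; rewrite mul0mx addr0 mul_scalar_mx scaler_eq0 (negbTE a0) /=.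
    by [].
  rewrite [X in X == _]eX -/B -/D B0 eqxx /=.
  by move: DGD; rewrite B0 trmx0 !mul0mx add0r => ->.
case/andP=> /eqP -> ; set D := drsubmx X; rewrite block_mxKdr => /eqP DG.
rewrite /isometry /dsum tr_block_mx !mulmx_block !trmx0 !trmx1 !mul0mx !mulmx0.
rewrite !mul1mx !mulmx1 !addr0 !add0r !mul0mx DG eqxx /=.
by rewrite block_mxEh row_mxKl eqxx.
Qed.

Definition cardO n (G : 'M[F]_n) : nat := #|isometry G|.
Definition cardS n (G : 'M[F]_n) (c : F) : nat := #|sphere G c|.

Lemma tr_dsum n a (G : 'M[F]_n) : G^T = G -> (dsum a G)^T = dsum a G.
Proof. by move=> sG; rewrite /dsum tr_block_mx tr_scalar_mx !trmx0 sG. Qed.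

(** Orbit-stabiliser: the first column of an isometry lies on the sphere of norm [a], the group acts
    transitively there, and each fibre is a translate of the stabiliser of the first basis
    vector. *)
Lemma cardO_dsum n a (G : 'M[F]_n) : a != 0 -> G^T = G ->
  cardO (dsum a G) = (cardS (dsum a G) a * cardO G)%N.
Proof.
move=> a0 sG; set D := dsum a G; have sD : D^T = D := tr_dsum a sG.
pose e : 'cV[F]_(1 + n) := col_mx 1%:M 0.
have Xe (X : 'M[F]_(1 + n)) : X *m e = lsubmx X.
  by rewrite -{1}[X]hsubmxK mul_row_col mulmx1 mulmx0 addr0.
have eS : sphere D a e.
  by rewrite /sphere bil_dsum mxE mulr1n !mulr1 /bil mulmx0 mxE addr0.
rewrite /cardO /cardS -[X in X = _]sum1_card.
rewrite (partition_big (fun X => lsubmx X) (sphere D a)) /=; last first.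
  move=> X /eqP iX; rewrite /sphere -Xe /bil trmx_mul -!mulmxA (mulmxA D) (mulmxA X^T).
  by rewrite (mulmxA X^T) iX mulmxA.
rewrite -sum_nat_const; apply: eq_bigr => v vS.
have [T [T2 /eqP To] Te] := sphere_transitive sD a0 eS vS.
rewrite (reindex (fun X => T *m X)) /=; last first.
  by apply: onW_bij; exists (fun X => T *m X) => X; rewrite mulmxA T2 mul1mx.
rewrite -sum1_card.
have TI : injective (fun x : 'cV_(1 + n) => T *m x).
  by move=> x y /(congr1 (mulmx T)); rewrite !mulmxA T2 !mul1mx.
rewrite (eq_bigl (fun X => isometry D X && (lsubmx X == e))); last first.
  move=> X; rewrite -!Xe -mulmxA -Te (inj_eq TI); congr (_ && _).
  rewrite -[_ \in _]/(_ == _) trmx_mul -!mulmxA (mulmxA T^T) (mulmxA (T^T *m D)).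
  by rewrite To !mulmxA.
rewrite (eq_bigl _ _ (fun X => isometry_fix G X a0)).
rewrite (reindex_onto (fun Y => block_mx 1%:M 0 0 Y) (fun X => drsubmx X)) /=.
  by apply: eq_bigl => Y; rewrite !block_mxKdr !eqxx !andbT.
by move=> X /andP[/eqP].
Qed.

Lemma cardS_dsum n a (G : 'M[F]_n) c :
  cardS (dsum a G) c = (\sum_(x : F) cardS G (c - a * x ^+ 2)%R)%N.
Proof.
rewrite /cardS -sum1_card.
rewrite (partition_big (fun X : 'cV_(1 + n) => usubmx X 0 0) predT) //=.
apply: eq_bigr => x _; rewrite -sum1_card.
rewrite (reindex_onto (fun Y : 'cV_n => col_mx (x%:M : 'M_1) Y)
   (fun X : 'cV_(1 + n) => dsubmx X)) /=; last first.
  move=> X /andP[_ /eqP <-]; rewrite -[RHS]vsubmxK; congr col_mx.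
  by rewrite [RHS]mx11_scalar.
apply: eq_bigl => Y; rewrite -[_ \in _]/(bil _ _ _ == c) -[_ \in _]/(bil _ _ _ == _).
rewrite bil_dsum col_mxKu col_mxKd !mxE eqxx mulr1n !eqxx !andbT.
rewrite [RHS]eq_sym subr_eq eq_sym addrC.
by rewrite -mulrA -expr2.
Qed.

Lemma congr_bil n (G P : 'M[F]_n) x y :
  bil (P^T *m G *m P) x y = bil G (P *m x) (P *m y).
Proof. by rewrite /bil trmx_mul !mulmxA. Qed.

Lemma cardS_congr n (G P : 'M[F]_n) c : P \in unitmx ->
  cardS (P^T *m G *m P) c = cardS G c.
Proof.
move=> uP; rewrite /cardS -!sum1_card [RHS](reindex (mulmx P)) /=.
  by apply: eq_bigl => x; rewrite -[_ \in _]/(bil _ _ _ == c) congr_bil.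
by apply: onW_bij; exists (mulmx (invmx P)) => x; rewrite ?mulKmx ?mulKVmx.
Qed.

Lemma cardO_congr n (G P : 'M[F]_n) : P \in unitmx ->
  cardO (P^T *m G *m P) = cardO G.
Proof.
move=> uP; rewrite /cardO -!sum1_card [RHS](reindex (fun X => P *m X *m invmx P)) /=.
  apply: eq_bigl => X.
  rewrite -[_ \in _]/(_ == _) -[RHS]/(_ == _).
  pose f (Z : 'M[F]_n) := (invmx P)^T *m Z *m invmx P.
  have fI : injective f.
    apply: (can_inj (g := fun Z => P^T *m Z *m P)) => Z.
    rewrite /f !mulmxA -trmx_mul mulVmx // trmx1 mul1mx -mulmxA mulVmx //.
    by rewrite mulmx1.
  have fG : f (P^T *m G *m P) = G.
    rewrite /f !mulmxA -trmx_mul mulmxV // trmx1 mul1mx -mulmxA mulmxV //.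
    by rewrite mulmx1.
  by rewrite -(inj_eq fI) fG /f !trmx_mul !mulmxA.
apply: onW_bij; exists (fun X => invmx P *m X *m P) => X.
  by rewrite !mulmxA mulVmx // mul1mx -!mulmxA mulVmx // mulmx1.
by rewrite !mulmxA mulmxV // mul1mx -!mulmxA mulmxV // mulmx1.
Qed.

End OrthogonalGroup.

(** * Point counts for split diagonal forms *)

Section DiagonalCounts.

Variable F : finFieldType.
Hypothesis two_neq0 : 2%:R != 0 :> F.
Let q : R := #|F|%:R.

(** The diagonal is a function on [nat], so that dropping the first coordinate is [d \o S], without
    casts on indices. *)
Definition dmx n (d : nat -> F) : 'M[F]_n := \matrix_(i, j) (d i *+ (i == j :> nat)).

Lemma dmxS n d : dmx (1 + n) d = dsum (d 0%N) (dmx n (d \o S)).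
Proof.
apply/matrixP=> i j; rewrite -(@splitK 1 n i) -(@splitK 1 n j).
case: (split (i : 'I_(1 + n))) => [i'|i']; case: (split (j : 'I_(1 + n))) => [j'|j'] /=; rewrite [LHS]mxE.
- by rewrite /dsum block_mxEul mxE !ord1.
- by rewrite /dsum block_mxEur mxE !ord1.
- by rewrite /dsum block_mxEdl mxE !ord1.
- by rewrite /dsum block_mxEdr mxE.
Qed.

Lemma tr_dmx n d : (dmx n d)^T = dmx n d.
Proof.
apply/matrixP=> i j; rewrite !mxE eq_sym.
by case: eqP => // ->.
Qed.

Lemma cardS_dmxS n d c :
  cardS (dmx n.+1 d) c = (\sum_(x : F) cardS (dmx n (d \o S)) (c - d 0%N * x ^+ 2)%R)%N.
Proof. by rewrite dmxS cardS_dsum. Qed.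

Lemma cardS_dmx0 d c : cardS (dmx 0 d) c = (c == 0).
Proof.
rewrite /cardS; case: eqP => [->|c0].
  rewrite -[RHS](_ : #|{: 'cV[F]_0}| = 1%N); last by rewrite card_mx mul0n expn0.
  by apply: eq_card => x; rewrite -[_ \in _]/(_ == _) /bil [x]flatmx0 mulmx0 mxE eqxx.
rewrite eq_card0 // => x; rewrite -[_ \in _]/(_ == _) /bil [x]flatmx0 mulmx0 mxE.
by apply/eqP => e; apply: c0.
Qed.

Lemma sum_cardS n d : \sum_(c : F) (cardS (dmx n d) c)%:R = q ^+ n :> R.
Proof.
elim: n d => [|n IH] d.
  rewrite (bigD1 0) //= cardS_dmx0 eqxx big1 ?addr0 ?expr0 // => c c0.
  by rewrite cardS_dmx0 (negbTE c0).
under eq_bigr => c _ do rewrite cardS_dmxS natr_sum.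
rewrite exchange_big /=.
transitivity (\sum_(x : F) q ^+ n); last by rewrite sumr_const exprS mulr_natl.
apply: eq_bigr => x _; rewrite -(IH (d \o S)).
rewrite [RHS](reindex (fun c => c - d 0%N * x ^+ 2)) //=.
by apply: onW_bij; exists (fun c : F => c + d 0%N * x ^+ 2) => c; rewrite ?subrK ?addrK.
Qed.

Lemma cardS_hyp n d c : d 0%N = 2%:R -> d 1%N = - 2%:R ->
  (cardS (dmx n.+2 d) c)%:R =
  (q - 1) * q ^+ n + q * (cardS (dmx n (fun i => d i.+2)) c)%:R :> R.
Proof.
move=> d0 d1; pose f c : R := (cardS (dmx n (fun i => d i.+2)) c)%:R.
have fE : (cardS (dmx n.+2 d) c)%:R = \sum_(x : F) \sum_(y : F) f (c - 2%:R * (x ^+ 2 - y ^+ 2)).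
  rewrite cardS_dmxS natr_sum; apply: eq_bigr => x _.
  rewrite cardS_dmxS natr_sum; apply: eq_bigr => y _.
  by rewrite /f /= d0 d1; congr (cardS _ _)%:R; ring.
have fourN : 8%:R != 0 :> F by rewrite (_ : 8%:R = 2%:R ^+ 3) ?expf_neq0 //; ring.
(* With [x = s + t] and [y = s - t] the plane [2x^2 - 2y^2] becomes [8st]. For [s != 0] the argument
   [c - 8st] runs through all of [F] and the total count [q^n] appears; [s = 0] leaves [q] copies of
   the count at [c]. *)
rewrite fE pair_big /= (reindex (fun u : F * F => (u.1 + u.2, u.1 - u.2))) /=; last first.
  apply: onW_bij; exists (fun u : F * F => ((u.1 + u.2) / 2%:R, (u.1 - u.2) / 2%:R)).
    by move=> [x y]; congr (_, _) => /=; field.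
  by move=> [x y]; congr (_, _) => /=; field.
transitivity (\sum_(s : F) \sum_(t : F) f (c - 8%:R * s * t)).
  by rewrite [RHS]pair_big /=; apply: eq_bigr => -[s t] _; congr f => /=; ring.
rewrite (bigD1 0) //= addrC; congr (_ + _).
  transitivity (\sum_(s : F | s != 0) q ^+ n).
    apply: eq_bigr => s s0; rewrite -(sum_cardS n (fun i => d i.+2)) [RHS](reindex (fun t => c - 8%:R * s * t)) //.
    apply: onW_bij; exists (fun m : F => (c - m) / (8%:R * s)) => t.
      by field; rewrite s0.
    by field; rewrite s0.
  rewrite sumr_const -[LHS]mulr_natl; congr (_ * _).
  have := cardD1 (0 : F) F; rewrite /q => ->; rewrite inE natrD addrAC subrr add0r.
  by congr _%:R; apply: eq_card => x; rewrite !inE andbT.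
transitivity (\sum_(t : F) f c); first by apply: eq_bigr => t _; rewrite mulr0 mul0r subr0.
by rewrite sumr_const -[LHS]mulr_natl.
Qed.

(* The form <-2> + H^t, with H diagonalised as <2, -2>; [dW] is its tail. *)
Definition dL (i : nat) : F := if odd i then 2%:R else - 2%:R.
Definition dW (i : nat) : F := if odd i then - 2%:R else 2%:R.

Lemma card_gt0 : q != 0.
Proof. by rewrite pnatr_eq0 -lt0n; apply/card_gt0P; exists 0. Qed.

(** The factor [q] on the left avoids the exponents [2t - 1] and [t - 1], which would be negative at
    [t = 0]. *)
Lemma cardS_W t c :
  q * (cardS (dmx (2 * t) dW) c)%:R = q ^+ (2 * t) - q ^+ t + q ^+ t.+1 * (c == 0)%:R.
Proof.
elim: t c => [|t IH] c; first by rewrite cardS_dmx0 !expr0 expr1; ring.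
have e : (2 * t.+1 = (2 * t).+2)%N by rewrite mulnS.
have dWE : (fun i => dW i.+2) = dW by apply: functional_extensionality => i; rewrite /dW /= negbK.
rewrite e cardS_hyp // dWE mulrDr IH !exprS; ring.
Qed.

(* For [c != 0] this is 1 plus the quadratic character of [-2c]. *)
Definition sqc (c : F) : R := #|[pred x : F | c == - 2%:R * x ^+ 2]|%:R.

Lemma cardS_L t c :
  (cardS (dmx (2 * t).+1 dL) c)%:R = q ^+ (2 * t) - q ^+ t + q ^+ t * sqc c.
Proof.
have q0 := card_gt0; apply: (mulfI q0).
have dLE : dL \o S = dW by apply: functional_extensionality => i; rewrite /dW /dL /=; case: odd.
rewrite cardS_dmxS natr_sum dLE mulr_sumr.
under eq_bigr => x _ do rewrite cardS_W.
rewrite big_split /= sumr_const -[X in X + _]mulr_natl -mulr_sumr.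
have -> : \sum_(x : F) ((c - dL 0%N * x ^+ 2 == 0)%:R : R) = sqc c.
  rewrite /sqc -sum_ind; apply: eq_bigr => x _.
  by rewrite subr_eq0.
rewrite -/q exprS; ring.
Qed.

Lemma sqc_m2 : sqc (- 2%:R) = 2%:R.
Proof.
rewrite /sqc (eq_card (B := pred2 1 (-1))); last first.
  move=> x; rewrite !inE -subr_eq0 (_ : _ - _ = 2%:R * (x ^+ 2 - 1)); last by ring.
  by rewrite mulf_eq0 (negbTE two_neq0) -[X in _ - X](expr1n _ 2) subr_sqr mulf_eq0 subr_eq0 addr_eq0.
rewrite card2 -addr_eq0 -(natrD _ 1 1) two_neq0 //.
Qed.

Definition ordO t : R := (cardO (dmx (2 * t).+1 dL))%:R.

(** Two orbit-stabiliser steps remove one entry [-2] and one entry [2]. The spheres have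
    [q^(2t+2) + q^(t+1)] and [q^(2t+1) - q^t] points, whose product is the stated factor. *)
Lemma ordO_rec t :
  ordO t.+1 = q ^+ (2 * t).+1 * (q ^+ (2 * t).+2 - 1) * ordO t.
Proof.
have q0 := card_gt0.
have dLE : dL \o S = dW by apply: functional_extensionality => i; rewrite /dW /dL /=; case: odd.
have dWE : dW \o S = dL by apply: functional_extensionality => i; rewrite /dW /dL /=; case: odd.
have nz : dL 0%N != 0 by rewrite oppr_eq0.
have e : (2 * t.+1 = (2 * t).+2)%N by rewrite mulnS.
rewrite /ordO e dmxS cardO_dsum ?tr_dmx // natrM -dmxS -e cardS_L sqc_m2 dLE.
rewrite e dmxS cardO_dsum ?tr_dmx // natrM -dmxS dWE.
have := cardS_W t.+1 (dW 0%N); rewrite e (negbTE (two_neq0 : dW 0%N != 0)) mulr0 addr0.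
move=> cW.
have -> : (cardS (dmx (2 * t).+2 dW) (dW 0%N))%:R = q ^+ (2 * t).+1 - q ^+ t.
  by apply: (mulfI q0); rewrite cW mulrBr -!exprS.
rewrite mulrA; congr (_ * _).
rewrite !mulSn !mul0n !addn0 !exprS !exprD; ring.
Qed.

Lemma ordO_0 : ordO 0 = 2%:R.
Proof.
have nz : dL 0%N != 0 by rewrite oppr_eq0.
rewrite /ordO muln0 dmxS cardO_dsum ?tr_dmx // natrM -dmxS -(muln0 2) cardS_L sqc_m2.
rewrite muln0 !expr0 subrr add0r mul1r -[RHS]mulr1; congr (_ * _).
rewrite /cardO -[RHS](_ : #|{: 'M[F]_0}|%:R = 1 :> R); last by rewrite card_mx muln0 expn0.
by congr _%:R; apply: eq_card => x; rewrite -[_ \in _]/(_ == _) flatmx0 [X in _ == X]flatmx0 eqxx.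
Qed.

End DiagonalCounts.

(** * The Gram matrix of [L] plus hyperbolic planes over a finite field *)

Section GramMatrix.

(** Dropping the bound [j < dimLH t] makes the coefficients independent of [t], so that the Gram
    matrices are nested and can be diagonalised by induction on [t]. *)
Definition cLH (i j : nat) : int :=
  if (i == 0%N) && (j == 1%N) then 1
  else if (i == 2%N) && (j == 2%N) then -1
  else if [&& (3 <= i)%N, odd i & j == i.+1] then 1 else 0.

Lemma coefLH_intE t i j : (j < dimLH t)%N -> coefLH_int t i j = cLH i j.
Proof. by move=> jt; rewrite /coefLH_int jt andbT. Qed.

Definition gLH (i j : nat) : int :=
  if i == j then 2%:R * cLH i i else if (i < j)%N then cLH i j else cLH j i.

Lemma gLH_sym i j : gLH i j = gLH j i.
Proof. by rewrite /gLH eq_sym; case: ltngtP => // ->. Qed.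

Definition GLH n : 'M[int]_n := \matrix_(i, j) gLH i j.

Lemma tr_GLH n : (GLH n)^T = GLH n.
Proof. by apply/matrixP=> i j; rewrite !mxE gLH_sym. Qed.

Variable F : finFieldType.
Hypothesis two_neq0 : 2%:R != 0 :> F.

Definition GF n : 'M[F]_n := map_mx intr (GLH n).

Definition Hmx : 'M[F]_(1 + 1) := block_mx 0 1%:M 1%:M 0.
Definition Kmx : 'M[F]_(1 + 1) := block_mx 1%:M 1%:M 1%:M (-1)%:M.
Definition Emx : 'M[F]_(1 + 1) := block_mx 2%:R%:M 0 0 (- 2%:R)%:M.

Lemma Kmx_unit : Kmx \in unitmx.
Proof.
suff : Kmx *m (2%:R^-1 *: Kmx) = 1%:M by case/mulmx1_unit.
rewrite -scalemxAr mulmx_block -!scalar_mxM -!raddfD /= !mulr1 !mul1r mulrNN mul1r subrr.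
rewrite scale_block_mx !scale_scalar_mx mulr0 -(natrD _ 1 1) mulVf //.
by rewrite raddf0 -scalar_mx_block.
Qed.

Lemma Kmx_congr : Kmx^T *m Hmx *m Kmx = Emx.
Proof.
rewrite /Kmx tr_block_mx !tr_scalar_mx !mulmx_block !mulmx0 !mulmx1 !add0r !addr0.
rewrite -!scalar_mxM -!raddfD /=; congr block_mx.
- by rewrite mul1r subrr raddf0.
- by rewrite addNr raddf0.
- by congr _%:M; ring.
Qed.

Lemma cLH_ge n k : odd n -> (2 < n)%N -> cLH n k = (k == n.+1)%:R.
Proof. by case: n => [|[|[|n]]] //= on _; rewrite /cLH /= on /=; case: eqP. Qed.

Lemma cLH_ge1 n k : odd n -> (2 < n)%N -> cLH n.+1 k = 0.
Proof. by case: n => [|[|[|n]]] //= on _; rewrite /cLH /= on. Qed.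

Lemma cLH_lt n j k : odd n -> (2 < n)%N -> (j < n)%N -> (n <= k)%N -> cLH j k = 0.
Proof.
move=> on n2 jn nk; rewrite /cLH.
have -> : (k == 1%N) = false by lia.
have -> : (k == 2%N) = false by lia.
rewrite !andbF; case: and3P => // -[_ oj /eqP kj]; suff : odd n = odd j.+1 by rewrite /= oj on.
by congr odd; lia.
Qed.

Lemma GF_add2 n : odd n -> (2 < n)%N -> GF (n + (1 + 1)) = block_mx (GF n) 0 0 Hmx.
Proof.
move=> on n2; apply/matrixP=> i j; rewrite -(splitK i) -(splitK j).
case: (split i) => i'; case: (split j) => j' /=; rewrite [LHS]mxE.
- by rewrite block_mxEul !mxE.
- rewrite block_mxEur !mxE /= /gLH.
  have ij : (i' < n + j')%N by rewrite ltn_addr.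
  by rewrite (ltn_eqF ij) ij (cLH_lt on) ?leq_addr.
- rewrite block_mxEdl !mxE /= gLH_sym /gLH.
  have ij : (j' < n + i')%N by rewrite ltn_addr.
  by rewrite (ltn_eqF ij) ij (cLH_lt on) ?leq_addr.
rewrite block_mxEdr [GLH _ _ _]mxE /= /Hmx.
rewrite -(@splitK 1 1 i') -(@splitK 1 1 j').
case: (split (i' : 'I_(1 + 1))) => a; case: (split (j' : 'I_(1 + 1))) => b /=;
  rewrite ?(block_mxEul, block_mxEur, block_mxEdl, block_mxEdr) !ord1 !mxE /= /gLH;
  rewrite ?addn0 ?addn1 ?eqxx ?(ltn_eqF (ltnSn n)) ?(gtn_eqF (ltnSn n)) ?ltnSn;
  rewrite ?[(n.+1 < n)%N]ltnNge ?leqnSn /= ?cLH_ge1 ?cLH_ge ?eqxx ?mulr0 //.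
by rewrite (ltn_eqF (ltnSn n)) mulr0.
Qed.

(** The columns are the third basis vector of [L] and the sum and difference of the first two; they
    are orthogonal, with [bil]-norms [-2], [2], [-2]. *)
Definition Pmx3 : 'M[F]_3 := \matrix_(i, j)
  (if j == 0%N :> nat then (i == 2%N :> nat)%:R
   else if j == 1%N :> nat then (i != 2%N :> nat)%:R
   else (i == 0%N :> nat)%:R - (i == 1%N :> nat)%:R).

Lemma Pmx3_congr : Pmx3^T *m GF 3 *m Pmx3 = dmx 3 (dL F).
Proof.
apply/matrixP=> i j; rewrite !mxE !big_ord_recl big_ord0 !mxE.
rewrite !big_ord_recl !big_ord0 !mxE.
case: i => [[|[|[|//]]] /= _]; case: j => [[|[|[|//]]] /= _];
  rewrite /gLH /cLH /= /dL /=; rewrite ?mulr0 ?mulr0z ?mulr1z; ring.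
Qed.

Lemma dmx_add2 n : odd n -> dmx (n + (1 + 1)) (dL F) = block_mx (dmx n (dL F)) 0 0 Emx.
Proof.
move=> on; apply/matrixP=> i j; rewrite -(splitK i) -(splitK j).
case: (split i) => i'; case: (split j) => j' /=; rewrite [LHS]mxE.
- by rewrite block_mxEul !mxE.
- by rewrite block_mxEur mxE /= (ltn_eqF (ltn_addr _ _)) ?mulr0n.
- by rewrite block_mxEdl mxE /= gtn_eqF ?mulr0n // ltn_addr.
rewrite block_mxEdr -(@splitK 1 1 i') -(@splitK 1 1 j').
case: (split (i' : 'I_(1 + 1))) => a; case: (split (j' : 'I_(1 + 1))) => b /=;
  rewrite ?(block_mxEul, block_mxEur, block_mxEdl, block_mxEdr) !ord1 !mxE /=;
  rewrite ?addn0 ?addn1 ?eqxx ?(ltn_eqF (ltnSn n)) ?(gtn_eqF (ltnSn n)) ?mulr0n // /dL ?oddS /= on //.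
Qed.

Lemma GF_diag t : exists2 P : 'M[F]_(3 + 2 * t), P \in unitmx &
  P^T *m GF (3 + 2 * t) *m P = dmx (3 + 2 * t) (dL F).
Proof.
elim: t => [|t [P uP PG]].
  exists Pmx3; last exact: Pmx3_congr.
  (* Invertibility of [Pmx3] is read off from the result: the diagonal matrix is invertible, hence
     so is every factor of the congruence. *)
  have uD : dmx 3 (dL F) \in unitmx.
    rewrite unitmxE unitfE.
    have -> : \det (dmx 3 (dL F)) = \prod_(i < 3) dL F i.
      rewrite -[RHS](_ : \prod_(i < 3) (\row_(j < 3) dL F j) 0 i = _).
        rewrite -det_diag; congr (\det _); apply/matrixP=> i j; rewrite !mxE.
        by congr (_ *+ _).
      by apply: eq_bigr => i _; rewrite mxE.
    by rewrite !big_ord_recl big_ord0 /dL /= mulr1 !mulf_neq0 // oppr_eq0.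
  by move: uD; rewrite -Pmx3_congr !unitmx_mul => /andP[].
have e : (3 + 2 * t.+1 = (3 + 2 * t) + (1 + 1))%N by rewrite mulnS; lia.
have on : odd (3 + 2 * t) by rewrite mul2n /= odd_double.
rewrite e; exists (block_mx P 0 0 Kmx).
  by rewrite unitmxE det_ublock unitrM -!unitmxE uP Kmx_unit.
rewrite GF_add2 // dmx_add2 // tr_block_mx !mulmx_block !trmx0 ?mul0mx ?mulmx0 ?mul0mx ?addr0 ?add0r ?mul0mx ?mulmx0.
by rewrite ?addr0 ?add0r PG Kmx_congr.
Qed.

Let q : R := #|F|%:R.

Lemma GF_unit t : GF (3 + 2 * t) \in unitmx.
Proof.
have [P uP PG] := GF_diag t.
suff : P^T *m GF (3 + 2 * t) *m P \in unitmx by rewrite !unitmx_mul unitmx_tr uP andbT => /andP[].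
rewrite PG unitmxE unitfE.
have -> : \det (dmx (3 + 2 * t) (dL F)) = \prod_(i < 3 + 2 * t) dL F i.
  rewrite -[RHS](_ : \prod_(i < 3 + 2 * t) (\row_(j < 3 + 2 * t) dL F j) 0 i = _).
    by rewrite -det_diag; congr (\det _); apply/matrixP=> i j; rewrite !mxE.
  by apply: eq_bigr => i _; rewrite mxE.
by apply/prodf_neq0 => i _; rewrite /dL; case: odd; rewrite ?oppr_eq0.
Qed.

Lemma cardS_GF t c :
  (cardS (GF (3 + 2 * t)) c)%:R = q ^+ (2 * t.+1) - q ^+ t.+1 + q ^+ t.+1 * sqc c.
Proof.
have [P uP PG] := GF_diag t.
by rewrite -(cardS_congr _ c uP) PG -cardS_L // mulnS.
Qed.

Lemma cardO_GF t :
  (cardO (GF (3 + 2 * t)))%:R = 2%:R * \prod_(j < t.+1) (q ^+ (2 * j).+1 * (q ^+ (2 * j).+2 - 1)).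
Proof.
have [P uP PG] := GF_diag t.
rewrite -(cardO_congr _ uP) PG.
have -> : (3 + 2 * t = (2 * t.+1).+1)%N by rewrite mulnS.
rewrite -/(ordO F t.+1); elim: t.+1 => [|n IH].
  by rewrite big_ord0 mulr1 ordO_0.
by rewrite ordO_rec // IH big_ord_recr /= -/q; ring.
Qed.

End GramMatrix.

(** * Hensel lifting for quadratic matrix equations *)

Section FibreCounts.

Variable F : finFieldType.
Hypothesis two_neq0 : 2%:R != 0 :> F.
Let q := #|F|.

Definition antisym n : pred 'M[F]_n := fun Z => Z + Z^T == 0.

Lemma card_antisym n : #|@antisym n| = (q ^ 'C(n, 2))%N.
Proof.
elim: n => [|n IH].
  rewrite -[RHS](_ : #|{: 'M[F]_0}| = _); last by rewrite card_mx muln0.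
  by apply: eq_card => Z; rewrite [RHS]inE; apply/eqP/matrixP=> -[].
rewrite binS bin1 expnD -IH mulnC -[n in X in _ = (X * _)%N]mul1n -card_mx -cardX.
rewrite -[LHS]sum1_card -[RHS]sum1_card.
pose h (u : 'rV[F]_n * 'M[F]_n) : 'M[F]_(1 + n) := block_mx 0 u.1 (- u.1^T) u.2.
rewrite (reindex_onto h (fun Z => (ursubmx Z, drsubmx Z))) /=.
  apply: eq_bigl => -[b D]; rewrite /h /= block_mxKur block_mxKdr eqxx andbT.
  rewrite -[LHS]/(block_mx 0 b (- b^T) D + (block_mx 0 b (- b^T) D)^T == 0) tr_block_mx add_block_mx trmx0 linearN /= trmxK subrr addNr addr0.
  apply/eqP/idP => [/eqP|].
    by rewrite -block_mx0 => /eqP/eq_block_mx[_ _ _ /eqP].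
  by move=> /eqP ->; rewrite block_mx0.
move=> Z /eqP/matrixP ZA; have ZB i j : Z i j = - Z j i.
  by apply/eqP; rewrite -addr_eq0; apply/eqP; have := ZA i j; rewrite !mxE.
rewrite /h /= -[RHS]submxK; congr block_mx; apply/matrixP=> i j; rewrite !mxE.
  rewrite !ord1; have /eqP := ZB (lshift n 0) (lshift n 0).
  by rewrite -addr_eq0 -mulr2n -mulr_natl mulf_eq0 (negbTE two_neq0) => /eqP.
by rewrite [RHS]ZB.
Qed.

(** The linear map [Y] to [A Y + (A Y)^T] is onto the symmetric matrices: [A] has a right inverse
    and [E/2] is a preimage of [E] under symmetrisation. Hence all its fibres have the same size,
    [q^(Nn)] divided by the number of symmetric matrices. *)
Lemma card_symfibre N n (A : 'M[F]_(n, N)) (E : 'M[F]_n) : row_free A -> E^T = E ->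
  (#|[pred Y : 'M[F]_(N, n) | (A *m Y + (A *m Y)^T == E)%R]| * q ^ 'C(n.+1, 2) = q ^ (N * n))%N.
Proof.
move=> /row_freeP[B AB] sE.
pose K := #|[pred Y : 'M[F]_(N, n) | A *m Y == 0]|.
have fib Z : #|[pred Y : 'M[F]_(N, n) | A *m Y == Z]| = K.
  rewrite /K -!sum1_card [LHS](reindex (fun Y => Y + B *m Z)) /=; last first.
    by apply: onW_bij; exists (fun Y => Y - B *m Z) => Y; rewrite ?addrK ?subrK.
  apply: eq_bigl => Y; rewrite !inE mulmxDr mulmxA AB mul1mx -subr_eq0 addrK //.
have count (P : pred 'M[F]_n) : #|[pred Y : 'M[F]_(N, n) | P (A *m Y)]| = (#|P| * K)%N.
  rewrite -sum1_card (partition_big (fun Y => A *m Y) P) //=.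
  rewrite -sum_nat_const; apply: eq_bigr => Z PZ; rewrite -(fib Z) -sum1_card.
  by apply: eq_bigl => Y; rewrite !inE; case: eqP => [->|]; rewrite ?andbF // andbT.
have KE : (q ^ (n * n) * K = q ^ (N * n))%N.
  by rewrite -!card_mx -[in RHS](eq_card (A := [pred Y : 'M[F]_(N, n) | predT (A *m Y)])) // count.
rewrite (count (fun Z => Z + Z^T == E)).
have -> : #|fun Z : 'M[F]_n => Z + Z^T == E| = (q ^ 'C(n, 2))%N.
  rewrite -card_antisym -!sum1_card [LHS](reindex (fun Y => Y + 2%:R^-1 *: E)) /=; last first.
    by apply: onW_bij; exists (fun Y => Y - 2%:R^-1 *: E) => Y; rewrite ?addrK ?subrK.
  apply: eq_bigl => Z; rewrite -[_ \in _]/(_ == _) -[RHS]/(_ == _).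
  rewrite linearD /= linearZ /= sE addrACA -scalerDl.
  have -> : 2%:R^-1 + 2%:R^-1 = 1 :> F by field.
  by rewrite scale1r -subr_eq0 addrK.
rewrite -KE mulnAC -expnD; congr (_ ^ _ * _)%N.
by elim: (n) => // m; rewrite !binS !bin1 !bin0; lia.
Qed.

End FibreCounts.

Section TransposeLinear.
Variables (V : pzRingType) (m n : nat).
Implicit Types A B : 'M[V]_(m, n).
Lemma trmxD A B : (A + B)^T = A^T + B^T. Proof. exact: linearD. Qed.
Lemma trmxB A B : (A - B)^T = A^T - B^T. Proof. exact: linearB. Qed.
Lemma trmxN A : (- A)^T = - A^T. Proof. exact: linearN. Qed.
Lemma trmxZ a A : (a *: A)^T = a *: A^T. Proof. exact: linearZ. Qed.
End TransposeLinear.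

Lemma scalemx_intI m n (c : int) (A B : 'M[int]_(m, n)) : c != 0 -> c *: A = c *: B -> A = B.
Proof.
by move=> c0 /matrixP H; apply/matrixP=> i j; move: (H i j); rewrite !mxE; apply: mulfI.
Qed.

Section Hensel.

Variable p : nat.
Hypothesis p_pr : prime p.
Hypothesis p_odd : p <> 2%N.

Lemma Fp_two_neq0 : 2%:R != 0 :> 'F_p.
Proof.
have := intr_Fp_eq0 2%:Z p_pr; rewrite -pmulrn => ->.
rewrite dvdzE /= dvdn_prime2 //; exact/eqP.
Qed.

Definition dvdM m n (d : int) (A : 'M[int]_(m, n)) : bool :=
  [forall i, forall j, (d %| A i j)%Z].

Lemma dvdMP m n d (A : 'M[int]_(m, n)) : reflect (exists E, A = d *: E) (dvdM d A).
Proof.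
apply: (iffP idP) => [/forallP H|[E ->]].
  exists (\matrix_(i, j) (A i j %/ d)%Z); apply/matrixP=> i j; rewrite !mxE.
  by have /forallP/(_ j) := H i => /divzK; rewrite mulrC.
by apply/forallP=> i; apply/forallP=> j; rewrite mxE dvdz_mulr.
Qed.

Lemma dvdM_Fp m n (A : 'M[int]_(m, n)) : dvdM p A = (map_mx (intr : int -> 'F_p) A == 0).
Proof.
apply/forallP/eqP => [H|/matrixP H i].
  by apply/matrixP=> i j; rewrite !mxE; apply/eqP; rewrite intr_Fp_eq0 //; have /forallP := H i.
by apply/forallP=> j; rewrite -intr_Fp_eq0 //; have := H i j; rewrite !mxE => ->.
Qed.

Variables (N n : nat) (G : 'M[int]_N) (B : 'M[int]_n).
Hypothesis sG : G^T = G.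
Hypothesis sB : B^T = B.

Local Notation phi := (map_mx (intr : int -> 'F_p)).

Variable P : pred 'M['F_p]_(N, n).
Hypothesis PX : forall X, P X -> row_free (X^T *m phi G).

(** [P] is a condition modulo [p] under which the equation is smooth: [X^T G] has full row rank, so
    the derivative is onto the symmetric matrices. It is later instantiated by determinant 1 and by
    being nonzero modulo [p]. *)
Definition solP k (X : 'M[int]_(N, n)) : bool :=
  dvdM (p ^ k)%N (X^T *m G *m X - B) && P (phi X).

Lemma qform_shift k (x y : 'M[int]_(N, n)) :
  (x + (p ^ k)%N%:Z *: y)^T *m G *m (x + (p ^ k)%N%:Z *: y) =
  x^T *m G *m x + (p ^ k)%N%:Z *: (x^T *m G *m y + (x^T *m G *m y)^T + (p ^ k)%N%:Z *: (y^T *m G *m y)).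
Proof.
rewrite trmxD trmxZ !mulmxDl !mulmxDr -!scalemxAl -!scalemxAr !trmx_mul trmxK sG.
by rewrite !scalerDr !addrA mulmxA.
Qed.

Lemma phi_shift k (x y : 'M[int]_(N, n)) : (0 < k)%N -> phi (x + (p ^ k)%N%:Z *: y) = phi x.
Proof.
move=> k0; apply/matrixP=> i j; rewrite !mxE rmorphD rmorphM /=.
suff -> : ((p ^ k)%N%:Z)%:~R = 0 :> 'F_p by rewrite mul0r addr0.
by apply/eqP; rewrite intr_Fp_eq0 // dvdzE /= dvdn_exp.
Qed.

(** Write a candidate modulo [p^(k+1)] as [x + p^k y]. If [x] solves the equation modulo [p^k] with
    error [p^k E], the condition on [y] is linear over [F_p], since the quadratic term carries
    [p^(2k)] and [k >= 1]; [card_symfibre] counts its solutions. *)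
Lemma hensel_count k : (0 < k)%N ->
  sumM (p ^ k.+1) (fun X => ind (solP k.+1 X)) * (p ^ 'C(n.+1, 2))%:R =
  (p ^ (N * n))%:R * sumM (p ^ k) (fun X => ind (solP k X)).
Proof.
move=> k0; rewrite expnSr sumM_glue /sumM mulr_suml mulr_sumr; apply: eq_bigr => x0 _.
move: (zmx x0) => x {x0}; rewrite -/(sumM p (fun y => ind (solP k.+1 (x + (p ^ k)%N%:Z *: y)))).
have pk0 : (p ^ k)%N%:Z != 0 by rewrite eqz_nat -lt0n expn_gt0 prime_gt0.
case: (boolP (solP k x)) => sx; last first.
  rewrite mulr0 (eq_sumM _ (g := fun _ => 0)) ?sumM_const ?mulr0 ?mul0r // => y.
  rewrite (_ : solP _ _ = false) //; apply: contraNF sx => /andP[/dvdMP[E EE]].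
  rewrite phi_shift // /solP => ->; rewrite andbT; apply/dvdMP.
  move: EE; rewrite qform_shift.
  set T := _ + _ *: (y^T *m _ *m _) => EE; exists (p%:Z *: E - T).
  by rewrite scalerBr scalerA -PoszM -expnSr -EE [RHS]addrAC addrK.
have /andP[/dvdMP[E EE] Px] := sx; rewrite mulr1.
have sE : E^T = E.
  have : ((p ^ k)%N%:Z *: E)^T = (p ^ k)%N%:Z *: E.
    by rewrite -EE trmxB sB !trmx_mul trmxK sG mulmxA.
  by rewrite trmxZ => /(scalemx_intI pk0).
pose A := (phi x)^T *m phi G.
have solE y : solP k.+1 (x + (p ^ k)%N%:Z *: y) = (A *m phi y + (A *m phi y)^T == - phi E).
  rewrite /solP phi_shift // Px andbT qform_shift addrAC EE -scalerDr.
  set T := x^T *m G *m y.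
  have -> : A *m phi y = phi T by rewrite /T /A !map_mxM map_trmx.
  rewrite map_trmx -addr_eq0 -!map_mxD -[RHS]dvdM_Fp.
  apply/dvdMP/dvdMP => [[E' E'E]|[E' E'E]].
    exists (E' - (p ^ k.-1)%N%:Z *: (y^T *m G *m y)); rewrite scalerBr scalerA -PoszM -expnS prednK //.
    move: E'E; rewrite expnSr PoszM -scalerA => E'E.
    have -> : p%:Z *: E' = E + (T + T^T + (p ^ k)%N%:Z *: (y^T *m G *m y)).
      exact/esym/(scalemx_intI pk0 E'E).
    by rewrite [X in X - _]addrA addrK addrC.
  exists (E' + (p ^ k.-1)%N%:Z *: (y^T *m G *m y)); rewrite expnSr PoszM -scalerA; congr (_ *: _).
  by rewrite scalerDr scalerA -PoszM -expnS prednK // -E'E addrA; congr (_ + _); rewrite addrC.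
rewrite (eq_sumM _ (fun y => congr1 ind (solE y))).
rewrite (sumM_Fp (fun Y => ind (A *m Y + (A *m Y)^T == - phi E)) p_pr) sum_ind.
have sE' : (- phi E)^T = - phi E by rewrite trmxN map_trmx sE.
by rewrite -natrM; have := card_symfibre Fp_two_neq0 (PX Px) sE'; rewrite card_Fp // => ->.
Qed.

(** The volume of the solutions modulo [p^k], divided by the volume of the ball of radius [p^-k] in
    the space of quadratic forms: the inner quotient in [fibre], up to the density factors. *)
Definition dens k := sumM (p ^ k) (fun X => ind (solP k X)) /
  ((p ^ k) ^ (N * n))%:R * ((p ^ k) ^ 'C(n.+1, 2))%:R.

Lemma dens_const k : (0 < k)%N -> dens k = dens 1.
Proof.
case: k => // k _; elim: k => // k IH; rewrite -IH /dens.
have pn0 m : (p ^ m)%:R != 0 :> R by rewrite pnatr_eq0 -lt0n expn_gt0 prime_gt0.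
have e m : ((p ^ k.+2) ^ m = (p ^ k.+1) ^ m * p ^ m)%N by rewrite expnS expnMn mulnC.
have := hensel_count (ltn0Sn k); set a := sumM _ _; set b := sumM _ _ => H.
rewrite !e !natrM.
have -> : a = (p ^ (N * n))%:R * b / (p ^ 'C(n.+1, 2))%:R by rewrite -H mulfK.
have n1 := pn0 (N * n)%N; have n2 := pn0 'C(n.+1, 2).
have n3 m : ((p ^ k.+1) ^ m)%:R != 0 :> R by rewrite -expnM pn0.
have aux (u v U V c : R) : u != 0 -> v != 0 -> U != 0 ->
    u * c / v / (U * u) * (V * v) = c / U * V.
  by move=> u0 v0 U0; field; rewrite u0 v0 U0.
exact: aux.
Qed.

Lemma dens1E : dens 1 = #|[pred X : 'M['F_p]_(N, n) | (X^T *m phi G *m X == phi B) && P X]|%:R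
  / (p ^ (N * n))%:R * (p ^ 'C(n.+1, 2))%:R.
Proof.
rewrite /dens !expn1; congr (_ / _ * _); rewrite -sum_ind -(sumM_Fp _ p_pr).
apply: eq_sumM => X; rewrite /solP expn1 dvdM_Fp /=; congr (ind (_ && _)).
by rewrite map_mxB !map_mxM map_trmx subr_eq0.
Qed.

End Hensel.

(** * Congruences between integer matrices *)

Section Congruence.

Variable d : int.
Implicit Types m n : nat.

(** Congruence of integer matrices stands in for equality over the rings of residues, so that the
    modulus can vary along a p-adic sequence. *)
Definition eqM m n (A B : 'M[int]_(m, n)) : bool := dvdM d (A - B).

Lemma eqMP m n (A B : 'M[int]_(m, n)) : reflect (exists E, A = B + d *: E) (eqM A B).
Proof.
apply: (iffP (dvdMP _ _)) => -[E EE]; exists E; last by rewrite EE addrC addKr.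
by rewrite -EE addrC subrK.
Qed.

Lemma eqM_refl m n (A : 'M[int]_(m, n)) : eqM A A.
Proof. by apply/eqMP; exists 0; rewrite scaler0 addr0. Qed.

Lemma eqM_sym m n (A B : 'M[int]_(m, n)) : eqM A B = eqM B A.
Proof.
by apply/eqMP/eqMP => -[E ->]; exists (- E); rewrite scalerN addrK.
Qed.

Lemma eqM_trans m n (A B C : 'M[int]_(m, n)) : eqM A B -> eqM B C -> eqM A C.
Proof.
by move=> /eqMP[E ->] /eqMP[E' ->]; apply/eqMP; exists (E' + E); rewrite scalerDr addrA.
Qed.

Lemma eqM_mul m n l (A A' : 'M[int]_(m, n)) (B B' : 'M[int]_(n, l)) :
  eqM A A' -> eqM B B' -> eqM (A *m B) (A' *m B').
Proof.
move=> /eqMP[E ->] /eqMP[E' ->]; apply/eqMP; exists (A' *m E' + E *m B' + d *: (E *m E')).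
rewrite mulmxDl !mulmxDr -!scalemxAl -!scalemxAr !scalerDr scalerA.
by rewrite !addrA.
Qed.

Lemma eqM_add m n (A A' B B' : 'M[int]_(m, n)) :
  eqM A A' -> eqM B B' -> eqM (A + B) (A' + B').
Proof.
by move=> /eqMP[E ->] /eqMP[E' ->]; apply/eqMP; exists (E + E'); rewrite scalerDr addrACA.
Qed.

Lemma eqM_tr m n (A A' : 'M[int]_(m, n)) : eqM A A' -> eqM A^T A'^T.
Proof. by move=> /eqMP[E ->]; apply/eqMP; exists E^T; rewrite trmxD trmxZ. Qed.

Lemma eqM_scale m n (c : int) (A A' : 'M[int]_(m, n)) : eqM A A' -> eqM (c *: A) (c *: A').
Proof. by move=> /eqMP[E ->]; apply/eqMP; exists (c *: E); rewrite scalerDr !scalerA mulrC. Qed.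

Lemma eqM_entry m n (A A' : 'M[int]_(m, n)) :
  reflect (forall i j, (A i j = A' i j %[mod d])%Z) (eqM A A').
Proof.
apply: (iffP forallP) => [H i j|H i].
  by have /forallP/(_ j) := H i; rewrite !mxE -eqz_mod_dvd => /eqP.
by apply/forallP=> j; rewrite !mxE -eqz_mod_dvd; apply/eqP.
Qed.

Lemma eqM_det n (A A' : 'M[int]_n) : eqM A A' -> (\det A = \det A' %[mod d])%Z.
Proof.
move=> /eqM_entry H; rewrite /determinant.
have modD (x x' y y' : int) : (x = x' %[mod d])%Z -> (y = y' %[mod d])%Z ->
  (x + y = x' + y' %[mod d])%Z by move=> e e'; rewrite -modzDm e e' modzDm.
have modM (x x' y y' : int) : (x = x' %[mod d])%Z -> (y = y' %[mod d])%Z ->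
  (x * y = x' * y' %[mod d])%Z by move=> e e'; rewrite -modzMm e e' modzMm.
apply: (big_ind2 (fun x y : int => (x = y %[mod d])%Z)) => // s _.
apply: (modM _ _ _ _ erefl).
apply: (big_ind2 (fun x y : int => (x = y %[mod d])%Z)) => //.
Qed.

End Congruence.

Lemma eqM_dvd m n (d e : int) (A B : 'M[int]_(m, n)) : (d %| e)%Z -> eqM e A B -> eqM d A B.
Proof.
move=> /dvdzP[c ->] /eqMP[E ->]; apply/eqMP; exists (c *: E).
by rewrite scalerA mulrC.
Qed.

Lemma eqM_phi p m n (A B : 'M[int]_(m, n)) : prime p ->
  eqM p A B = (map_mx (intr : int -> 'F_p) A == map_mx (intr : int -> 'F_p) B).
Proof. by move=> pr; rewrite /eqM dvdM_Fp // map_mxB subr_eq0. Qed.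

Lemma lift_Fp p m n (A : 'M['F_p]_(m, n)) : exists B : 'M[int]_(m, n), map_mx intr B = A.
Proof.
exists (map_mx (fun x : 'F_p => (x : nat)%:Z) A); apply/matrixP=> i j; rewrite !mxE.
by rewrite -pmulrn natr_Zp.
Qed.

(** * Lifting one approximate solution to an exact p-adic one *)

Section Newton.

Variable p : nat.
Hypothesis p_pr : prime p.
Hypothesis p_odd : p <> 2%N.
Local Notation phi := (map_mx (intr : int -> 'F_p)).
Variables (N n : nat) (G : 'M[int]_N) (B : nat -> 'M[int]_n).
Hypothesis sG : G^T = G.
Hypothesis sB : forall k, (B k)^T = B k.
Hypothesis cB : forall k, eqM (p ^ k)%N (B k.+1) (B k).
Variables (k0 : nat) (X0 : 'M[int]_(N, n)).
Hypothesis k0_gt0 : (0 < k0)%N.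
Hypothesis sol0 : eqM (p ^ k0)%N (X0^T *m G *m X0) (B k0).
Hypothesis free0 : row_free (phi (X0^T *m G)).

Let pdvd k : (0 < k)%N -> (p%:Z %| (p ^ k)%N%:Z)%Z.
Proof. by move=> k0'; rewrite dvdzE /= dvdn_exp. Qed.

Lemma newton_step k X : (0 < k)%N -> eqM p X X0 -> eqM (p ^ k)%N (X^T *m G *m X) (B k) ->
  exists X', eqM (p ^ k)%N X' X /\ eqM (p ^ k.+1)%N (X'^T *m G *m X') (B k.+1).
Proof.
move=> kgt0 XX0 sX.
have /row_freeP[W0 W0E] := free0; have [W WE] := lift_Fp W0.
(* For odd [p] the integer [(p + 1)/2] inverts 2 modulo [p]. *)
pose h := (p.+1)./2%:Z.
have h2 : 2%:R * h = p%:Z + 1.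
  have op : odd p by have [] := even_prime p_pr.
  have := odd_double_half p.+1; rewrite /= op /= -mul2n /h => e; lia.
have /eqMP[E EE] : eqM (p ^ k)%N (X^T *m G *m X) (B k.+1).
  by apply: eqM_trans sX _; rewrite eqM_sym.
have sE : E^T = E.
  apply: (@scalemx_intI _ _ (p ^ k)%N%:Z); first by rewrite eqz_nat -lt0n expn_gt0 prime_gt0.
  rewrite -trmxZ; have -> : (p ^ k)%N%:Z *: E = X^T *m G *m X - B k.+1.
    by rewrite EE addrC addKr.
  by rewrite trmxB sB !trmx_mul trmxK sG mulmxA.
exists (X + (p ^ k)%N%:Z *: (- h *: (W *m E))); split.
  by apply/eqMP; eexists.
rewrite qform_shift // EE -addrA -scalerDr.
set T := X^T *m G *m _.
have /eqMP[E' E'E] : eqM p (E + (T + T^T)) 0.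
  have TE : eqM p T (- h *: E).
    rewrite /T -scalemxAr; apply: eqM_scale; rewrite mulmxA -[X in eqM _ _ X]mul1mx.
    apply: eqM_mul (eqM_refl _ _).
    rewrite eqM_phi // map_mxM WE.
    have : eqM p (X^T *m G) (X0^T *m G) by apply: eqM_mul (eqM_refl _ _); apply: eqM_tr.
    by rewrite eqM_phi // => /eqP ->; rewrite W0E map_mx1.
  apply: (@eqM_trans _ _ _ _ (E + (- h *: E + - h *: E))).
    apply: (eqM_add (eqM_refl _ _)); apply: (eqM_add TE).
    by have := eqM_tr TE; rewrite trmxZ sE.
  rewrite -scalerDl -[X in X + _]scale1r -scalerDl; apply/eqMP; exists (- E).
  rewrite add0r scalerN -scaleNr; congr (_ *: _).
  by rewrite -[1 + _](addrK (2%:R * h)) [in X in _ - X]h2; ring.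
apply/eqMP; exists (E' + (p ^ k.-1)%N%:Z *: ((- h *: (W *m E))^T *m G *m (- h *: (W *m E)))).
congr (_ + _); rewrite addrA E'E add0r expnSr PoszM -scalerA; congr (_ *: _).
by rewrite scalerDr scalerA -PoszM -expnS prednK.
Qed.

Lemma newton_lift : exists X : nat -> 'M[int]_(N, n),
  [/\ forall k, eqM (p ^ k)%N (X k.+1) (X k),
      forall k, (k0 <= k)%N -> eqM (p ^ k)%N ((X k)^T *m G *m X k) (B k) &
      forall k, (k <= k0)%N -> X k = X0].
Proof.
(* The iterates carry their proofs, because each step needs them. The sequence is then kept constant
   equal to [X0] up to index [k0]: this makes it coherent from index 0 on and records that the limit
   agrees with [X0] modulo [p^k0]. *)
pose T j := {X : 'M[int]_(N, n) | eqM p X X0 /\ eqM (p ^ (k0 + j))%N (X^T *m G *m X) (B (k0 + j))}.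
have step j (X : T j) : {X' : T j.+1 | eqM (p ^ (k0 + j))%N (sval X') (sval X)}.
  case: X => X [XX0 sX] /=.
  have /constructive_indefinite_description[X' [X'X sX']] :=
    newton_step (leq_trans k0_gt0 (leq_addr j k0)) XX0 sX.
  unshelve eexists (exist _ X' _) => //; split; last by rewrite addnS.
  by apply: eqM_trans XX0; apply: eqM_dvd X'X; apply: pdvd; rewrite addn_gt0 k0_gt0.
have P0 : eqM p X0 X0 /\ eqM (p ^ (k0 + 0))%N (X0^T *m G *m X0) (B (k0 + 0)%N).
  by rewrite addn0; split=> //; exact: eqM_refl.
pose T0 : T 0%N := exist _ X0 P0.
pose Xs := fix Xs j : T j := if j is j'.+1 then sval (step j' (Xs j')) else T0.
exists (fun k => sval (Xs (k - k0)%N)); split.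
- move=> k; case: (leqP k0 k) => kk0.
    rewrite subSn //= -[k in (p ^ k)%N](subnKC kk0).
    by case: (step _ _).
  by have -> : (k.+1 - k0 = k - k0)%N; [lia | rewrite eqM_refl].
- move=> k kk0; have [_] := svalP (Xs (k - k0)%N); by move: (sval _) => Y; rewrite subnKC.
- by move=> k kk0; have -> : (k - k0 = 0)%N; first lia.
Qed.
End Newton.

(** * p-adic integers, forms and Haar integrals *)

Section PadicReductions.

Variable p : nat.
Hypothesis p_pr : prime p.
Hypothesis p_odd : p <> 2%N.

Lemma redP k x y : red p k x = red p k y <-> (x = y %[mod (p ^ k)%N])%Z.
Proof. by []. Qed.

Lemma to_red k x y : red p k x = red p k y -> (x = y %[mod (p ^ k)%N])%Z.
Proof. by []. Qed.

Lemma red_dvd k x y : (red p k x == red p k y) = ((p ^ k)%N%:Z %| x - y)%Z.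
Proof. exact: eqz_mod_dvd. Qed.

Lemma red_id k x : red p k (red p k x) = red p k x.
Proof. exact: modz_mod. Qed.

Lemma red_le j k x : (j <= k)%N -> red p j (red p k x) = red p j x.
Proof.
move=> jk; apply/eqP; rewrite red_dvd /red /pk.
have e := divz_eq x (p ^ k)%N.
rewrite {2}e opprD addrCA subrr addr0 -(subnKC jk) expnD.
by rewrite -mulNr PoszM mulrCA dvdz_mulr.
Qed.

Lemma zp_red x k : is_zp p x -> red p k (x k) = x k.
Proof. by move=> zx; rewrite zx red_id. Qed.

Lemma zp_le x j k : is_zp p x -> (j <= k)%N -> x j = red p j (x k).
Proof.
move=> zx; elim: k => [|k IH]; first by rewrite leqn0 => /eqP ->; rewrite zp_red.
rewrite leq_eqVlt => /predU1P[->|]; first by rewrite zp_red.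
by rewrite ltnS => jk; rewrite IH // zx red_le.
Qed.

Lemma red_add k x x' y y' : red p k x = red p k x' -> red p k y = red p k y' ->
  red p k (x + y) = red p k (x' + y').
Proof. by rewrite /red => e e'; rewrite -modzDm e e' modzDm. Qed.

Lemma red_mul k x x' y y' : red p k x = red p k x' -> red p k y = red p k y' ->
  red p k (x * y) = red p k (x' * y').
Proof. by rewrite /red => e e'; rewrite -modzMm e e' modzMm. Qed.

Lemma red_opp k x x' : red p k x = red p k x' -> red p k (- x) = red p k (- x').
Proof. by rewrite -(mulN1r x) -(mulN1r x'); apply: red_mul. Qed.

Lemma is_zp_zint z : is_zp p (zint p z).
Proof. by move=> k; rewrite /zint red_le. Qed.

Lemma red0 x : red p 0 x = 0. Proof. by rewrite /red /pk expn0 modz1. Qed.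

Definition mxk m n (a : nat -> nat -> padic) k : 'M[int]_(m, n) := \matrix_(i, j) a i j k.
Definition vk m (v : nat -> padic) k : 'cV[int]_m := \col_i v i k.

Definition toP m n (X : nat -> 'M[int]_(m, n)) : nat -> nat -> padic :=
  fun i j k => match insub i, insub j with
               | Some i', Some j' => red p k (X k i' j') | _, _ => 0 end.

Lemma toPE m n (X : nat -> 'M[int]_(m, n)) (i : 'I_m) (j : 'I_n) k :
  toP X i j k = red p k (X k i j).
Proof. by rewrite /toP !valK. Qed.

Lemma mxk_toP m n (X : nat -> 'M[int]_(m, n)) k : eqM (p ^ k)%N (mxk m n (toP X) k) (X k).
Proof. by apply/eqM_entry=> i j; rewrite mxE toPE; apply: red_id. Qed.

Lemma zmat_toP m n (X : nat -> 'M[int]_(m, n)) :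
  (forall k, eqM (p ^ k)%N (X k.+1) (X k)) -> zmat p m n (toP X).
Proof.
move=> cX i j im jn k; rewrite -[i]/(val (Ordinal im)) -[j]/(val (Ordinal jn)) !toPE.
by rewrite red_le //; apply/esym/redP; move/eqM_entry: (cX k); apply.
Qed.

Lemma zmat_coh m n a k : zmat p m n a -> eqM (p ^ k)%N (mxk m n a k.+1) (mxk m n a k).
Proof.
move=> za; apply/eqM_entry=> i j; rewrite !mxE; apply/redP; rewrite [in RHS](za _ _ (ltn_ord i) (ltn_ord j)); apply/esym/red_id.
Qed.

Variable c : nat -> nat -> int.
Let cL : nat -> nat -> padic := fun i j => zint p (c i j).

(** The upper triangular matrix represents [Q] itself without halving; its symmetrisation is the
    Gram matrix. *)
Definition upmx m : 'M[int]_m := \matrix_(i, j) (if (i <= j)%N then c i j else 0).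
Definition gramI m : 'M[int]_m :=
  \matrix_(i, j) (if i == j :> nat then 2%:R * c i i else if (i < j)%N then c i j else c j i).

Lemma gramI_up m : gramI m = upmx m + (upmx m)^T.
Proof.
apply/matrixP=> i j; rewrite !mxE; case: ltngtP => [|_|->]; rewrite ?addr0 ?add0r //.
by rewrite mulr_natl.
Qed.

Lemma tr_gramI m : (gramI m)^T = gramI m.
Proof. by rewrite gramI_up trmxD trmxK addrC. Qed.

Definition qf m (v : 'cV[int]_m) : int := (v^T *m upmx m *m v) 0 0.
Definition bf m (v w : 'cV[int]_m) : int := (v^T *m gramI m *m w) 0 0.

Lemma qf_polar m (v w : 'cV[int]_m) : qf (v + w) - qf v - qf w = bf v w.
Proof.
rewrite /qf /bf gramI_up trmxD !mulmxDl !mulmxDr !mulmxDl.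
have -> : v^T *m (upmx m)^T *m w = (w^T *m upmx m *m v)^T by rewrite !trmx_mul trmxK mulmxA.
move: (v^T *m _ *m v) (v^T *m _ *m w) (w^T *m _ *m v) (w^T *m _ *m w) => a b d e.
by rewrite !mxE; ring.
Qed.

Lemma bf_diag m (v : 'cV[int]_m) : bf v v = 2%:R * qf v.
Proof.
rewrite /qf /bf gramI_up mulmxDr mulmxDl.
have -> : v^T *m (upmx m)^T *m v = (v^T *m upmx m *m v)^T by rewrite !trmx_mul trmxK mulmxA.
by rewrite mxE [X in _ + X]mxE mulr_natl.
Qed.

Lemma qf_mod m d (v w : 'cV[int]_m) : eqM d v w -> (qf v = qf w %[mod d])%Z.
Proof.
move=> vw; have : eqM d (v^T *m upmx m *m v) (w^T *m upmx m *m w).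
  exact: (eqM_mul (eqM_mul (eqM_tr vw) (eqM_refl _ _)) vw).
by move/eqM_entry; apply.
Qed.

Lemma qevalE m v k : qeval p m cL v k = red p k (qf (vk m v k)).
Proof.
rewrite /qeval /qf; apply/redP.
have -> : ((vk m v k)^T *m upmx m *m vk m v k) 0 0 =
   \sum_(i < m) \sum_(j < m | (i <= j)%N) c i j * v i k * v j k.
  rewrite mxE; under eq_bigr => j _ do rewrite mxE mulr_suml.
  rewrite exchange_big /=.
  apply: eq_bigr => i _; rewrite [RHS]big_mkcond /=; apply: eq_bigr => j _.
  by rewrite !mxE; case: ifP => _; rewrite ?mulr0 ?mul0r // [v i k * _]mulrC.
apply: (big_ind2 (fun x y : int => (x = y %[mod (p ^ k)%N])%Z)) => //.
  by move=> x x' y y' e e'; rewrite -modzDm e e' modzDm.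
move=> i _; apply: (big_ind2 (fun x y : int => (x = y %[mod (p ^ k)%N])%Z)) => //.
  by move=> x x' y y' e e'; rewrite -modzDm e e' modzDm.
by move=> j _; rewrite -!mulrA -modzMml modz_mod modzMml.
Qed.

Lemma bevalE m v w k : beval p m cL v w k = red p k (bf (vk m v k) (vk m w k)).
Proof.
rewrite /beval !qevalE -qf_polar.
apply: red_add; last by apply: red_opp; apply: red_id.
apply: red_add; last by apply: red_opp; apply: red_id.
rewrite red_id; apply/redP/qf_mod/eqM_entry => i j; rewrite !mxE; apply: red_id.
Qed.

Definition gramK n (cM : nat -> nat -> padic) k : 'M[int]_n :=
  \matrix_(i, j) (if i == j :> nat then 2%:R * cM i i k
                  else if (i < j)%N then cM i j k else cM j i k).

Lemma dvd_two k (z : int) : ((p ^ k)%N%:Z %| 2%:R * z)%Z = ((p ^ k)%N%:Z %| z)%Z.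
Proof.
rewrite Gauss_dvdzr // coprimezE; change (coprime (p ^ k) 2).
by apply: coprimeXl; rewrite prime_coprime // dvdn_prime2 //; apply/eqP.
Qed.

(** Off the diagonal both conditions concern the polar form. On the diagonal the Gram matrix sees
    [2Q] in place of [Q], and 2 is invertible modulo [p^k]. *)
Lemma near_formE m n cM k a : (forall i j, (i <= j < n)%N -> is_zp p (cM i j)) ->
  near_form p m cL n cM k a <->
  eqM (p ^ k)%N ((mxk m n a k)^T *m gramI m *m mxk m n a k) (gramK n cM k).
Proof.
move=> zc; set A := mxk m n a k.
have ent (i j : 'I_n) : (A^T *m gramI m *m A) i j = bf (vk m (Defs.col a i) k) (vk m (Defs.col a j) k).
  rewrite /bf !mxE; apply: eq_bigr => x _; rewrite [A x j]mxE [in RHS]mxE.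
  rewrite [vk _ _ _ _ _]mxE; congr (_ * _); rewrite !mxE; apply: eq_bigr => y _.
  by rewrite ![_^T _ _]mxE !(mxE matrix_key).
have diag (i : 'I_n) : pullback p m cL a i i k = red p k (qf (vk m (Defs.col a i) k)).
  by rewrite /pullback eqxx qevalE.
have off (i j : 'I_n) : i != j :> nat -> pullback p m cL a i j k = red p k ((A^T *m gramI m *m A) i j).
  by move=> ij; rewrite /pullback (negbTE ij) bevalE ent.
have sA : (A^T *m gramI m *m A)^T = A^T *m gramI m *m A.
  by rewrite !trmx_mul trmxK tr_gramI mulmxA.
have sAE i j : (A^T *m gramI m *m A) i j = (A^T *m gramI m *m A) j i.
  by rewrite -[in RHS]sA [RHS]mxE.
split=> [H|/eqM_entry H i j /andP[ij jn]].
  have up (i j : 'I_n) : (i < j)%N -> red p k ((A^T *m gramI m *m A) i j) = red p k (cM i j k).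
    move=> ij; rewrite -off ?ltn_eqF // H ?(ltnW ij) ?ltn_ord // zp_red //.
    by apply: zc; rewrite (ltnW ij) ltn_ord.
  apply/eqM_entry => i j; rewrite [gramK _ _ _ _ _]mxE.
  case: ltngtP => ij; [exact: up | by rewrite sAE; apply: up |].
  have -> : j = i by apply: val_inj.
  rewrite ent bf_diag; apply: red_mul => //.
  by rewrite -diag H ?leqnn ?ltn_ord // zp_red //; apply: zc; rewrite leqnn ltn_ord.
have im := leq_ltn_trans ij jn.
rewrite -(zp_red k (zc _ _ _)) ?ij //.
rewrite -[i]/(val (Ordinal im)) -[j]/(val (Ordinal jn)).
have {H} := H (Ordinal im) (Ordinal jn); rewrite [gramK _ _ _ _ _]mxE /=.
move: ij; rewrite leq_eqVlt => /predU1P[ij|ij].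
  move: jn; rewrite -ij => jn; rewrite eqxx.
  have -> : Ordinal jn = Ordinal im by apply: val_inj.
  rewrite ent bf_diag => /eqP; rewrite eqz_mod_dvd -mulrBr dvd_two -red_dvd => /eqP.
  by rewrite -[i]/(val (Ordinal im)) diag.
rewrite (ltn_eqF ij) ij => H.
by rewrite -[i]/(val (Ordinal im)) -[j]/(val (Ordinal jn)) off ?ltn_eqF.
Qed.

Lemma detz_mx n a k : detz p n a k = red p k (\det (mxk n n a k)).
Proof. by []. Qed.

Lemma gram_mxk n k : eqM (p ^ k)%N (mxk n n (gram p n cL) k) (gramI n).
Proof.
apply/eqM_entry => i j; rewrite !mxE; apply: to_red; rewrite /gram red_id.
by case: eqP => _; [apply: red_mul => //; apply: red_id | case: ltnP => _; apply: red_id].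
Qed.

Lemma detz_gram n : detz p n (gram p n cL) = zint p (\det (gramI n)).
Proof.
apply: functional_extensionality => k; rewrite detz_mx; apply/redP.
by apply: eqM_det; apply: gram_mxk.
Qed.

End PadicReductions.

Section Limits.

Lemma Rlim_ev (u : nat -> R) (l : R) n0 : (forall n, (n0 <= n)%N -> u n = l) -> Rlim u = l.
Proof.
move=> H; rewrite /Rlim (Lim_seq_ext_loc u (fun _ => l)) ?Lim_seq_const //.
by exists n0 => n /ssrnat.leP; apply: H.
Qed.

Lemma Rlim_cvg (u : nat -> R) (l : R) : is_lim_seq u (Rbar.Finite l) -> Rlim u = l.
Proof. by move=> /is_lim_seq_unique; rewrite /Rlim => ->. Qed.

Variable p : nat.
Hypothesis p_pr : prime p.

Definition absk (k : nat) (z : int) : R :=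
  if z == 0 then (p ^ k)%:R^-1 else (p ^ logn p `|z|)%:R^-1.

Lemma abspE x : absp p x = Rlim (fun k => absk k (x k)).
Proof.
congr Rlim; apply: functional_extensionality => k.
by rewrite /absk !RealsE.
Qed.

Lemma absk_val x v k : is_zp p x -> x v = 0 -> x v.+1 != 0 -> (v < k)%N ->
  absk k (x k) = (p ^ v)%:R^-1.
Proof.
move=> zx xv xv1 vk.
have xk0 : x k != 0.
  by apply: contraNneq xv1 => xk0; rewrite (zp_le zx vk) xk0 /red mod0z.
rewrite /absk (negbTE xk0); congr (_%:R^-1).
have dv j : (j <= k)%N -> (j <= logn p `|x k|)%N = (x j == 0).
  move=> jk; rewrite -pfactor_dvdn ?absz_gt0 // (zp_le zx jk).
  by apply/idP/eqP => [d|/dvdz_mod0P //]; apply/dvdz_mod0P.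
congr (p ^ _)%N; apply/eqP; rewrite eqn_leq -ltnS (ltnNge (logn _ _)).
by rewrite dv ?vk // dv ?(ltnW vk) // xv eqxx andbT xv1.
Qed.

Lemma absp_val x v : is_zp p x -> x v = 0 -> x v.+1 != 0 -> absp p x = (p ^ v)%:R^-1.
Proof.
by move=> zx xv xv1; rewrite abspE; apply: (@Rlim_ev _ _ v.+1) => k vk; apply: absk_val.
Qed.

Lemma absp_zint z : ~~ (p%:Z %| z)%Z -> absp p (zint p z) = 1.
Proof.
move=> nz; rewrite (absp_val (v := 0)) ?expn0 ?invr1 //; first exact: is_zp_zint.
  exact: red0.
by apply: contraNneq nz => /dvdz_mod0P; rewrite /pk expn1.
Qed.

End Limits.

Section Coherence.

Variable p : nat.
Hypothesis p_pr : prime p.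

(** Weaker than [is_zp]: the values need not be reduced, so coherent sequences are closed under the
    plain ring operations. *)
Definition coh (f : nat -> int) : Prop := forall k, red p k (f k.+1) = red p k (f k).

Lemma zp_coh x : is_zp p x -> coh x.
Proof. by move=> zx k; rewrite [in RHS]zx red_id. Qed.

Lemma coh_zp f : coh f -> is_zp p (fun k => red p k (f k)).
Proof. by move=> cf k; rewrite red_le. Qed.

Lemma coh_add f g : coh f -> coh g -> coh (fun k => f k + g k).
Proof. by move=> cf cg k; apply: red_add. Qed.
Lemma coh_mul f g : coh f -> coh g -> coh (fun k => f k * g k).
Proof. by move=> cf cg k; apply: red_mul. Qed.
Lemma coh_opp f : coh f -> coh (fun k => - f k).
Proof. by move=> cf k; apply: red_opp. Qed.
Lemma coh_sub f g : coh f -> coh g -> coh (fun k => f k - g k).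
Proof. by move=> cf cg; apply: (coh_add cf (coh_opp cg)). Qed.

Lemma coh_sum (I : finType) (P : pred I) (f : I -> nat -> int) :
  (forall i, P i -> coh (f i)) -> coh (fun k => \sum_(i | P i) f i k).
Proof.
by move=> cf k; apply: (big_ind2 (fun x y => red p k x = red p k y)) => // *; [apply: red_add | apply: cf].
Qed.

Lemma coh_red f : coh f -> coh (fun k => red p k (f k)).
Proof. by move=> cf k; rewrite red_le // red_id. Qed.

Lemma red_unit_cancel k (a x y : int) : ~~ (p%:Z %| a)%Z ->
  red p k (a * x) = red p k (a * y) -> red p k x = red p k y.
Proof.
move=> na /eqP; rewrite red_dvd -mulrBr Gauss_dvdzr => [|]; first by rewrite -red_dvd => /eqP.
by rewrite coprimezE /= coprimeXl // prime_coprime.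
Qed.

Lemma inv_mod k (a : int) : ~~ (p%:Z %| a)%Z -> exists u, red p k (a * u) = red p k 1.
Proof.
move=> na; have [u [v e]] := Bezoutz a (p ^ k)%N.
exists u; apply/eqP; rewrite red_dvd mulrC.
have <- : gcdz a (p ^ k)%N = 1.
  apply/eqP; change (coprimez a (p ^ k)%N).
  by rewrite coprimezE coprimeXr // coprime_sym prime_coprime.
by rewrite -e opprD addrA subrr add0r -mulNr dvdz_mull.
Qed.

(** Inverses are chosen level by level; they fit together because an inverse modulo [p^k] is
    unique. *)
Lemma inv_coh (a : nat -> int) : coh a -> ~~ (p%:Z %| a 1%N)%Z ->
  exists2 u, coh u & forall k, red p k (a k * u k) = red p k 1.
Proof.
move=> ca na.
have nak k : ~~ (p%:Z %| a k.+1)%Z.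
  elim: k => // k; apply: contra => d; have := ca k.+1 => /eqP; rewrite red_dvd => d'.
  have d1 : (p%:Z %| a k.+2 - a k.+1)%Z.
    by apply: dvdz_trans d'; rewrite dvdzE /= expnS dvdn_mulr.
  by rewrite -(subKr (a k.+2) (a k.+1)) rpredB.
have inv k : exists u, red p k (a k * u) = red p k 1.
  by case: k => [|k]; [exists 0; rewrite !red0 | apply: inv_mod].
have [u uP] := ClassicalEpsilon.choice _ inv; exists u => // -[|k]; first by rewrite !red0.
apply: (red_unit_cancel (nak k)); rewrite uP -[RHS](red_le _ _ (leqnSn k.+1)) -(uP k.+2).
by rewrite red_le //; apply: red_mul => //; rewrite -ca.
Qed.

Lemma eqM_adj d n (A B : 'M[int]_n) : eqM d A B -> eqM d (\adj A) (\adj B).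
Proof.
move=> /eqM_entry AB; apply/eqM_entry => i j; rewrite !mxE /cofactor.
rewrite -modzMmr -[in RHS]modzMmr; congr ((_ * _) %% _)%Z.
by apply: eqM_det; apply/eqM_entry => a b; rewrite !mxE.
Qed.

End Coherence.

Section HaarMatrices.

Variable p : nat.
Hypothesis p_pr : prime p.
Hypothesis p_odd : p <> 2%N.

(** For an integrand depending only on residues modulo [p^k], the Riemann sums are constant from
    level [k] on, so the integral is a finite sum. *)
Lemma haarM_ev m n (F : (nat -> nat -> padic) -> R) k (f : 'M[int]_(m, n) -> R) :
  periodic (p ^ k)%N f -> (forall Z, F (toP p (fun _ => Z)) = f Z) ->
  haarM p m n F = sumM (p ^ k) f / ((p ^ k) ^ (m * n))%:R.
Proof.
move=> pf Ff; apply: (@Rlim_ev _ _ k) => r kr; rewrite !RealsE mulrC.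
have -> : \sum_(x : {ffun 'I_m * 'I_n -> 'I_(p ^ r)})
        F (fun i j => match insub i, insub j with
                      | Some i', Some j' => embN p (x (i', j'))
                      | _, _ => zero end) = sumM (p ^ r) f.
  rewrite /sumM (reindex (fun x : {ffun 'I_m * 'I_n -> 'I_(p ^ r)} => Matrix x)) /=.
    apply: eq_bigr => x _; rewrite -Ff; congr F.
    apply: functional_extensionality => i; apply: functional_extensionality => j.
    apply: functional_extensionality => l; rewrite /toP.
    by case: insub => // i'; case: insub => // j'; rewrite mxE.
  by apply: onW_bij; exists (fun A => mx_val A) => // -[].
rewrite -(subnKC kr) expnD sumM_periodic // mulrC expnMn natrM.
have n0 (a b : nat) : ((p ^ a) ^ b)%:R != 0 :> R by rewrite pnatr_eq0 -lt0n !expn_gt0 prime_gt0.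
have aux (u v s : R) : u != 0 -> v != 0 -> (u * v)^-1 * (v * s) = s / u.
  by move=> u0 v0; field; rewrite u0 v0.
by rewrite aux // mulrC.
Qed.

Lemma periodic_mxk k (T : Type) m n (f : 'M[int]_(m, n) -> T) :
  (forall X Y, eqM (p ^ k)%N X Y -> f X = f Y) -> periodic (p ^ k)%N f.
Proof. by move=> H X Y; apply: H; apply/eqMP; exists Y. Qed.

Lemma gramI_LH t : gramI (coefLH_int t) (dimLH t) = GLH (dimLH t).
Proof.
apply/matrixP=> i j; rewrite !mxE /gLH.
by rewrite !coefLH_intE.
Qed.

Lemma gramK_LH t k : eqM (p ^ k)%N (gramK (dimLH t) (coefLH p t) k) (GLH (dimLH t)).
Proof.
rewrite -gramI_LH; apply/eqM_entry => i j; rewrite !mxE; apply: to_red.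
by case: eqP => _; [apply: red_mul => //; apply: red_id | case: ltnP => _; apply: red_id].
Qed.

Lemma GLH_det_unit t : ~~ (p%:Z %| \det (GLH (dimLH t)))%Z.
Proof.
rewrite -intr_Fp_eq0 // -det_map_mx -unitfE -unitmxE.
exact: GF_unit (Fp_two_neq0 p_pr p_odd) t.
Qed.

Definition isoK t k (A : 'M[int]_(dimLH t)) : bool :=
  eqM (p ^ k)%N (A^T *m GLH (dimLH t) *m A) (GLH (dimLH t)).

Lemma near_LHE t k a : near_form p (dimLH t) (coefLH p t) (dimLH t) (coefLH p t) k a <->
  isoK k (mxk (dimLH t) (dimLH t) a k).
Proof.
have -> := near_formE p_pr p_odd (coefLH_int t) (dimLH t) (n := dimLH t) (cM := coefLH p t) k a
  (fun i j _ => is_zp_zint p _).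
rewrite gramI_LH /isoK; have gK := gramK_LH t k; split=> H.
  exact: eqM_trans H gK.
by apply: eqM_trans H _; rewrite eqM_sym.
Qed.

Lemma isom_LHE t a : Defs.isom p (dimLH t) (coefLH p t) (dimLH t) (coefLH p t) a <->
  forall k, isoK k (mxk (dimLH t) (dimLH t) a k).
Proof.
by split=> [H k|H i j ij k]; [apply/near_LHE => i j ij; apply: H | move/near_LHE: (H k); apply].
Qed.

(** The integral inverse demanded by [SOset] is the adjugate, as the determinant is 1. *)
Lemma SOsetP t g : SOset p t g <-> [/\ zmat p (dimLH t) (dimLH t) g,
   forall k, isoK k (mxk (dimLH t) (dimLH t) g k) &
   forall k, red p k (\det (mxk (dimLH t) (dimLH t) g k)) = red p k 1].
Proof.
set N := dimLH t; split=> [[zg /isom_LHE ig dg _]|[zg ig dg]].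
  by split=> // k; have := dg k; rewrite detz_mx.
split=> //; first exact/isom_LHE.
exists (toP p (fun k => \adj (mxk N N g k))); split.
  by apply: zmat_toP => k; apply: eqM_adj; apply: zmat_coh.
move=> i j iN jN; split=> k.
  have -> : matmul p N g (toP p (fun k => \adj (mxk N N g k))) i j k =
     red p k ((mxk N N g k *m \adj (mxk N N g k)) (Ordinal iN) (Ordinal jN)).
    rewrite /matmul !mxE; apply: (big_ind2 (fun x y => red p k x = red p k y)) => //.
      by move=> *; apply: red_add.
    by move=> l _; rewrite [mxk N N g k _ _]mxE /=; apply: red_mul => //; rewrite -[j]/(val (Ordinal jN)) toPE red_id.
  by rewrite mul_mx_adj mxE /idmat /zint -val_eqE /=; case: eqP => _; rewrite ?mulr1n ?mulr0n ?dg.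
have -> : matmul p N (toP p (fun k => \adj (mxk N N g k))) g i j k =
   red p k ((\adj (mxk N N g k) *m mxk N N g k) (Ordinal iN) (Ordinal jN)).
  rewrite /matmul !mxE; apply: (big_ind2 (fun x y => red p k x = red p k y)) => //.
    by move=> *; apply: red_add.
  move=> l _; rewrite [mxk N N g k _ _]mxE /=; apply: red_mul => //.
  by rewrite -[i]/(val (Ordinal iN)) toPE red_id.
by rewrite mul_adj_mx mxE /idmat /zint -val_eqE /=; case: eqP => _; rewrite ?mulr1n ?mulr0n ?dg.
Qed.

(* The lattice is unimodular, so the discriminant group is trivial. *)
Lemma SO'setE t g : SO'set p t g <-> SOset p t g.
Proof.
split=> [[]//|sg]; split=> // z zz.
set N := dimLH t; set w := matvec p N _ z.
have cc : coh p (fun _ => \det (GLH N)) by [].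
(* Since [det G] is a unit with inverse [u], the vector [y = u (g w - w)] witnesses the divisibility
   by [det G]. *)
have [u cu uP] := inv_coh p_pr cc (GLH_det_unit t).
have [zg _ _] := iffLR (SOsetP t g) sg.
have cw i : (i < N)%N -> coh p (w i).
  move=> iN; rewrite /w /matvec; apply: coh_red; apply: coh_sum => j _.
  apply: coh_mul; last by apply: zp_coh; apply: zz.
  rewrite -[i]/(val (Ordinal iN)).
  rewrite /adjz !valK; apply: coh_red => l.
  suff : eqM (p ^ l)%N (\adj (mxk N N (gram p N (coefLH p t)) l.+1)) (\adj (mxk N N (gram p N (coefLH p t)) l)).
    by move/eqM_entry; apply.
  have gl := gram_mxk p (coefLH_int t) N.
  apply: eqM_adj; apply: (eqM_trans (B := gramI (coefLH_int t) N)).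
    by apply: eqM_dvd (gl l.+1); rewrite dvdzE /= expnS dvdn_mull.
  by rewrite eqM_sym; apply: gl.
have cgw i : (i < N)%N -> coh p (matvec p N g w i).
  move=> iN; apply: coh_red; apply: coh_sum => j _.
  by apply: coh_mul; [apply: zp_coh; apply: zg | apply: cw].
exists (fun i k => red p k (u k * (matvec p N g w i k - w i k))); split.
  by move=> i iN; apply: coh_zp; apply: coh_mul => //; apply: coh_sub; [apply: cgw | apply: cw].
move=> i iN /= k; rewrite detz_gram gramI_LH /zint -/N.
rewrite -[LHS]red_id; set x := matvec p N g w i k - w i k.
have -> : red p k (red p k (\det (GLH N)) * red p k (u k * x)) = red p k (\det (GLH N) * (u k * x)).
  by apply: red_mul; apply: red_id.
rewrite red_id mulrA -[x in LHS]mul1r; exact: red_mul.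
Qed.

Lemma homfac_LH t : homfac p (dimLH t) (coefLH p t) (dimLH t) (coefLH p t) = 1.
Proof.
rewrite /homfac detz_gram gramI_LH absp_zint ?GLH_det_unit // /Rpower ln_1 !Rmult_0_r exp_0.
by rewrite !RealsE mulr1.
Qed.

Lemma qffac_LH t : qffac p (dimLH t) (coefLH p t) = 1.
Proof.
by rewrite /qffac detz_gram gramI_LH absp_zint ?GLH_det_unit // /Rpower ln_1 !Rmult_0_r exp_0.
Qed.

Local Notation phi := (map_mx (intr : int -> 'F_p)).

Lemma det_phi n (A : 'M[int]_n) : \det (phi A) = (\det A)%:~R.
Proof. exact: det_map_mx. Qed.

Lemma red1_Fp x y : (red p 1 x == red p 1 y) = (x%:~R == y%:~R :> 'F_p).
Proof. by rewrite intr_Fp_eq // /red /pk expn1. Qed.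

Lemma red_le1 k x y : (0 < k)%N -> red p k x = red p k y -> x%:~R = y%:~R :> 'F_p.
Proof.
move=> k0 e; apply/eqP; rewrite -red1_Fp; apply/eqP.
by rewrite -(red_le _ _ k0) e red_le.
Qed.

(** In [(d + 1)(d - 1) = 0] the first factor is 2 modulo [p], hence a unit. Thus the determinant of
    an isometry is exactly 1 as soon as it is 1 modulo [p]. *)
Lemma det_one k (N := 0%N) (d : int) : red p k (d * d) = red p k 1 -> d%:~R = 1 :> 'F_p ->
  red p k d = red p k 1.
Proof.
move=> dd d1; have n2 : ~~ (p%:Z %| d + 1)%Z.
  rewrite -intr_Fp_eq0 // intrD d1 -(natrD _ 1 1); exact: Fp_two_neq0.
apply: (red_unit_cancel p_pr n2); apply/eqP; rewrite red_dvd.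
have -> : (d + 1) * d - (d + 1) * 1 = d * d - 1 by ring.
by rewrite -red_dvd dd.
Qed.

Lemma isoK_det t k A : isoK (t := t) k A -> red p k (\det A * \det A) = red p k 1.
Proof.
move=> /eqM_det; rewrite !det_mulmx det_tr => e.
apply: (red_unit_cancel p_pr (GLH_det_unit t)).
by rewrite mulr1 mulrCA mulrA; exact: e.
Qed.

Lemma isoK_free t k A : (0 < k)%N -> isoK (t := t) k A -> row_free (phi (A^T *m GLH (dimLH t))).
Proof.
move=> k0 /isoK_det /(red_le1 k0); rewrite intrM -det_phi => e.
rewrite row_free_unit map_mxM unitmx_mul -map_trmx unitmx_tr.
rewrite !unitmxE !unitfE; apply/andP; split; last by rewrite det_phi intr_Fp_eq0 // GLH_det_unit.
by apply/eqP => d0; move: e; rewrite d0 mul0r => /esym/eqP; rewrite oner_eq0.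
Qed.

Lemma isoK_lift t k A : (0 < k)%N -> isoK (t := t) k A -> \det (phi A) = 1 ->
  exists2 g, SOset p t g & forall j, (j <= k)%N -> eqM (p ^ j)%N (mxk (dimLH t) (dimLH t) g j) A.
Proof.
move=> k0 iA dA; set N := dimLH t in A iA dA *.
have [X [cX sX X0]] := newton_lift p_pr p_odd (tr_GLH N) (fun _ => tr_GLH N)
  (fun k => eqM_refl _ _) k0 iA (isoK_free k0 iA).
have iX j : isoK j (mxk N N (toP p X) j).
  have mX l : eqM (p ^ l)%N (mxk N N (toP p X) l) (X l) := mxk_toP p X l.
  suff : isoK j (X j).
    by apply: eqM_trans; apply: (eqM_mul (eqM_mul (eqM_tr (mX j)) (eqM_refl _ _)) (mX j)).
  case: (leqP k j) => kj; first exact: sX.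
  rewrite X0 ?(ltnW kj) //; apply: eqM_dvd iA.
  by rewrite dvdzE /= dvdn_exp2l // ltnW.
exists (toP p X); last first.
  by move=> j jk; have := mxk_toP p X j; rewrite X0.
apply/SOsetP; split=> //; first exact: zmat_toP.
move=> [|j]; first by rewrite !red0.
apply: det_one; first exact: isoK_det.
have e : phi (X j.+1) = phi A.
  elim: j => [|j IH]; first by rewrite X0.
  by apply/eqP; rewrite -IH -eqM_phi //; apply: eqM_dvd (cX j.+1); rewrite dvdzE /= expnS dvdn_mulr.
have /eqM_dvd : eqM (p ^ j.+1)%N (mxk N N (toP p X) j.+1) (X j.+1) by apply: mxk_toP.
move=> /(_ p); rewrite eqM_phi // => H.
by rewrite -det_phi (eqP (H _)) ?e // dvdzE /= expnS dvdn_mulr.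
Qed.

End HaarMatrices.

(** * The volume of the special orthogonal group *)

Section Lambda.

Variable p : nat.
Hypothesis p_pr : prime p.
Hypothesis p_odd : p <> 2%N.
Variable t : nat.
Let N := dimLH t.
Local Notation phi := (map_mx (intr : int -> 'F_p)).
Let q : R := p%:R.

Let q0 : q != 0. Proof. by rewrite pnatr_eq0 -lt0n prime_gt0. Qed.

Lemma isoK_eqM k (A B : 'M[int]_N) : eqM (p ^ k)%N A B -> isoK p (t := t) k A = isoK p (t := t) k B.
Proof.
move=> AB; have e : eqM (p ^ k)%N (A^T *m GLH N *m A) (B^T *m GLH N *m B).
  exact: (eqM_mul (eqM_mul (eqM_tr AB) (eqM_refl _ _)) AB).
rewrite /isoK; apply/idP/idP => H; last exact: eqM_trans e H.
by apply: eqM_trans H; rewrite eqM_sym.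
Qed.

Definition detone : pred 'M['F_p]_N := fun X => \det X == 1.

Lemma GF_phi : phi (GLH N) = GF 'F_p N. Proof. by []. Qed.

Lemma detone_free (X : 'M['F_p]_N) : detone X -> row_free (X^T *m phi (GLH N)).
Proof.
move=> /eqP dX; rewrite row_free_unit unitmx_mul unitmx_tr (unitmxE X) dX unitr1 /=.
by rewrite GF_phi; apply: GF_unit (Fp_two_neq0 p_pr p_odd) t.
Qed.

Lemma Rind_bool (P : Prop) (b : bool) : (P <-> b) -> Rind P = ind b.
Proof.
rewrite /Rind /ind => Pb; case: ClassicalEpsilon.excluded_middle_informative => H.
  by have -> : b by apply/Pb.
by have -> : b = false by apply/negP => /Pb.
Qed.

(** Being [p^r]-close to an exact element of the group only forces determinant 1 modulo [p];
    conversely every isometry modulo [p^k] with that property lifts, by [isoK_lift]. So the volume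
    does not depend on [r >= 1]. *)
Lemma haar_SO r k : (0 < r)%N -> (r <= k)%N ->
  haarM p N N (fun a => Rind (near_form p N (coefLH p t) N (coefLH p t) k a /\
     near_set p N N r (SO'set p t) a)) =
  sumM (p ^ k) (fun Z => ind (solP (GLH N) (GLH N) detone k Z)) / ((p ^ k) ^ (N * N))%:R.
Proof.
move=> r0 rk; have k0 := leq_trans r0 rk; apply: haarM_ev => //.
  apply: periodic_mxk => X Y XY; congr ind; rewrite /solP -!/(eqM _ _ _).
  have := isoK_eqM XY; rewrite /isoK => ->; congr (_ && detone _).
  by apply/eqP; rewrite -eqM_phi //; apply: eqM_dvd XY; rewrite dvdzE /= dvdn_exp.
move=> Z; set a := toP p _; apply: Rind_bool.
have aZ j : eqM (p ^ j)%N (mxk N N a j) Z := mxk_toP p (fun _ => Z) j.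
have pj j : (0 < j)%N -> (p%:Z %| (p ^ j)%N%:Z)%Z by move=> j0; rewrite dvdzE /= dvdn_exp.
split=> [[/(near_LHE p_pr p_odd) Ha [g [/(SO'setE p_pr p_odd) sg ag]]]|/andP[iZ /eqP dZ]].
  rewrite (isoK_eqM (aZ k)) in Ha.
  apply/andP; split; first exact: Ha.
  have /(SOsetP p_pr p_odd)[zg ig dg] := sg.
  have e : mxk N N a r = mxk N N g r.
    by apply/matrixP=> i j; rewrite !mxE ag.
  have /eqP <- : phi (mxk N N a r) == phi Z by rewrite -eqM_phi //; apply: eqM_dvd (aZ r); apply: pj.
  rewrite /detone e det_phi; apply/eqP.
  by have := red_le1 p_pr r0 (dg r).
split.
  by apply/(near_LHE p_pr p_odd); rewrite (isoK_eqM (aZ k)).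
have [g sg gZ] := isoK_lift p_pr p_odd k0 iZ dZ.
exists g; split; first exact/(SO'setE p_pr p_odd).
move=> i j iN jN.
have /(SOsetP p_pr p_odd)[zg _ _] := sg.
have /eqM_entry /(_ (Ordinal iN) (Ordinal jN)) : eqM (p ^ r)%N (mxk N N a r) (mxk N N g r).
  by apply: eqM_trans (aZ r) _; rewrite eqM_sym; apply: gZ.
rewrite !mxE /= -!/(red p r _) => e.
by rewrite -[RHS](zp_red _ (zg _ _ iN jN)) -e /a -[i]/(val (Ordinal iN)) -[j]/(val (Ordinal jN)) toPE red_id.
Qed.

Lemma fibre_SO : fibre p N (coefLH p t) N (coefLH p t) (SO'set p t) =
  dens (GLH N) (GLH N) detone 1.
Proof.
(* At [r = 0] the closeness condition is empty and would also admit determinant [-1]. *)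
apply: (@Rlim_ev _ _ 1) => r r1; apply: (@Rlim_ev _ _ r) => k rk.
rewrite haar_SO // homfac_LH // qffac_LH // !RealsE !mul1r invrK.
rewrite -(dens_const p_pr p_odd (tr_GLH N) (tr_GLH N) detone_free (leq_trans r1 rk)) /dens.
by rewrite bin2 /= addn1 mulnC divn2.
Qed.

(** In odd dimension, negation exchanges the isometries of determinant 1 with those of determinant
    [-1]. *)
Lemma card_detone : (#|[pred X : 'M['F_p]_N | (X^T *m phi (GLH N) *m X == phi (GLH N)) && detone X]| * 2 =
  cardO (GF 'F_p N))%N.
Proof.
rewrite /cardO -[in RHS](cardID detone) muln2 -addnn; congr (_ + _)%N.
rewrite -!sum1_card [LHS](reindex_inj (@oppr_inj _)) /=.
apply: eq_bigl => X; rewrite !inE trmxN !mulNmx mulmxN opprK andbC [RHS]andbC.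
rewrite -/(isometry (GF 'F_p N) X) -[X in _ = (X && _)]/(isometry (GF 'F_p N) X).
case: (boolP (isometry (GF 'F_p N) X)) => [iX|]; rewrite ?andbF // !andbT.
have : \det X * \det X = 1.
  move/eqP: iX => /(congr1 determinant); rewrite !det_mulmx det_tr => e.
  have u := GF_unit (Fp_two_neq0 p_pr p_odd) t; rewrite unitmxE unitfE -/N in u.
  by apply: (mulfI u); rewrite mulr1 mulrCA mulrA.
move/eqP; rewrite -expr2 sqrf_eq1 -[X \notin _]/(~~ (_ == _)) /=.
have -> : detone (- X) = (\det X == - 1).
  have oN : odd N by rewrite /N /dimLH mul2n oddD odd_double.
  rewrite /detone -scaleN1r detZ -signr_odd oN expr1 mulN1r.
  by rewrite eqr_oppLR.
case/orP => /eqP ->; last by rewrite eqxx; apply/esym; rewrite eq_sym -addr_eq0 -(natrD _ 1 1) (Fp_two_neq0 p_pr p_odd).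
by rewrite eqxx /= -addr_eq0 -(natrD _ 1 1) (negbTE (Fp_two_neq0 p_pr p_odd)).
Qed.

Lemma prodfacS n : prodfac p n.+1 = prodfac p n * (1 - (q ^+ (2 * n.+1))^-1).
Proof. by rewrite /prodfac -/prodfac !RealsE natrX. Qed.

Lemma q_gt1 : 1 < q. Proof. by rewrite ltr1n prime_gt1. Qed.

Lemma prodfac_neq0 n : prodfac p n != 0.
Proof.
elim: n => [|n IH]; first by rewrite /prodfac oner_eq0.
rewrite prodfacS mulf_neq0 // subr_eq0 eq_sym invr_eq1 gt_eqF //.
by rewrite exprn_egt1 ?q_gt1 // muln_eq0.
Qed.

Lemma prod_order n :
  \prod_(j < n) (q ^+ (2 * j).+1 * (q ^+ (2 * j).+2 - 1)) = q ^+ 'C((2 * n).+1, 2) * prodfac p n.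
Proof.
elim: n => [|n IH]; first by rewrite big_ord0 /prodfac muln0 bin_small // expr0 mul1r.
rewrite prodfacS big_ord_recr /= IH.
have -> : ('C((2 * n.+1).+1, 2) = 'C((2 * n).+1, 2) + (2 * n).+1 + (2 * n).+2)%N.
  by rewrite mulnS !binS !bin1 !bin0; lia.
have -> : (2 * n.+1 = (2 * n).+2)%N by rewrite mulnS.
rewrite !exprD; field.
by rewrite expf_neq0.
Qed.

(** The finite group contributes [prodfac p t.+1], and the normalisation of [lambda_p] removes all
    but its last factor. The powers of [p] cancel because [N^2] is [C(N, 2) + C(N+1, 2)]. *)
Lemma lambda_val : lambda_p p t = 1 - (q ^+ (2 * t.+1))^-1.
Proof.
rewrite /lambda_p fibre_SO dens1E //.
set A := #|_|; have := card_detone; rewrite -/A => /(congr1 (fun n => n%:R : R)).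
rewrite natrM (cardO_GF (Fp_two_neq0 p_pr p_odd)) card_Fp // -/q prod_order mulrC => H.
have {}H : A%:R = q ^+ 'C(N, 2) * prodfac p t.+1.
  have -> : N = (2 * t.+1).+1 by rewrite /N /dimLH mulnS.
  by apply: (mulfI (_ : 2%:R != 0)) => //; rewrite pnatr_eq0.
rewrite H RdivE prodfacS !natrX -/q.
have -> : (N * N = 'C(N, 2) + 'C(N.+1, 2))%N.
  by elim: (N) => // m; rewrite !binS !bin1 !bin0; lia.
rewrite exprD; field.
by rewrite !expf_neq0 // prodfac_neq0.
Qed.

End Lambda.

(** * Representation densities *)

Section Shift.

Variable p : nat.
Hypothesis p_pr : prime p.

(** Division by [p^e]: the residue of the quotient modulo [p^k] requires [x] modulo [p^(k+e)]. *)
Definition shift e (x : padic) : padic := fun k => (x (k + e)%N %/ (p ^ e)%N)%Z.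

Let pe0 e : (0 : int) < (p ^ e)%N%:Z. Proof. by rewrite ltz_nat expn_gt0 prime_gt0. Qed.

Lemma shiftE e x k : is_zp p x -> x e = 0 -> x (k + e)%N = (p ^ e)%N%:Z * shift e x k.
Proof.
move=> zx xe; rewrite mulrC /shift divzK //; apply/dvdz_mod0P.
by have := zp_le zx (leq_addl k e); rewrite xe.
Qed.

Lemma is_zp_shift e x : is_zp p x -> x e = 0 -> is_zp p (shift e x).
Proof.
move=> zx xe k; apply: (mulfI (lt0r_neq0 (pe0 e))).
rewrite -shiftE // zx -addSn shiftE // /red /pk expnD mulnC PoszM.
by rewrite -mulz_modr.
Qed.

Lemma shift_eq0 e x k : is_zp p x -> x e = 0 -> (shift e x k == 0) = (x (k + e)%N == 0).
Proof. by move=> zx xe; rewrite shiftE // mulf_eq0 (negbTE (lt0r_neq0 (pe0 e))). Qed.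

Lemma shift_red e x k : is_zp p x -> x e = 0 -> red p k ((p ^ e)%N%:Z * shift e x k) = x k.
Proof. by move=> zx xe; rewrite -shiftE // -zp_le // leq_addr. Qed.

Lemma zp_val x : is_zp p x -> ~ zeq x zero -> exists v, x v = 0 /\ x v.+1 != 0.
Proof.
move=> zx nx; have : exists k, x k != 0.
  apply: Classical_Prop.NNPP => H; apply: nx => k; apply/eqP/negPn/negP => xk.
  by apply: H; exists k.
move=> ex; case: (ex_minnP ex) => -[|v] xv vmin; first by move: xv; rewrite zx red0.
exists v; split=> //; apply/eqP/negPn/negP => xv0.
by have := vmin _ xv0; rewrite ltnn.
Qed.

Lemma zp_val0 x v j : is_zp p x -> x v = 0 -> (j <= v)%N -> x j = 0.
Proof. by move=> zx xv jv; rewrite (zp_le zx jv) xv /red mod0z. Qed.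

Lemma zp_valn0 x v j : is_zp p x -> x v.+1 != 0 -> (v < j)%N -> x j != 0.
Proof.
by move=> zx xv jv; apply: contraNneq xv => xj; rewrite (zp_le zx jv) xj /red mod0z.
Qed.

End Shift.

Section Mu.

Variable p : nat.
Hypothesis p_pr : prime p.
Hypothesis p_odd : p <> 2%N.
Variable t : nat.
Let N := dimLH t.
Let G := GLH N.
Local Notation phi := (map_mx (intr : int -> 'F_p)).
Let q : R := p%:R.
Let X : R := (q ^+ t.+1)^-1.

Let q0 : q != 0. Proof. by rewrite pnatr_eq0 -lt0n prime_gt0. Qed.

Definition solq k (b : int) (Z : 'M[int]_(N, 1)) : bool :=
  eqM (p ^ k)%N (Z^T *m G *m Z) (2%:R * b)%:M.

Definition cntq k b : R := sumM (p ^ k) (fun Z => ind (solq k b Z)).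

Definition nonzero m n : pred 'M['F_p]_(m, n) := fun Z => Z != 0.

Lemma nonzero_free (Z : 'M['F_p]_(N, 1)) : nonzero Z -> row_free (Z^T *m phi G).
Proof.
move=> Z0; rewrite /row_free rank_rV eqb1.
apply: contraNneq Z0; have u := GF_unit (Fp_two_neq0 p_pr p_odd) t.
move=> /(congr1 (fun M => M *m invmx (phi G))); rewrite -mulmxA mulmxV // mulmx1 mul0mx.
by move/(congr1 trmx); rewrite trmxK trmx0 => ->.
Qed.

Lemma solq_eqM k b Z Z' : eqM (p ^ k)%N Z Z' -> solq k b Z = solq k b Z'.
Proof.
move=> ZZ; have e : eqM (p ^ k)%N (Z^T *m G *m Z) (Z'^T *m G *m Z').
  exact: (eqM_mul (eqM_mul (eqM_tr ZZ) (eqM_refl _ _)) ZZ).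
rewrite /solq; apply/idP/idP => H; last exact: eqM_trans e H.
by apply: eqM_trans H; rewrite eqM_sym.
Qed.

(** The number of nonzero solutions of [Q = b] modulo [p], divided by [p^(2(t+1))]. The last term
    removes the zero vector, a solution exactly when [p] divides [b]; [2b] enters because spheres
    are taken for the bilinear form. *)
Definition primval (b : int) :=
  1 - X + X * sqc ((2%:R * b)%:~R : 'F_p) - X ^+ 2 * (p%:Z %| b)%Z%:R.

Lemma card_prim b :
  #|[pred Z : 'M['F_p]_(N, 1) | (Z^T *m phi G *m Z == phi (2%:R * b)%:M) && nonzero Z]|%:R =
  q ^+ (2 * t.+1) * primval b.
Proof.
have -> : q ^+ (2 * t.+1) * primval b = (cardS (GF 'F_p N) (2%:R * b)%:~R)%:R - (p%:Z %| b)%Z%:R.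
  rewrite (cardS_GF (Fp_two_neq0 p_pr p_odd)) card_Fp // -/q /primval /X.
  have -> : q ^+ (2 * t.+1) = (q ^+ t.+1) ^+ 2 by rewrite mulnC exprM.
  have aux (u K d : R) : u != 0 -> u ^+ 2 * (1 - u^-1 + u^-1 * K - u^-1 ^+ 2 * d) = u ^+ 2 - u + u * K - d.
    by move=> u0; field.
  by apply: aux; rewrite expf_neq0.
apply/eqP; rewrite eq_sym subr_eq; apply/eqP; rewrite /cardS -[in LHS](cardID (@nonzero N 1)) natrD -/N.
have sE Z : (Z \in sphere (GF 'F_p N) (2%:R * b)%:~R) = (Z^T *m phi G *m Z == phi (2%:R * b)%:M).
  rewrite -[LHS]/(_ == _) map_scalar_mx; apply/eqP/eqP => [e|/(congr1 (fun M : 'M_1 => M 0 0))].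
    by rewrite bilE e.
  by rewrite [in X in _ = X -> _]mxE mulr1n.
congr (_ + _).
  by congr _%:R; apply: eq_card => Z; rewrite !inE sE andbC.
have [pb|pb] := boolP (p%:Z %| b)%Z.
  rewrite (eq_card (B := pred1 0)) ?card1 // => Z; rewrite !inE sE negbK.
  have [->|//] := eqVneq Z 0.
  rewrite mulmx0 map_scalar_mx rmorphM /=; have /eqP -> : b%:~R == 0 :> 'F_p by rewrite intr_Fp_eq0.
  by rewrite mulr0 raddf0 eqxx.
rewrite eq_card0 // => Z; rewrite !inE sE negbK.
have [->|//] := eqVneq Z 0; rewrite ?andbF //= mulmx0 map_scalar_mx eq_sym.
apply/negbTE; apply: contra pb => /eqP /(congr1 (fun M : 'M_1 => M 0 0)); rewrite !mxE mulr1n.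
move/eqP; rewrite rmorphM mulf_eq0 /= [b%:~R == 0]intr_Fp_eq0 //.
by rewrite rmorph_nat (negbTE (Fp_two_neq0 p_pr p_odd)).
Qed.

Lemma prim_count k b : (0 < k)%N ->
  sumM (p ^ k) (fun Z => ind (solP G (2%:R * b)%:M (@nonzero N 1) k Z)) =
  (q ^+ k) ^+ (2 * t.+1) * primval b.
Proof.
move=> k0; have sB : ((2%:R * b)%:M : 'M[int]_1)^T = (2%:R * b)%:M by rewrite tr_scalar_mx.
have := dens_const p_pr p_odd (tr_GLH N) sB nonzero_free k0.
rewrite dens1E // card_prim /dens binn !muln1 !expn1 !natrX -/q.
have qk0 : q ^+ k != 0 by rewrite expf_neq0.
set a := sumM _ _ => H.
have NE : N = (2 * t.+1).+1 by rewrite /N /dimLH mulnS.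
have aux1 (c U V D : R) : U != 0 -> V != 0 -> c / U * V = D -> c = D * (U / V).
  by move=> U0 V0 <-; field; rewrite U0 V0.
have aux2 (W P U K V : R) : W != 0 -> U != 0 -> K != 0 -> W * P / (U * W) * U * ((K * V) / K) = V * P.
  by move=> W0 U0 K0; field; rewrite W0 U0 K0.
by rewrite (aux1 _ _ _ _ _ _ H) ?expf_neq0 // NE !exprS aux2 ?expf_neq0 // mulf_neq0 // expf_neq0.
Qed.

Definition cntz k b : R := sumM (p ^ k) (fun Z : 'M[int]_(N, 1) => ind (solq k b Z && (phi Z == 0))).

Lemma cntq_split k b : (0 < k)%N -> cntq k b = (q ^+ k) ^+ (2 * t.+1) * primval b + cntz k b.
Proof.
move=> k0; rewrite -prim_count // /cntq /cntz /sumM -big_split /=; apply: eq_bigr => Z _.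
rewrite /solP -/(eqM _ _ _) -/(solq k b _) /nonzero /ind.
by case: (solq _ _ _) => //=; case: (phi (zmx Z) == 0) => //=; rewrite ?addr0 ?add0r.
Qed.

Lemma cntzE k b : cntz k.+1 b = sumM (p ^ k) (fun Z => ind (solq k.+1 b (p%:Z *: Z))).
Proof.
rewrite /cntz expnS sumM_glue {1}/sumM.
pose x0 : 'M['I_p]_(N, 1) := const_mx (Ordinal (prime_gt0 p_pr)).
have zx0 : zmx x0 = 0 by apply/matrixP=> i j; rewrite !mxE.
have phip (Y : 'M[int]_(N, 1)) : phi (p%:Z *: Y) = 0.
  apply/eqP; rewrite -(map_mx0 (intr : int -> 'F_p)) -eqM_phi //.
  by apply/eqMP; exists Y; rewrite add0r.
rewrite (bigD1 x0) //= big1 ?addr0 => [|x xx0].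
  by apply: eq_sumM => Y; rewrite zx0 add0r phip eqxx andbT.
have nz : phi (zmx x) != 0.
  apply: contra xx0 => /eqP/matrixP H; apply/eqP/matrixP => i j; apply: val_inj; rewrite mxE /=.
  have /eqP := H i j; rewrite !mxE intr_Fp_eq0 // dvdzE /= => d.
  by apply/eqP; rewrite -leqn0 leqNgt; apply/negP => x_gt0; have := dvdn_leq x_gt0 d; rewrite leqNgt ltn_ord.
rewrite -[RHS](mulr0 ((p ^ k) ^ (N * 1))%:R) -sumM_const; apply: eq_sumM => Y.
by rewrite map_mxD phip addr0 (negbTE nz) andbF.
Qed.

Lemma qf_scale (Z : 'M[int]_(N, 1)) (a : int) : (a *: Z)^T *m G *m (a *: Z) = a ^+ 2 *: (Z^T *m G *m Z).
Proof. by rewrite trmxZ -!scalemxAl -scalemxAr scalerA. Qed.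

(** Dividing a vector by [p] lowers the valuation of its norm and the precision of the equation by 2
    each; this drives both the count and the lifting below. *)
Lemma solq_scale k b Z : solq k.+2 ((p ^ 2)%N%:Z * b) (p%:Z *: Z) = solq k b Z.
Proof.
rewrite /solq qf_scale mulrCA /eqM -[p%:Z ^+ 2]/(p%:Z * p%:Z).
rewrite -[(p ^ 2)%N%:Z]/((p * p)%N%:Z) PoszM -(scale_scalar_mx _ (p%:Z * p%:Z)) -scalerBr.
have p0 : p%:Z * p%:Z != 0 by rewrite mulf_neq0 // eqz_nat -lt0n prime_gt0.
apply/dvdMP/dvdMP => -[E EE].
  exists E; apply: (scalemx_intI p0); rewrite EE scalerA; congr (_ *: _).
  by rewrite !expnS !PoszM mulrA.
by exists E; rewrite EE scalerA !expnS !PoszM mulrA.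
Qed.

Lemma solq_not_dvd k b Z : (0 < k)%N -> ~~ (p%:Z %| b)%Z -> solq k b (p%:Z *: Z) = false.
Proof.
move=> k0 nb; apply/negP; rewrite /solq qf_scale => H.
have /eqM_entry/(_ 0 0) : eqM p (p%:Z ^+ 2 *: (Z^T *m G *m Z)) (2%:R * b)%:M.
  by apply: eqM_dvd H; rewrite dvdzE /= dvdn_exp.
move=> /eqP; rewrite [_ 0 0]mxE [X in (_ == X %[mod _])%Z]mxE mulr1n eqz_mod_dvd.
rewrite rpredBl; last by rewrite expr2 -mulrA dvdz_mulr.
by have := dvd_two p_pr p_odd 1 b; rewrite expn1 => ->; apply/negP.
Qed.

Lemma solq_not_dvd2 k b Z : (1 < k)%N -> ~~ (p%:Z %| b)%Z -> solq k (p%:Z * b) (p%:Z *: Z) = false.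
Proof.
move=> k1 nb; apply/negP; rewrite /solq qf_scale => H.
have /eqM_entry/(_ 0 0) : eqM (p * p)%N (p%:Z ^+ 2 *: (Z^T *m G *m Z)) (2%:R * (p%:Z * b))%:M.
  by apply: eqM_dvd H; rewrite dvdzE /= -[(p * p)%N]/(p ^ 2)%N dvdn_exp2l.
move=> /eqP; rewrite [_ 0 0]mxE [X in (_ == X %[mod _])%Z]mxE mulr1n eqz_mod_dvd.
rewrite rpredBl; last by rewrite PoszM expr2 dvdz_mulr.
rewrite mulrCA PoszM dvdz_mul2l; last by rewrite eqz_nat -lt0n prime_gt0.
by have := dvd_two p_pr p_odd 1 b; rewrite expn1 => ->; apply/negP.
Qed.

(* Density of solutions of [Q = b] in [L + H^t] for [b] of valuation [v]; [kappa] is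
   [sqc] of twice the unit part of [b]. *)
Fixpoint dval (kappa : R) (v : nat) {struct v} :=
  match v with
  | 0 => 1 - X + X * kappa
  | 1 => 1 - X ^+ 2
  | v'.+2 => 1 - X ^+ 2 + q * X ^+ 2 * dval kappa v'
  end.

Lemma primval_dvd b : (p%:Z %| b)%Z -> primval b = 1 - X ^+ 2.
Proof.
move=> pb; rewrite /primval pb.
have -> : (2%:R * b)%:~R = 0 :> 'F_p.
  by apply/eqP; rewrite rmorphM mulf_eq0 /= [b%:~R == 0]intr_Fp_eq0 // pb orbT.
have -> : sqc (0 : 'F_p) = 1.
  rewrite /sqc (eq_card (B := pred1 0)) ?card1 // => x; rewrite !inE eq_sym mulf_eq0 oppr_eq0.
  by rewrite (negbTE (Fp_two_neq0 p_pr p_odd)) /= sqrf_eq0.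
by rewrite mulr1 mulr1n subrK mulr1.
Qed.

Lemma cntq_val v b0 k : ~~ (p%:Z %| b0)%Z -> (v < k)%N ->
  cntq k ((p ^ v)%N%:Z * b0) = (q ^+ k) ^+ (2 * t.+1) * dval (sqc ((2%:R * b0)%:~R : 'F_p)) v.
Proof.
move=> nb; elim/ltn_ind: v k => -[|[|v]] IH k vk.
- rewrite expn0 mul1r cntq_split //.
  case: k vk => // k _; rewrite cntzE.
  rewrite (eq_sumM _ (g := fun _ => 0)) ?sumM_const ?mulr0 ?addr0; last by move=> Z; rewrite solq_not_dvd.
  by rewrite /primval (negbTE nb) mulr0n mulr0 subr0.
- rewrite expn1 cntq_split; last exact: ltnW.
  rewrite primval_dvd ?dvdz_mulr //.
  case: k vk => // k k0; rewrite cntzE.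
  by rewrite (eq_sumM _ (g := fun _ => 0)) ?sumM_const ?mulr0 ?addr0 // => Z; rewrite solq_not_dvd2.
case: k vk => [|[|k]] // vk.
rewrite cntq_split // primval_dvd; last by rewrite dvdz_mulr // dvdzE /= expnS dvdn_mulr.
rewrite cntzE.
(* The vector [Z] runs modulo [p^(k+1)], while the rescaled condition only sees it modulo [p^k]:
   hence the factor [p^N]. Normalised, it becomes the [q X^2] of [dval]. *)
have -> : sumM (p ^ k.+1) (fun Z : 'M[int]_(N, 1) => ind (solq k.+2 ((p ^ v.+2)%N%:Z * b0) (p%:Z *: Z))) =
  q ^+ N * cntq k ((p ^ v)%N%:Z * b0).
  rewrite (eq_sumM _ (g := fun Z => ind (solq k ((p ^ v)%N%:Z * b0) Z))); last first.
    move=> Z; congr ind; rewrite -[RHS](solq_scale k).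
    by rewrite mulrA -PoszM -expnD.
  rewrite expnSr sumM_periodic ?muln1 ?natrX //.
  by apply: periodic_mxk => Y Y' YY; rewrite (solq_eqM _ YY).
rewrite IH //=; set D := dval _ v.
have NE : N = (2 * t.+1).+1 by rewrite /N /dimLH mulnS.
have XE : X ^+ 2 = (q ^+ (2 * t.+1))^-1 by rewrite /X exprVn -exprM mulnC.
rewrite [RHS]mulrDr; congr (_ + _); rewrite NE XE !exprS !exprMn.
by field; rewrite expf_neq0.
Qed.

End Mu.

Section MuValue.

Variable p : nat.
Hypothesis p_pr : prime p.
Hypothesis p_odd : p <> 2%N.
Variable t : nat.
Let N := dimLH t.
Let G := GLH N.
Local Notation phi := (map_mx (intr : int -> 'F_p)).
Let q : R := p%:R.

Definition solx (x : padic) k (a : nat -> nat -> padic) := solq (t := t) p k (x k) (mxk N 1 a k).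

Lemma near_qE x k a : is_zp p x -> near_form p N (coefLH p t) 1 (coefq x) k a <-> solx x k a.
Proof.
move=> zx; have -> := near_formE p_pr p_odd (coefLH_int t) N (n := 1) (cM := coefq x) k a (fun i j _ => zx).
rewrite gramI_LH /solx /solq; suff -> : gramK 1 (coefq x) k = (2%:R * x k)%:M by [].
by apply/matrixP=> i j; rewrite !mxE !ord1 eqxx mulr1n.
Qed.

Lemma isom_qE x a : is_zp p x -> Defs.isom p N (coefLH p t) 1 (coefq x) a <-> forall k, solx x k a.
Proof.
by move=> zx; split=> [H k|H i j ij k]; [apply/near_qE => // i j ij; apply: H | move/(near_qE _ _ zx): (H k); apply].
Qed.

Lemma solq_mod k b b' Z : red p k b = red p k b' -> solq (t := t) p k b Z = solq (t := t) p k b' Z.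
Proof.
move=> bb; have e : eqM (p ^ k)%N ((2%:R * b)%:M : 'M_1) (2%:R * b')%:M.
  apply/eqM_entry => i j; rewrite !ord1 !mxE !mulr1n; exact: red_mul.
rewrite /solq; apply/idP/idP => H; first exact: eqM_trans H e.
by apply: eqM_trans H _; rewrite eqM_sym.
Qed.

(** Newton lifting applies directly if [Z] is nonzero modulo [p]. Otherwise [Z = p Z'], and [Z']
    solves the problem for [x/p^2] modulo [p^(k-2)]. Each such descent costs two levels of precision
    and multiplying back by [p] regains one, so agreement modulo [p^(k-v)] survives. *)
Lemma solq_lift v x k Z : is_zp p x -> x v = 0 -> x v.+1 != 0 -> (v < k)%N ->
  solq (t := t) p k (x k) Z ->
  exists a, [/\ zmat p N 1 a, forall j, solx x j a & forall j, (j + v <= k)%N -> eqM (p ^ j)%N (mxk N 1 a j) Z].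
Proof.
elim/ltn_ind: v x k Z => v IH x k Z zx xv xv1 vk sZ.
have k0 : (0 < k)%N := leq_ltn_trans (leq0n v) vk.
have [pZ|nZ] := eqVneq (phi Z) 0; last first.
  pose B j : 'M[int]_1 := (2%:R * x j)%:M.
  have sB j : (B j)^T = B j by rewrite tr_scalar_mx.
  have cB j : eqM (p ^ j)%N (B j.+1) (B j).
    apply/eqM_entry => a b; rewrite !ord1 !mxE !mulr1n; apply: to_red; apply: red_mul => //.
    by rewrite [in RHS]zx red_id.
  have free : row_free (phi (Z^T *m G)) by rewrite map_mxM -map_trmx; apply: nonzero_free.
  have [X [cX sX X0]] := newton_lift p_pr p_odd (tr_GLH N) sB cB k0 sZ free.
  have mX l : eqM (p ^ l)%N (mxk N 1 (toP p X) l) (X l) := mxk_toP p X l.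
  exists (toP p X); split.
  - exact: zmat_toP.
  - move=> j; rewrite /solx (solq_eqM _ (mX j)).
    case: (leqP k j) => kj; first exact: sX.
    rewrite X0 ?(ltnW kj) // (solq_mod _ (b' := x k)); last by rewrite (zp_le zx (ltnW kj)) red_id.
    by apply: eqM_dvd sZ; rewrite dvdzE /= dvdn_exp2l // ltnW.
  - by move=> j jk; have := mX j; rewrite X0 // (leq_trans (leq_addr v j)).
have [Z' ZZ'] : exists Z', Z = p%:Z *: Z'.
  by apply/dvdMP; rewrite dvdM_Fp // pZ.
(* The norm of a multiple of [p] is divisible by [p^2], so [x] vanishes modulo [p] and then modulo
   [p^2], which leaves only [v >= 2]. *)
have x1 : x 1%N = 0.
  apply/eqP/negPn/negP => x1; move: sZ; rewrite ZZ' solq_not_dvd //.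
  apply: contra x1 => /dvdz_mod0P d; rewrite (zp_le zx k0) /red /pk expn1 d //.
have v0 : (0 < v)%N by case: v xv1 {IH xv vk} => //; rewrite x1.
have x2 : x 2%N = 0.
  apply/eqP/negPn/negP => x2.
  have v1 : (v < 2)%N by rewrite ltnNge; apply/negP => v2; move: x2; rewrite (zp_val0 zx xv v2).
  have k2 : (2 <= k)%N by apply: leq_ltn_trans vk.
  have e := shiftE k.-1 zx x1; rewrite addn1 prednK // expn1 in e.
  move: sZ; rewrite ZZ' e solq_not_dvd2 //.
  apply: contra x2 => /dvdzP[c cE]; rewrite (zp_le zx k2) e cE.
  by apply/eqP/dvdz_mod0P; rewrite mulrC -mulrA dvdz_mull // /pk expnS expn1 PoszM.
have v2 : (2 <= v)%N.
  rewrite ltnNge; apply/negP => v1; have v1E : v = 1%N by lia.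
  by move: xv1; rewrite v1E x2 eqxx.
pose y := shift p 2 x; have zy : is_zp p y := is_zp_shift p_pr zx x2.
have k2 : (2 <= k)%N by apply: leq_trans v2 (ltnW vk).
have xy j : x j.+2 = (p ^ 2)%N%:Z * y j by rewrite -addn2 (shiftE _ zx x2).
have h1 : (v - 2 < v)%N by rewrite ltn_subrL v0.
have h2 : y (v - 2)%N = 0 by apply/eqP; rewrite shift_eq0 // subnK // xv.
have h3 : y (v - 2).+1 != 0 by rewrite shift_eq0 // addSn subnK.
have h4 : (v - 2 < k - 2)%N by rewrite ltn_sub2r // (leq_ltn_trans v2).
have h5 : solq (t := t) p (k - 2) (y (k - 2)%N) Z'.
  move: sZ; rewrite ZZ' -[k in solq _ k](subnK k2) -[k in x k](subnK k2) addn2 xy.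
  by rewrite solq_scale.
have [a [za sa aZ]] := IH _ h1 _ _ _ zy h2 h3 h4 h5.
pose b i j l := red p l (p%:Z * a i j l).
have ba l : eqM (p ^ l)%N (mxk N 1 b l) (p%:Z *: mxk N 1 a l).
  by apply/eqM_entry => i j; rewrite !mxE; apply: red_id.
exists b; split.
- by move=> i j iN j1; apply: coh_zp; apply: coh_mul => //; apply/zp_coh/za.
- move=> j; rewrite /solx (solq_eqM _ (ba j)).
  have := sa j; rewrite /solx -solq_scale // => sj.
  rewrite (solq_mod _ (b' := (p ^ 2)%N%:Z * y j)); last first.
    by rewrite -xy [LHS](zp_red _ zx) (zp_le zx (leqW (leqnSn j))).
  by apply: eqM_dvd sj; rewrite dvdzE /= dvdn_exp2l // leqW.
- move=> [|j] jk; first by apply/eqM_entry => i l; rewrite !modz1.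
  apply: eqM_trans (ba _) _; rewrite ZZ'.
  have aj : eqM (p ^ j)%N (mxk N 1 a j.+1) Z'.
    apply: (eqM_trans (B := mxk N 1 a j)); first by apply: zmat_coh.
    by apply: aZ; lia.
  move/eqMP: aj => [E ->]; apply/eqMP; exists E.
  by rewrite scalerDr scalerA expnS PoszM.
Qed.

Lemma absp_two x v : is_zp p x -> x v = 0 -> x v.+1 != 0 ->
  absp p (detz p 1 (gram p 1 (coefq x))) = (q ^+ v)^-1.
Proof.
move=> zx xv xv1; have dE k : detz p 1 (gram p 1 (coefq x)) k = red p k (2%:R * x k).
  by rewrite /detz det_mx11 mxE /gram eqxx red_id.
rewrite (absp_val p_pr (v := v)) ?natrX //.
- by move=> k; rewrite !dE red_le //; apply: red_mul => //; rewrite zp_red.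
- by rewrite dE xv mulr0 /red mod0z.
rewrite dE; apply/eqP => /dvdz_mod0P; rewrite -/(pk p _) /pk dvd_two // => /dvdz_mod0P d.
by move: xv1; rewrite -(zp_red _ zx) /red /pk d eqxx.
Qed.

(** For [k > r + v], every solution modulo [p^k] is automatically [p^r]-close to an exact one by
    [solq_lift], so the closeness condition disappears. *)
Lemma haar_q v x k r : is_zp p x -> x v = 0 -> x v.+1 != 0 -> (r + v < k)%N ->
  haarM p N 1 (fun a => Rind (near_form p N (coefLH p t) 1 (coefq x) k a /\
    near_set p N 1 r (fun a => zmat p N 1 a /\ Defs.isom p N (coefLH p t) 1 (coefq x) a) a)) =
  cntq p t k (x k) / ((p ^ k) ^ (N * 1))%:R.
Proof.
move=> zx xv xv1 rk; apply: haarM_ev => //.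
  by apply: periodic_mxk => Y Y' YY; rewrite (solq_eqM _ YY).
move=> Z; set a := toP p _; apply: Rind_bool.
have aZ j : eqM (p ^ j)%N (mxk N 1 a j) Z := mxk_toP p (fun _ => Z) j.
rewrite -(solq_eqM _ (aZ k)); split=> [[/(near_qE _ _ zx)]//|sa].
split; first exact/near_qE.
have sZ := sa; rewrite (solq_eqM _ (aZ k)) in sZ.
have [g [zg sg gZ]] := solq_lift zx xv xv1 (leq_ltn_trans (leq_addl r v) rk) sZ.
exists g; split; first by split=> //; apply/isom_qE.
move=> i j iN jN.
have /eqM_entry /(_ (Ordinal iN) (Ordinal jN)) : eqM (p ^ r)%N (mxk N 1 a r) (mxk N 1 g r).
  by apply: eqM_trans (aZ r) _; rewrite eqM_sym; apply: gZ; apply: ltnW.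
rewrite !mxE /= => e.
rewrite -[RHS](zp_red _ (zg _ _ iN jN)); have -> : red p r (g i j r) = red p r (a i j r) by exact/esym.
by rewrite /a -[i]/(val (Ordinal iN)) -[j]/(val (Ordinal jN)) toPE red_id.
Qed.

Definition kappa v (x : padic) : R := sqc ((2%:R * shift p v x 1)%:~R : 'F_p).

Lemma mu_val v x : is_zp p x -> x v = 0 -> x v.+1 != 0 ->
  mu_p p x t = Rdiv (Rpower (q ^+ v)^-1 (Rdiv (- INR N) 2)) (Rpower (q ^+ v)^-1 (Rdiv (- (INR 1 + 1)) 2))
    * dval p t (kappa v x) v.
Proof.
move=> zx xv xv1; rewrite /mu_p /fibre -/N.
apply: (@Rlim_ev _ _ 0) => r _; apply: (@Rlim_ev _ _ (r + v).+1) => k rk.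
rewrite (haar_q zx xv xv1 rk) /homfac /qffac (absp_two zx xv xv1).
rewrite detz_gram gramI_LH absp_zint ?GLH_det_unit //.
have -> : Rpower 1 (INR 1 / 2) = 1 by rewrite /Rpower ln_1 Rmult_0_r exp_0.
have vk : (v < k)%N by apply: leq_trans rk; rewrite ltnS leq_addl.
have zs := is_zp_shift p_pr zx xv.
have xk : x k = (p ^ v)%N%:Z * shift p v x (k - v)%N by rewrite -shiftE // subnK // ltnW.
have s1 : shift p v x 1 = red p 1 (shift p v x (k - v)%N) by apply: zp_le; rewrite ?subn_gt0.
have nd : ~~ (p%:Z %| shift p v x (k - v)%N)%Z.
  have : shift p v x 1 != 0 by rewrite shift_eq0.
  by apply: contra => /dvdz_mod0P d; rewrite s1 /red /pk expn1 d.
rewrite xk cntq_val // -/q.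
have <- : kappa v x = sqc ((2%:R * shift p v x (k - v)%N)%:~R : 'F_p).
  rewrite /kappa; congr sqc; apply/eqP; rewrite -red1_Fp //; apply/eqP.
  by apply: red_mul => //; rewrite s1 red_id.
set D := dval _ _ _ _; rewrite !RealsE !natrX -/q mul1r.
set A := Rpower _ _; set B := Rpower _ _.
have B0 : B != 0 by apply/eqP; apply: Rgt_not_eq; apply: exp_pos.
have qk0 : q ^+ k != 0 by rewrite expf_neq0 // pnatr_eq0 -lt0n prime_gt0.
have -> : (N * 1 = (2 * t.+1).+1)%N by rewrite /N /dimLH muln1 mulnS.
rewrite [(q ^+ k) ^+ (2 * t.+1).+1]exprS.
have aux (a b c K W : R) : b != 0 -> K != 0 -> W != 0 -> a * (W * c / (K * W)) / (b * K^-1) = a / b * c.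
  by move=> b0 K0 W0; field; rewrite b0 K0 W0.
by rewrite aux // expf_neq0.
Qed.

End MuValue.

(** * Zeta integrals of binary forms *)

Section BinarySums.

Variable p : nat.
Hypothesis p_pr : prime p.
Hypothesis p_odd : p <> 2%N.
Variable e : nat.
Let q : R := p%:R.
Let w := (q^-1) ^+ e.

Let q0 : q != 0. Proof. by rewrite pnatr_eq0 -lt0n prime_gt0. Qed.

Lemma sumM_lin m d (M M' : 'M[int]_m) (f : 'cV[int]_m -> R) : (0 < d)%N ->
  (forall x y, eqM d x y -> f x = f y) -> eqM d (M *m M') 1%:M ->
  sumM d (fun x => f (M *m x)) = sumM d f.
Proof.
(* The modulus 1 is treated apart because ['Z_1] is not the zero ring. *)
move=> d0 pf MM; have [d1|d1] := leqP d 1.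
  have dE : d = 1%N by apply/eqP; rewrite eqn_leq d1.
  by apply: eq_sumM => x; apply: pf; apply/eqM_entry => i j; rewrite dE !modz1.
pose ph0 a b (x : 'M[int]_(a, b)) : 'M['Z_d]_(a, b) := map_mx (intr : int -> 'Z_d) x.
pose g (y : 'M['Z_d]_(m, 1)) := f (map_mx (fun x : 'Z_d => (x : nat)%:Z) y).
have eph a b (x y : 'M[int]_(a, b)) : ph0 _ _ x = ph0 _ _ y -> eqM d x y.
  move=> /matrixP H; apply/eqM_entry => i j; apply/eqP; rewrite -intr_Zp_eq //.
  by have := H i j; rewrite !mxE => ->.
have phe a b (x y : 'M[int]_(a, b)) : eqM d x y -> ph0 _ _ x = ph0 _ _ y.
  move=> /eqM_entry H; apply/matrixP=> i j; rewrite !mxE; apply/eqP.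
  by rewrite intr_Zp_eq // H.
have fg x : f x = g (ph0 _ _ x).
  apply: pf; apply: eph; apply/matrixP=> i j; rewrite !mxE -pmulrn natr_Zp //.
transitivity (sumM d (fun x => (g \o mulmx (ph0 _ _ M)) (ph0 _ _ x))).
  by apply: eq_sumM => x; rewrite fg /= /ph0 map_mxM.
rewrite (sumM_Zp (g \o mulmx (ph0 _ _ M))) // (eq_sumM _ fg) (sumM_Zp g) //.
rewrite [RHS](reindex (mulmx (ph0 _ _ M))) //.
have MM1 : ph0 _ _ M *m ph0 _ _ M' = 1%:M by have := phe _ _ _ _ MM; rewrite /ph0 map_mxM map_mx1.
apply: onW_bij; exists (mulmx (ph0 _ _ M')) => y; rewrite mulmxA.
  by rewrite (mulmx1C MM1) mul1mx.
by rewrite MM1 mul1mx.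
Qed.

Definition vec2 (a c : int) : 'cV[int]_(1 + 1) := col_mx a%:M c%:M.

Lemma sumM2 d (f : 'cV[int]_(1 + 1) -> R) :
  sumM d f = \sum_(a < d) \sum_(c < d) f (vec2 (a : nat)%:Z (c : nat)%:Z).
Proof.
rewrite pair_big /= /sumM.
pose h (u : 'I_d * 'I_d) : 'M['I_d]_(1 + 1, 1) := col_mx (const_mx u.1) (const_mx u.2).
rewrite (reindex h) /=.
  apply: eq_bigr => -[a c] _; congr f; rewrite /h /zmx map_col_mx /vec2 /=.
  by congr col_mx; apply/matrixP => i j; rewrite !ord1 !mxE mulr1n.
apply: onW_bij; exists (fun x : 'M['I_d]_(1 + 1, 1) => (usubmx x 0 0, dsubmx x 0 0)).
  by move=> [a c]; rewrite /h /= col_mxKu col_mxKd !mxE.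
move=> x; rewrite /h /= -[RHS]vsubmxK; congr col_mx; apply/matrixP=> i j; rewrite !ord1 [LHS]mxE //.
Qed.

(** [|z|^e] as seen modulo [p^r]: the residue 0 gets the value [p^(-r e)], which makes scaling by
    [p] exact. *)
Definition W r (z : int) := absk p r (red p r z) ^+ e.

Lemma W_mod r z z' : red p r z = red p r z' -> W r z = W r z'.
Proof. by rewrite /W => ->. Qed.

Lemma W_unit r z : ~~ (p%:Z %| z)%Z -> W r.+1 z = 1.
Proof.
move=> nz; rewrite /W /absk; case: eqP => [z0|/eqP z0].
  case/negP: nz; move/dvdz_mod0P: z0; apply: dvdz_trans.
  by rewrite dvdzE /= expnS dvdn_mulr.
rewrite (_ : logn _ _ = 0)%N ?expn0 ?invr1 ?expr1n //.
apply/eqP; rewrite -leqn0 leqNgt -pfactor_dvdn ?absz_gt0 //.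
apply: contra nz; rewrite expn1 => d.
have : (p%:Z %| red p r.+1 z)%Z by [].
have := red_dvd p r.+1 (red p r.+1 z) z; rewrite red_id eqxx => /esym d' d2.
rewrite -(subKr (red p r.+1 z) z) rpredB //; apply: dvdz_trans d'.
by rewrite dvdzE /= expnS dvdn_mulr.
Qed.

Lemma W_scale r j z : W (r + j) ((p ^ j)%N%:Z * z) = w ^+ j * W r z.
Proof.
rewrite /W; have -> : red p (r + j) ((p ^ j)%N%:Z * z) = (p ^ j)%N%:Z * red p r z.
  rewrite /red /pk expnD mulnC PoszM mulz_modr // ltz_nat expn_gt0 prime_gt0 //.
suff H y : absk p (r + j) ((p ^ j)%N%:Z * y) = (q^-1) ^+ j * absk p r y.
  by rewrite H exprMn /w -!exprM mulnC.
have pj : (p ^ j)%N%:Z != 0 by rewrite eqz_nat -lt0n expn_gt0 prime_gt0.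
rewrite /absk mulf_eq0 (negbTE pj) /=; case: eqP => y0.
  by rewrite expnD natrM invfM mulrC natrX exprVn.
rewrite abszM absz_nat lognM ?absz_gt0 ?expn_gt0 ?(prime_gt0 p_pr) //; last exact/eqP.
by rewrite lognX logn_prime // eqxx muln1 expnD natrM invfM natrX exprVn.
Qed.

Lemma W_mul_unit r b z : ~~ (p%:Z %| b)%Z -> W r (b * z) = W r z.
Proof.
move=> nb; rewrite /W /absk.
have E0 : (red p r (b * z) == 0) = (red p r z == 0).
  have r0 y : (red p r y == 0) = ((p ^ r)%N%:Z %| y)%Z by apply/eqP/dvdz_mod0P.
  by rewrite !r0 Gauss_dvdzr // coprimezE /= coprimeXl // prime_coprime.
rewrite E0; case: eqP => // /eqP z0; congr (_%:R^-1 ^+ _); congr (p ^ _)%N.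
have z1 : red p r (b * z) != 0 by rewrite E0.
have dv j y : red p r y != 0 -> (j <= logn p `|red p r y|)%N = (j <= r)%N && ((p ^ j)%N%:Z %| y)%Z.
  move=> y0; rewrite -pfactor_dvdn ?absz_gt0 //.
  have [jr|rj] /= := leqP j r.
    have e' := red_dvd p r (red p r y) y; rewrite red_id eqxx in e'.
    have d' : ((p ^ j)%N%:Z %| red p r y - y)%Z.
      by apply: dvdz_trans (esym e'); rewrite dvdzE /= dvdn_exp2l.
    change (((p ^ j)%N%:Z %| red p r y)%Z = ((p ^ j)%N%:Z %| y)%Z).
    by rewrite -[RHS](rpredDl _ d') subrK.
  apply/negP => d; have : (p ^ j <= `|red p r y|)%N by rewrite dvdn_leq ?absz_gt0.
  have ppos : (0 : int) < pk p r by rewrite ltz_nat expn_gt0 prime_gt0.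
  rewrite leqNgt => /negP; apply; apply: (@leq_trans (p ^ r)); last by rewrite leq_exp2l ?prime_gt1 // ltnW.
  rewrite -ltz_nat gez0_abs; first exact: ltz_pmod.
  by apply: modz_ge0; rewrite gt_eqF.
have key j : (j <= logn p `|red p r (b * z)|)%N = (j <= logn p `|red p r z|)%N.
  by rewrite !dv // Gauss_dvdzr // coprimezE /= coprimeXl // prime_coprime.
by apply/eqP; rewrite eqn_leq -key leqnn key leqnn.
Qed.

Lemma sum_split_unit r (f : nat -> R) c : (forall z, ~~ (p %| z)%N -> f z = c) ->
  \sum_(x < p ^ r.+1) f x = (q - 1) * q ^+ r * c + \sum_(j < p ^ r) f (p * j)%N.
Proof.
move=> fc; rewrite expnS sum_ord_glue (bigD1 (Ordinal (prime_gt0 p_pr))) //= addrC; congr (_ + _).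
rewrite (eq_bigr (fun _ => q ^+ r * c)) => [|i i0].
  rewrite sumr_const -[LHS]mulr_natl mulrA; congr (_ * _ * _).
  have := cardC1 (Ordinal (prime_gt0 p_pr)); rewrite card_ord => cE.
  rewrite -(natrB R (prime_gt0 p_pr)) subn1 -cE; congr _%:R.
rewrite (eq_bigr (fun _ => c)) => [|j _]; first by rewrite sumr_const card_ord -natrX mulr_natl.
apply: fc; rewrite dvdn_addl ?dvdn_mulr //; apply/negP => d.
have i_gt0 : (0 < i)%N by rewrite lt0n; apply: contraNneq i0 => i0; apply/eqP/val_inj.
by have := dvdn_leq i_gt0 d; rewrite leqNgt ltn_ord.
Qed.

Lemma sum_periodic r j (f : nat -> R) : (forall x y, f (x + p ^ r * y)%N = f x) ->
  \sum_(x < p ^ (r + j)) f x = q ^+ j * \sum_(x < p ^ r) f x.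
Proof.
move=> pf; rewrite expnD sum_ord_glue mulr_sumr; apply: eq_bigr => x _.
rewrite (eq_bigr (fun _ => f x)) => [|y _]; last exact: pf.
by rewrite sumr_const card_ord -natrX mulr_natl.
Qed.

Lemma sum_periodic1 r (f : nat -> R) : (forall x y, f (x + p ^ r * y)%N = f x) ->
  \sum_(x < p ^ r.+1) f x = q * \sum_(x < p ^ r) f x.
Proof. by move=> pf; rewrite -addn1 sum_periodic // expr1. Qed.

Definition S2 (f : int -> R) r (al be : int) : R :=
  \sum_(a < p ^ r) \sum_(c < p ^ r) f (al * (a : nat)%:Z ^+ 2 + be * (c : nat)%:Z ^+ 2).

Definition Sxy (f : int -> R) r : R :=
  \sum_(x < p ^ r) \sum_(y < p ^ r) f ((x : nat)%:Z * (y : nat)%:Z).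

Definition T1 r : R := \sum_(y < p ^ r) W r (y : nat)%:Z.

Lemma S2_sym f r al be : S2 f r al be = S2 f r be al.
Proof.
rewrite /S2 exchange_big; apply: eq_bigr => a _; apply: eq_bigr => c _.
by rewrite addrC.
Qed.

Lemma W_scale1 r z : W r.+1 (p%:Z * z) = w * W r z.
Proof. by have := W_scale r 1 z; rewrite addn1 expn1 expr1. Qed.

Lemma nd_sq z : (p%:Z %| z ^+ 2)%Z = (p%:Z %| z)%Z.
Proof. by rewrite -!(intr_Fp_eq0 _ p_pr) rmorphXn /= sqrf_eq0. Qed.

Lemma dvdz_mulu a b : ~~ (p%:Z %| b)%Z -> (p%:Z %| b * a)%Z = (p%:Z %| a)%Z.
Proof. by rewrite -!(intr_Fp_eq0 _ p_pr) rmorphM mulf_eq0 /= => /negbTE ->. Qed.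

Lemma red_shift r (x y : nat) : red p r (x + p ^ r * y)%N%:Z = red p r x%:Z.
Proof. by rewrite PoszD PoszM /red /pk addrC mulrC modzMDl. Qed.

(** If [p] does not divide [c], the value is a unit. For [c = p c'] a factor [p] comes out of the
    whole form, and the extra [p] moves from the first coefficient to the second. *)
Lemma S2_A r al be : ~~ (p%:Z %| be)%Z ->
  S2 (W r.+1) r.+1 (p%:Z * al) be = (q - 1) * q ^+ (2 * r).+1 + w * q * S2 (W r) r al (p%:Z * be).
Proof.
move=> nb; rewrite /S2.
transitivity (\sum_(a < p ^ r.+1) ((q - 1) * q ^+ r * 1 +
   w * \sum_(c < p ^ r) W r (al * (a : nat)%:Z ^+ 2 + p%:Z * be * (c : nat)%:Z ^+ 2))).
  apply: eq_bigr => a _.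
  rewrite (@sum_split_unit r (fun c => W r.+1 (p%:Z * al * (a : nat)%:Z ^+ 2 + be * c%:Z ^+ 2)) 1).
    congr (_ + _); rewrite mulr_sumr; apply: eq_bigr => c _.
    by rewrite -W_scale1 PoszM; congr (W _ _); ring.
  move=> z nz; apply: W_unit; rewrite rpredDl; last by rewrite -mulrA dvdz_mulr.
  by rewrite dvdz_mulu // nd_sq.
rewrite big_split /= sumr_const card_ord -mulr_sumr.
rewrite (@sum_periodic1 r (fun a => \sum_(c < p ^ r) W r (al * a%:Z ^+ 2 + p%:Z * be * (c : nat)%:Z ^+ 2))).
  rewrite -[X in X + _]mulr_natl natrX -/q mulSn mul1n !exprS ?exprD ?expr1; ring.
move=> x y; apply: eq_bigr => c _; apply: W_mod; apply: red_add => //.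
by apply: red_mul => //; rewrite !expr2; apply: red_mul; apply: red_shift.
Qed.

Lemma S2_B r al be : S2 (W r.+1) r.+1 (p%:Z * al) (p%:Z * be) = w * q ^+ 2 * S2 (W r) r al be.
Proof.
rewrite /S2.
transitivity (w * \sum_(a < p ^ r.+1) \sum_(c < p ^ r.+1) W r (al * (a : nat)%:Z ^+ 2 + be * (c : nat)%:Z ^+ 2)).
  rewrite mulr_sumr; apply: eq_bigr => a _; rewrite mulr_sumr; apply: eq_bigr => c _.
  by rewrite -W_scale1; congr (W _ _); ring.
have shiftl x y z : red p r (al * ((x + p ^ r * y)%N%:Z) ^+ 2 + z) = red p r (al * x%:Z ^+ 2 + z).
  by apply: red_add => //; apply: red_mul => //; rewrite !expr2; apply: red_mul; apply: red_shift.
have shiftr x y z : red p r (z + be * ((x + p ^ r * y)%N%:Z) ^+ 2) = red p r (z + be * x%:Z ^+ 2).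
  by apply: red_add => //; apply: red_mul => //; rewrite !expr2; apply: red_mul; apply: red_shift.
rewrite (@sum_periodic1 r (fun a => \sum_(c < p ^ r.+1) W r (al * a%:Z ^+ 2 + be * (c : nat)%:Z ^+ 2))).
  rewrite -!mulrA; congr (_ * _); congr (_ * _).
  rewrite mulr_sumr; apply: eq_bigr => a _.
  rewrite (@sum_periodic1 r (fun c => W r (al * (a : nat)%:Z ^+ 2 + be * c%:Z ^+ 2))) //.
  by move=> x y; apply: W_mod.
by move=> x y; apply: eq_bigr => c _; apply: W_mod.
Qed.

Lemma T1_rec r : T1 r.+1 = (q - 1) * q ^+ r + w * T1 r.
Proof.
rewrite /T1 (@sum_split_unit r (fun y => W r.+1 y%:Z) 1) ?mulr1 => [|z nz]; last by apply: W_unit.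
by congr (_ + _); rewrite mulr_sumr; apply: eq_bigr => c _; rewrite PoszM W_scale1.
Qed.

Lemma Sxy_rec r : Sxy (W r.+1) r.+1 = (q - 1) * q ^+ r * T1 r.+1 + w * q * Sxy (W r) r.
Proof.
rewrite /Sxy (@sum_split_unit r (fun x => \sum_(y < p ^ r.+1) W r.+1 (x%:Z * (y : nat)%:Z)) (T1 r.+1)); last first.
  by move=> z nz; apply: eq_bigr => y _; apply: W_mul_unit.
congr (_ + _); rewrite mulr_sumr; apply: eq_bigr => x _.
rewrite -mulrA -(@sum_periodic1 r (fun y => W r ((x : nat)%:Z * y%:Z))).
  by rewrite mulr_sumr; apply: eq_bigr => y _; rewrite -W_scale1 PoszM mulrA.
by move=> a b; apply: W_mod; apply: red_mul => //; apply: red_shift.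
Qed.

(* The anisotropic case: al a^2 + be c^2 is a unit unless p divides both a and c. *)
Lemma S2_C r al be : (forall a c : int, (p%:Z %| al * a ^+ 2 + be * c ^+ 2)%Z ->
    (p%:Z %| a)%Z && (p%:Z %| c)%Z) ->
  S2 (W r.+2) r.+2 al be = (q ^+ 2 - 1) * q ^+ (2 * r).+2 + w ^+ 2 * q ^+ 2 * S2 (W r) r al be.
Proof.
move=> an; rewrite /S2.
rewrite (@sum_split_unit r.+1 (fun a => \sum_(c < p ^ r.+2) W r.+2 (al * a%:Z ^+ 2 + be * (c : nat)%:Z ^+ 2)) (q ^+ r.+2)); last first.
  move=> z nz; rewrite (eq_bigr (fun _ => 1)) ?sumr_const ?card_ord ?natrX //= => c _.
  by apply: W_unit; apply: contra nz => /an /andP[].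
have -> : \sum_(a < p ^ r.+1) \sum_(c < p ^ r.+2) W r.+2 (al * (p * a)%N%:Z ^+ 2 + be * (c : nat)%:Z ^+ 2) =
  \sum_(a < p ^ r.+1) ((q - 1) * q ^+ r.+1 * 1 + w * \sum_(c < p ^ r.+1) W r.+1 (p%:Z * al * (a : nat)%:Z ^+ 2 + p%:Z * be * (c : nat)%:Z ^+ 2)).
  apply: eq_bigr => a _.
  rewrite (@sum_split_unit r.+1 (fun c => W r.+2 (al * (p * a)%N%:Z ^+ 2 + be * c%:Z ^+ 2)) 1); last first.
    by move=> z nz; apply: W_unit; apply: contra nz => /an /andP[].
  congr (_ + _); rewrite mulr_sumr; apply: eq_bigr => c _.
  by rewrite -W_scale1 !PoszM; congr (W _ _); ring.
rewrite big_split /= sumr_const card_ord -mulr_sumr.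
rewrite -[X in w * X]/(S2 (W r.+1) r.+1 (p%:Z * al) (p%:Z * be)) S2_B -/(S2 (W r) r al be).
rewrite -[X in _ + (X + _)]mulr_natl natrX -/q mulSn mul1n !exprS !exprD; ring.
Qed.

(** The form factors as [be (c - z a)(c + z a)]. The substitution [M] is invertible modulo [p^r]:
    with [h] inverse to [2z], the product [M M'] is the scalar [2zh]. *)
Lemma S2_split f r al be z h : (forall x y, red p r x = red p r y -> f x = f y) ->
  red p r al = red p r (- (be * z ^+ 2)) -> red p r (2%:R * z * h) = red p r 1 ->
  S2 f r al be = Sxy (fun x => f (be * x)) r.
Proof.
move=> fm alz zh.
pose M : 'M[int]_(1 + 1) := block_mx (- z)%:M 1%:M z%:M 1%:M.
pose M' : 'M[int]_(1 + 1) := block_mx (- h)%:M h%:M (z * h)%:M (z * h)%:M.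
pose g (v : 'cV[int]_(1 + 1)) := f (be * (usubmx v 0 0 * dsubmx v 0 0)).
have Mv a c : M *m vec2 a c = vec2 (c - z * a) (c + z * a).
  rewrite /M /vec2 mul_block_col -!scalar_mxM -!raddfD /= mulNr !mul1r.
  by congr col_mx; congr _%:M; rewrite addrC.
have := @sumM_lin _ (p ^ r)%N M M' g _ _ _.
rewrite !sumM2 => H; rewrite /S2 /Sxy -[RHS](_ : \sum_(a < p ^ r) \sum_(c < p ^ r) g (vec2 (a : nat)%:Z (c : nat)%:Z) = _); last first.
  by apply: eq_bigr => a _; apply: eq_bigr => c _; rewrite /g /vec2 col_mxKu col_mxKd !mxE !mulr1n.
rewrite -H.
- apply: eq_bigr => a _; apply: eq_bigr => c _; rewrite Mv /g /vec2 col_mxKu col_mxKd !mxE !mulr1n.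
  apply: fm; rewrite (_ : be * _ = - (be * z ^+ 2) * (a : nat)%:Z ^+ 2 + be * (c : nat)%:Z ^+ 2); last by ring.
  by apply: red_add => //; apply: red_mul.
- by rewrite expn_gt0 prime_gt0.
- move=> x y /eqM_entry xy; apply: fm; apply: red_mul => //; rewrite !mxE.
  by apply: red_mul; apply: xy.
rewrite mulmx_block -!scalar_mxM -!raddfD /=.
rewrite (_ : block_mx _ _ _ _ = (2%:R * z * h)%:M); last first.
  rewrite [RHS]scalar_mx_block; congr block_mx; rewrite -?(raddf0 (@scalar_mx int 1)); congr _%:M; ring.
apply/eqM_entry => i j; rewrite !mxE; case: (i == j) => //; exact: zh.
Qed.

End BinarySums.

(** * Limits of sequences satisfying a linear recursion *)

Section RealLimits.

(* Stated over an arbitrary [K] so that limits are parsed in [ring_scope], not in [R_scope]. *)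
Definition cvg (K : realFieldType) (u : nat -> K) (l : K) : Prop :=
  forall eps : K, 0 < eps -> exists n0, forall n, (n0 <= n)%N -> `|u n - l| <= eps.

Lemma Rlim_of_cvg (u : nat -> R) (l : R) : cvg u l -> Rlim u = l.
Proof.
move=> cu; apply: Rlim_cvg; apply/is_lim_seq_spec => -[eps /= /RltP eps0].
have h0 : 0 < eps / 2%:R by rewrite divr_gt0 ?ltr0n.
have [n0 H] := cu _ h0; exists n0 => n /ssrnat.leP n0n.
apply/RltP; rewrite !RealsE; apply: le_lt_trans (H n n0n) _.
by rewrite ltr_pdivrMr ?ltr0n // mulr_natr mulr2n ltrDl.
Qed.

Lemma cvg_eq (u v : nat -> R) (l : R) : (forall n, u n = v n) -> cvg u l -> cvg v l.
Proof. by move=> uv cu eps e0; have [n0 H] := cu _ e0; exists n0 => n nn; rewrite -uv H. Qed.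

Lemma cvg_const (l : R) : cvg (fun _ => l) l.
Proof. by move=> eps e0; exists 0%N => n _; rewrite subrr normr0 ltW. Qed.

Lemma cvg_shift m (u : nat -> R) (l : R) : cvg (fun n => u (n + m)%N) l -> cvg u l.
Proof.
move=> cu eps e0; have [n0 H] := cu _ e0; exists (n0 + m)%N => n nn.
have mn : (m <= n)%N by apply: leq_trans nn; rewrite leq_addl.
by rewrite -(subnK mn) H // leq_subRL // addnC.
Qed.

Lemma cvg_unshift m (u : nat -> R) (l : R) : cvg u l -> cvg (fun n => u (n + m)%N) l.
Proof.
move=> cu eps e0; have [n0 H] := cu _ e0; exists n0 => n nn; apply: H.
exact: leq_trans nn (leq_addr _ _).
Qed.

Lemma cvg_add (u v : nat -> R) (l m : R) : cvg u l -> cvg v m -> cvg (fun n => u n + v n) (l + m).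
Proof.
move=> cu cv eps e0; have h0 : 0 < eps / 2%:R by rewrite divr_gt0 ?ltr0n.
have [n0 H] := cu _ h0; have [n1 H1] := cv _ h0.
exists (maxn n0 n1) => n; rewrite geq_max => /andP[n0n n1n].
rewrite opprD addrACA; apply: le_trans (ler_normD _ _) _.
apply: le_trans (lerD (H n n0n) (H1 n n1n)) _.
by rewrite -splitr.
Qed.

Lemma cvg_mulc (c : R) (u : nat -> R) (l : R) : cvg u l -> cvg (fun n => c * u n) (c * l).
Proof.
move=> cu eps e0; have c0 : 0 < `|c| + 1 by rewrite ltr_wpDl.
have h0 : 0 < eps / (`|c| + 1) by rewrite divr_gt0.
have [n0 H] := cu _ h0; exists n0 => n nn; rewrite -mulrBr normrM.
apply: (@le_trans _ _ ((`|c| + 1) * (eps / (`|c| + 1)))).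
  by apply: ler_pM => //; [rewrite lerDl | apply: H].
by rewrite mulrCA divff ?mulr1 // gt_eqF.
Qed.

Lemma geom_small (x M eps : R) : 0 <= x -> x < 1 -> 0 < eps -> exists j, forall i, (j <= i)%N -> x ^+ i * M <= eps.
Proof.
move=> x0 x1 e0; case: (lerP M 0) => M0.
  by exists 0%N => i _; apply: le_trans (ltW e0); rewrite mulr_ge0_le0 // exprn_ge0.
have h0 : 0 < eps / M by rewrite divr_gt0.
have := @pow_lt_1_zero x; rewrite !RealsE => /(_ _ (eps / M)).
case=> [||j H]; [by apply/RltP; rewrite ger0_norm | by apply/RltP |].
exists j => i /ssrnat.leP ji; have /RltP := H i ji; rewrite !RealsE ger0_norm ?exprn_ge0 // => /ltW.
by rewrite ler_pdivlMr.
Qed.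

(** The limit is the fixed point of [l = b0 + x l]. Along each class of indices modulo [m] the
    distance to it shrinks by [x], up to an error controlled by [b r - b0]. *)
Lemma cvg_rec m (a b : nat -> R) (x b0 : R) : (0 < m)%N -> 0 <= x -> x < 1 ->
  (forall r, a (r + m)%N = b r + x * a r) -> cvg b b0 -> cvg a (b0 / (1 - x)).
Proof.
move=> m0 x0 x1 rec cb eps e0; set l := b0 / (1 - x).
have x1' : 0 < 1 - x by rewrite subr_gt0.
have h0 : 0 < eps / 2%:R * (1 - x) by rewrite mulr_gt0 // divr_gt0 ?ltr0n.
have [n0 H] := cb _ h0.
pose M := \sum_(i < m) `|a (n0 + i)%N - l|.
have h1 : 0 < eps / 2%:R by rewrite divr_gt0 ?ltr0n.
(* The tolerance [eps/2 (1 - x)] on [b] makes [eps/2] a fixed point of the error recursion; [M]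
   bounds all [m] starting errors at once. *)
have bound j i : (i < m)%N -> `|a (n0 + j * m + i)%N - l| <= x ^+ j * M + eps / 2%:R.
  move=> im; elim: j => [|j IH].
    rewrite expr0 mul1r mul0n addn0 -[leLHS]addr0 lerD ?(ltW h1) //.
    rewrite /M (bigD1 (Ordinal im)) //= lerDl sumr_ge0 //.
  have -> : (n0 + j.+1 * m + i = (n0 + j * m + i) + m)%N by rewrite mulSn; lia.
  rewrite rec; set r := (n0 + j * m + i)%N in IH *.
  have -> : b r + x * a r - l = (b r - b0) + x * (a r - l).
    by rewrite /l; field; rewrite gt_eqF.
  apply: le_trans (ler_normD _ _) _; rewrite normrM (ger0_norm x0).
  apply: le_trans (lerD (H r _) (ler_wpM2l x0 IH)) _.
    by rewrite /r -addnA leq_addr.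
  rewrite le_eqVlt; apply/orP; left; apply/eqP.
  by rewrite exprS; field.
have [j0 Hj] := geom_small M x0 x1 h1.
exists (n0 + j0 * m)%N => n nn.
have n0n : (n0 <= n)%N by apply: leq_trans nn; rewrite leq_addr.
pose d := (n - n0)%N.
have nE : n = (n0 + d %/ m * m + d %% m)%N by rewrite -addnA -divn_eq subnKC.
rewrite nE; apply: le_trans (bound _ _ _) _; first by rewrite ltn_mod.
rewrite [leRHS]splitr lerD //; apply: Hj.
by rewrite leq_divRL // /d leq_subRL // addnC.
Qed.

End RealLimits.

(** * Values of the zeta integrals and of their normalising volumes *)

Section ZetaLimits.

Variable p : nat.
Hypothesis p_pr : prime p.
Hypothesis p_odd : p <> 2%N.
Variable e : nat.
Let q : R := p%:R.
Let w := (q^-1) ^+ e.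
Let X := w / q.
Local Notation W := (W p e).
Local Notation S2 := (S2 p).
Local Notation Sxy := (Sxy p).

Let q0 : q != 0. Proof. by rewrite pnatr_eq0 -lt0n prime_gt0. Qed.
Let q1 : 1 < q. Proof. by rewrite ltr1n prime_gt1. Qed.
Let qr0 r : q ^+ r != 0. Proof. by rewrite expf_neq0. Qed.

Let qd r : q ^+ (2 * r) = (q ^+ r) ^+ 2. Proof. by rewrite mulnC exprM. Qed.
Let qdS r : q ^+ (2 * r).+1 = q * (q ^+ r) ^+ 2. Proof. by rewrite exprS qd. Qed.
Let qdSS r : q ^+ (2 * r).+2 = q ^+ 2 * (q ^+ r) ^+ 2. Proof. by rewrite -addn2 exprD qd mulrC. Qed.

Lemma w_ge0 : 0 <= w. Proof. by rewrite exprn_ge0 // invr_ge0 ler0n. Qed.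
Lemma w_le1 : w <= 1.
Proof.
rewrite exprn_ile1 ?invr_ge0 ?ler0n // invf_le1; first exact: ltW.
exact: lt_trans q1.
Qed.
Lemma X_ge0 : 0 <= X. Proof. by rewrite divr_ge0 ?w_ge0 ?ler0n. Qed.
Lemma X_lt1 : X < 1.
Proof. by rewrite ltr_pdivrMr ?ltr0n ?prime_gt0 // mul1r (le_lt_trans w_le1). Qed.
Lemma X_neq1 : 1 - X != 0. Proof. by rewrite subr_eq0 gt_eqF // X_lt1. Qed.

Lemma T1_cvg : cvg (fun r => T1 p e r / q ^+ r) ((1 - q^-1) / (1 - X)).
Proof.
apply: (cvg_rec (m := 1) (b := fun _ => 1 - q^-1)) => //; [exact: X_ge0|exact: X_lt1| |exact: cvg_const].
move=> r; rewrite addn1 T1_rec // -/q -/w /X exprS.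
by field; rewrite qr0 q0.
Qed.

Lemma Sxy_cvg : cvg (fun r => Sxy (W r) r / q ^+ (2 * r)) (((1 - q^-1) / (1 - X)) ^+ 2).
Proof.
rewrite expr2 mulrA; apply: (cvg_rec (m := 1) (b := fun r => (1 - q^-1) * (T1 p e r.+1 / q ^+ r.+1))) => //.
- exact: X_ge0.
- exact: X_lt1.
- move=> r; rewrite addn1 Sxy_rec // -/q -/w /X !(qdSS, qdS, qd) !exprS.
  by field; rewrite q0 qr0.
rewrite [(1 - q^-1) / _ * _]mulrC; apply: (@cvg_eq (fun r => (1 - q^-1) * (T1 p e (r + 1) / q ^+ (r + 1)))).
  by move=> r; rewrite addn1.
apply: cvg_mulc; exact: (cvg_unshift 1 T1_cvg).
Qed.

Lemma S2_mod f r al al' be be' : (forall x y, red p r x = red p r y -> f x = f y) ->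
  red p r al = red p r al' -> red p r be = red p r be' -> S2 f r al be = S2 f r al' be'.
Proof.
move=> fm ea eb; apply: eq_bigr => a _; apply: eq_bigr => c _; apply: fm.
by apply: red_add; apply: red_mul.
Qed.

(* Riemann sum mod [p^r] for the integral of [|p^n u a^2 + b c^2|^e]. *)
Definition Jseq n (u b : nat -> int) r := S2 (W r) r ((p ^ n)%N%:Z * u r) (b r) / q ^+ (2 * r).

Lemma coh_unit (u : nat -> int) r : coh p u -> ~~ (p%:Z %| u 1%N)%Z -> ~~ (p%:Z %| u r.+1)%Z.
Proof.
move=> cu; elim: r => // r IH /IH; apply: contra => d.
have := cu r.+1 => /eqP; rewrite red_dvd => d'.
have d1 : (p%:Z %| u r.+2 - u r.+1)%Z by apply: dvdz_trans d'; rewrite dvdzE /= expnS dvdn_mulr.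
by rewrite -(subKr (u r.+2) (u r.+1)) rpredB.
Qed.

Lemma Jseq1_step u b r : coh p u -> coh p b -> ~~ (p%:Z %| b 1%N)%Z ->
  Jseq 1 u b r.+1 = (1 - q^-1) + X * Jseq 1 b u r.
Proof.
move=> cu cb nb; rewrite /Jseq !expn1 S2_A //; last exact: coh_unit.
rewrite S2_sym (S2_mod _ (al' := p%:Z * b r) (be' := u r)).
- rewrite -/q -/w /X !(qdSS, qdS, qd) !exprS.
  by field; rewrite q0 qr0.
- exact: W_mod.
- by apply: red_mul.
- exact: cu.
Qed.

Lemma Jseq1_cvg u b : coh p u -> coh p b -> ~~ (p%:Z %| u 1%N)%Z -> ~~ (p%:Z %| b 1%N)%Z ->
  cvg (Jseq 1 u b) ((1 - q^-1) / (1 - X)).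
Proof.
move=> cu cb nu nb.
(* One step of the recursion exchanges [u] and [b]; two steps return to the same sequence, with
   ratio [X^2] and constant [(1 - q^-1)(1 + X)]. *)
have -> : (1 - q^-1) / (1 - X) = ((1 - q^-1) * (1 + X)) / (1 - X ^+ 2).
  have h1 := X_neq1; have h2 : 1 + X != 0 by rewrite gt_eqF // ltr_wpDr ?X_ge0.
  rewrite -[X in _ = _ / (X - _)](expr1n _ 2) subr_sqr; field.
  by rewrite h1 h2.
apply: (cvg_rec (m := 2) (b := fun _ => (1 - q^-1) * (1 + X))) => //.
- by rewrite exprn_ge0 // X_ge0.
- by rewrite exprn_ilt1 // ?X_ge0 ?X_lt1.
- by move=> r; rewrite addn2 !Jseq1_step //; ring.
exact: cvg_const.
Qed.

(** [S2_A] moves one factor [p] to the second coefficient, [S2_B] then removes the common factor: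
    the valuation drops by 2, at the cost of [w^2/q = X w]. *)
Lemma Jseq_step n u b r : coh p u -> coh p b -> ~~ (p%:Z %| b 1%N)%Z ->
  Jseq n.+2 u b r.+2 = (1 - q^-1) + X * w * Jseq n u b r.
Proof.
move=> cu cb nb; rewrite /Jseq expnS PoszM -mulrA S2_A //; last exact: coh_unit.
rewrite expnS PoszM -[p%:Z * _ * _]mulrA S2_B // (S2_mod _ (al' := (p ^ n)%N%:Z * u r) (be' := b r)).
- rewrite -/q -/w /X !(qdSS, qdS, qd) !exprS.
  by field; rewrite q0 qr0.
- exact: W_mod.
- by apply: red_mul => //; rewrite -cu -[LHS](red_le _ _ (leqnSn r)) cu red_le.
- by rewrite -cb -[LHS](red_le _ _ (leqnSn r)) cb red_le.
Qed.

Lemma Jseq0_aniso u b : coh p u -> coh p b -> ~~ (p%:Z %| u 1%N)%Z -> ~~ (p%:Z %| b 1%N)%Z ->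
  (forall z : 'F_p, (b 1%N)%:~R * z ^+ 2 + (u 1%N)%:~R != 0) ->
  cvg (Jseq 0 u b) ((1 - (q ^+ 2)^-1) / (1 - X ^+ 2)).
Proof.
move=> cu cb nu nb an.
apply: (cvg_rec (m := 2) (b := fun _ => 1 - (q ^+ 2)^-1)) => //.
- by rewrite exprn_ge0 // X_ge0.
- by rewrite exprn_ilt1 // ?X_ge0 ?X_lt1.
- move=> r; rewrite addn2 /Jseq !expn0 !mul1r S2_C //.
    rewrite (S2_mod _ (al' := u r) (be' := b r)).
    + rewrite -/q -/w /X !(qdSS, qdS, qd) !exprS.
      by field; rewrite q0 qr0.
    + exact: W_mod.
    + by rewrite -cu -[LHS](red_le _ _ (leqnSn r)) cu red_le.
    + by rewrite -cb -[LHS](red_le _ _ (leqnSn r)) cb red_le.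
  move=> x y; rewrite -!(intr_Fp_eq0 _ p_pr) !rmorphD !rmorphM /= -?expr2.
  have uE : (u r.+2)%:~R = (u 1%N)%:~R :> 'F_p.
    apply/eqP; rewrite -red1_Fp //; apply/eqP.
    elim: r => [|r IH]; first by rewrite cu.
    by rewrite -IH -(red_le _ _ (ltn0Sn r.+1)) cu red_le.
  have bE : (b r.+2)%:~R = (b 1%N)%:~R :> 'F_p.
    apply/eqP; rewrite -red1_Fp //; apply/eqP.
    elim: r {uE} => [|r IH]; first by rewrite cb.
    by rewrite -IH -(red_le _ _ (ltn0Sn r.+1)) cb red_le.
  rewrite uE bE; have [x0|x0] := eqVneq (x%:~R : 'F_p) 0.
    rewrite x0 expr0n /= mulr0 add0r mulf_eq0 [(b 1%N)%:~R == 0]intr_Fp_eq0 // (negbTE nb) /=.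
    by rewrite sqrf_eq0.
  move=> /eqP h; have := an (y%:~R / x%:~R); rewrite expr_div_n => /negP[].
  have x2 : (x%:~R : 'F_p) ^+ 2 != 0 by rewrite sqrf_eq0.
  rewrite -(mulIr_eq0 _ (mulIf x2)) mulrDl -mulrA divfK //.
  by rewrite addrC h.
exact: cvg_const.
Qed.

(** Newton lifting for 1 by 1 matrices, with target [- u]. A root is needed modulo only one
    [p^(r+1)] at a time, so the coefficient [b] may be frozen at that level. *)
Lemma sqrt_lift u b (z0 : 'F_p) : coh p u -> coh p b -> ~~ (p%:Z %| u 1%N)%Z -> ~~ (p%:Z %| b 1%N)%Z ->
  (b 1%N)%:~R * z0 ^+ 2 + (u 1%N)%:~R = 0 ->
  forall r, exists z, ~~ (p%:Z %| z)%Z /\ red p r.+1 (u r.+1) = red p r.+1 (- (b r.+1 * z ^+ 2)).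
Proof.
move=> cu cb nu nb hz r.
have /constructive_indefinite_description[Z ZE] := lift_Fp (z0%:M : 'M_1).
pose G : 'M[int]_1 := (b r.+1)%:M; pose B k : 'M[int]_1 := (- u k)%:M.
have bu k : (0 < k)%N -> (u k)%:~R = (u 1%N)%:~R :> 'F_p /\ (b k)%:~R = (b 1%N)%:~R :> 'F_p.
  case: k => // k _; elim: k => // k [IHu IHb]; split.
    by rewrite -IHu; apply: red_le1 (cu k.+1).
  by rewrite -IHb; apply: red_le1 (cb k.+1).
have tG : G^T = G by rewrite tr_scalar_mx.
have tB k : (B k)^T = B k by rewrite tr_scalar_mx.
have cB k : eqM (p ^ k)%N (B k.+1) (B k).
  apply/eqM_entry => i j; rewrite !ord1 !mxE !mulr1n; exact: (red_opp (cu k)).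
have z0n : z0 != 0.
  apply: contraNneq nu => z00; move: hz; rewrite z00 expr0n mulr0 add0r => /eqP.
  by rewrite intr_Fp_eq0.
have [_ bE] := bu r.+1 (ltn0Sn r).
have s0 : eqM (p ^ 1)%N (Z^T *m G *m Z) (B 1%N).
  rewrite expn1 eqM_phi // !map_mxM -map_trmx ZE !map_scalar_mx /= tr_scalar_mx.
  rewrite -!scalar_mxM bE rmorphN /=; apply/eqP; congr _%:M.
  by apply/eqP; rewrite -subr_eq0 opprK -{}hz; apply/eqP; ring.
have f0 : row_free (map_mx (intr : int -> 'F_p) (Z^T *m G)).
  rewrite !map_mxM -map_trmx ZE !map_scalar_mx /= tr_scalar_mx -scalar_mxM.
  rewrite row_free_unit unitmxE det_scalar1 unitfE mulf_neq0 // bE intr_Fp_eq0 //.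
have [Y [cY sY Y0]] := newton_lift p_pr p_odd tG tB cB (ltn0Sn 0) s0 f0.
have YE k : map_mx (intr : int -> 'F_p) (Y k.+1) = z0%:M.
  elim: k => [|k IH]; first by rewrite Y0.
  by rewrite -IH; apply/eqP; rewrite -eqM_phi //; apply: eqM_dvd (cY k.+1); rewrite dvdzE /= expnS dvdn_mulr.
exists (Y r.+1 0 0); split.
  by have /matrixP/(_ 0 0) := YE r; rewrite !mxE mulr1n -intr_Fp_eq0 // => ->.
have /eqM_entry/(_ 0 0) := sY r.+1 (ltn0Sn r).
rewrite {1}[Y r.+1]mx11_scalar tr_scalar_mx -!scalar_mxM !mxE !mulr1n => H.
have /esym := red_opp H; rewrite opprK => ->; congr (red _ _ _); rewrite big_ord1 !mxE mulr1n; ring.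
Qed.

Lemma Sxy_unit r b : ~~ (p%:Z %| b)%Z -> Sxy (fun x => W r (b * x)) r = Sxy (W r) r.
Proof. by move=> nb; apply: eq_bigr => x _; apply: eq_bigr => y _; apply: W_mul_unit. Qed.

Lemma two_unit z : ~~ (p%:Z %| z)%Z -> ~~ (p%:Z %| 2%:R * z)%Z.
Proof. by have := dvd_two p_pr p_odd 1 z; rewrite expn1 => ->. Qed.

Lemma Jseq0_split u b (z0 : 'F_p) : coh p u -> coh p b -> ~~ (p%:Z %| u 1%N)%Z -> ~~ (p%:Z %| b 1%N)%Z ->
  (b 1%N)%:~R * z0 ^+ 2 + (u 1%N)%:~R = 0 ->
  cvg (Jseq 0 u b) (((1 - q^-1) / (1 - X)) ^+ 2).
Proof.
move=> cu cb nu nb hz; apply: (cvg_shift (m := 1)).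
apply: cvg_eq (cvg_unshift 1 Sxy_cvg) => r; rewrite addn1 /Jseq.
have [z [nz uz]] := sqrt_lift cu cb nu nb hz r.
have [h hh] := inv_mod p_pr r.+1 (two_unit nz).
rewrite expn0 mul1r (S2_split p_pr (z := z) (h := h)) ?Sxy_unit //; first exact: coh_unit.
exact: W_mod.
Qed.

(** The integral of [|p^n u a^2 + b c^2|^e] for units [u], [b], where [sp] tells whether [-u/b] is a
    square modulo [p]. [Ev] below is the volume of the locus where this form is a unit. *)
Fixpoint Iv (sp : bool) (n : nat) {struct n} :=
  match n with
  | 0 => if sp then ((1 - q^-1) / (1 - X)) ^+ 2 else (1 - (q ^+ 2)^-1) / (1 - X ^+ 2)
  | 1 => (1 - q^-1) / (1 - X)
  | n'.+2 => (1 - q^-1) + X * w * Iv sp n'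
  end.

Definition Ev (sp : bool) (n : nat) :=
  if n is 0 then (if sp then (1 - q^-1) ^+ 2 else 1 - (q ^+ 2)^-1) else 1 - q^-1.

Definition splits (u b : nat -> int) : bool :=
  [exists z : 'F_p, (b 1%N)%:~R * z ^+ 2 + (u 1%N)%:~R == 0].

Lemma J_cvg n u b : coh p u -> coh p b -> ~~ (p%:Z %| u 1%N)%Z -> ~~ (p%:Z %| b 1%N)%Z ->
  cvg (Jseq n u b) (Iv (splits u b) n).
Proof.
move=> cu cb nu nb; elim/ltn_ind: n => -[|[|n]] IH.
- rewrite /Iv; case: (boolP (splits u b)) => [/existsP[z /eqP hz]|/existsPn an].
    exact: Jseq0_split hz.
  exact: Jseq0_aniso.
- exact: Jseq1_cvg.
apply: (cvg_shift (m := 2)).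
apply: (@cvg_eq (fun r => (1 - q^-1) + X * w * Jseq n u b r)).
  by move=> r; rewrite addn2 Jseq_step.
apply: cvg_add; first exact: cvg_const.
by apply: cvg_mulc; apply: IH; apply: leqW.
Qed.

Definition nd (x : int) := ind (~~ (p%:Z %| x)%Z).

Lemma nd_mod x y : red p 1 x = red p 1 y -> nd x = nd y.
Proof.
move=> /eqP; rewrite red1_Fp // => xy; rewrite /nd -!(intr_Fp_eq0 _ p_pr).
by rewrite (eqP xy).
Qed.

Lemma nd_unit x : ~~ (p%:Z %| x)%Z -> nd x = 1.
Proof. by rewrite /nd => ->. Qed.

Lemma nd_p x : nd (p%:Z * x) = 0.
Proof. by rewrite /nd dvdz_mulr. Qed.

Lemma sum_nd1 (f : nat -> R) c : (forall z, ~~ (p %| z)%N -> f z = c) ->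
  \sum_(x < p ^ 1) f x = (q - 1) * c + f 0%N.
Proof.
move=> fc; rewrite (sum_split_unit p_pr 0 fc) expr0 mulr1; congr (_ + _).
by rewrite expn0 big_ord1 muln0.
Qed.

Lemma C_ram al be : ~~ (p%:Z %| be)%Z -> S2 nd 1 (p%:Z * al) be = q * (q - 1).
Proof.
move=> nb; rewrite /(S2 _ _ _ _) (eq_bigr (fun _ => q - 1)) => [|a _].
  by rewrite sumr_const card_ord expn1 -[LHS]mulr_natl.
rewrite (@sum_nd1 (fun c => nd (p%:Z * al * (a : nat)%:Z ^+ 2 + be * c%:Z ^+ 2)) 1) => [|z nz].
  by rewrite expr0n /= mulr0 addr0 -mulrA nd_p mulr1 addr0.
apply: nd_unit; rewrite rpredDl; last by rewrite -mulrA dvdz_mulr.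
by rewrite dvdz_mulu // nd_sq.
Qed.

Lemma C_aniso al be : (forall a c : int, (p%:Z %| al * a ^+ 2 + be * c ^+ 2)%Z ->
    (p%:Z %| a)%Z && (p%:Z %| c)%Z) -> S2 nd 1 al be = q ^+ 2 - 1.
Proof.
move=> an; rewrite /(S2 _ _ _ _).
rewrite (@sum_nd1 (fun a => \sum_(c < p ^ 1) nd (al * a%:Z ^+ 2 + be * (c : nat)%:Z ^+ 2)) q) => [|z nz].
  rewrite (@sum_nd1 (fun c => nd (al * 0%:Z ^+ 2 + be * c%:Z ^+ 2)) 1) => [|z nz].
    by rewrite !expr0n /= !mulr0 addr0 /nd dvdz0 /ind /= mulr1 addr0; ring.
  by apply: nd_unit; apply: contra nz => /an /andP[].
rewrite (eq_bigr (fun _ => 1)) ?sumr_const ?card_ord ?expn1 //= => c _.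
by apply: nd_unit; apply: contra nz => /an /andP[].
Qed.

Lemma C_xy b : ~~ (p%:Z %| b)%Z -> Sxy (fun x => nd (b * x)) 1 = (q - 1) ^+ 2.
Proof.
move=> nb; rewrite /(Sxy _ _).
rewrite (@sum_nd1 (fun x => \sum_(y < p ^ 1) nd (b * (x%:Z * (y : nat)%:Z))) (q - 1)) => [|z nz].
  rewrite big1 ?addr0 ?expr2 // => y _.
  by rewrite mul0r mulr0 /nd dvdz0.
rewrite (@sum_nd1 (fun y => nd (b * (z%:Z * y%:Z))) 1) => [|y ny].
  by rewrite !mulr0 /nd dvdz0 /ind mulr1 addr0.
by apply: nd_unit; rewrite !dvdz_mulu.
Qed.

Lemma E_val n u b : coh p u -> coh p b -> ~~ (p%:Z %| u 1%N)%Z -> ~~ (p%:Z %| b 1%N)%Z ->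
  S2 nd 1 ((p ^ n)%N%:Z * u 1%N) (b 1%N) / q ^+ 2 = Ev (splits u b) n.
Proof.
move=> cu cb nu nb; case: n => [|n]; last first.
  by rewrite expnS PoszM -mulrA C_ram // /Ev; field.
rewrite expn0 mul1r /Ev; case: (boolP (splits u b)) => [/existsP[z0 /eqP hz]|/existsPn an].
  have [z [nz uz]] := sqrt_lift cu cb nu nb hz 0.
  have [h hh] := inv_mod p_pr 1 (two_unit nz).
  rewrite (S2_split p_pr (z := z) (h := h)) ?C_xy //; [by field | exact: nd_mod].
rewrite C_aniso; first by field.
move=> x y; rewrite -!(intr_Fp_eq0 _ p_pr) !rmorphD !rmorphM /= -?expr2.
have [x0|x0] := eqVneq (x%:~R : 'F_p) 0.
  rewrite x0 expr0n /= mulr0 add0r mulf_eq0 [(b 1%N)%:~R == 0]intr_Fp_eq0 // (negbTE nb) /=.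
  by rewrite sqrf_eq0.
move=> /eqP h; have := an (y%:~R / x%:~R); rewrite expr_div_n => /negP[].
have x2 : (x%:~R : 'F_p) ^+ 2 != 0 by rewrite sqrf_eq0.
rewrite -(mulIr_eq0 _ (mulIf x2)) mulrDl -mulrA divfK //.
by rewrite addrC h.
Qed.

End ZetaLimits.

(** * The identity between rational functions *)

Section OrbitSumIdentity.

Variable p : nat.
Hypothesis p_pr : prime p.
Variable e : nat.
Let q : R := p%:R.
Let w := (q^-1) ^+ e.
Let X := w / q.

Let q0 : q != 0. Proof. by rewrite pnatr_eq0 -lt0n prime_gt0. Qed.
Let q1 : q - 1 != 0.
Proof. by rewrite subr_eq0 gt_eqF // ltr1n prime_gt1. Qed.
Let q2 : q + 1 != 0.
Proof. by rewrite /q natr1 pnatr_eq0. Qed.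

Let q3 : q ^+ 2 - 1 != 0.
Proof. by rewrite -[X in _ - X](expr1n _ 2) subr_sqr mulf_neq0. Qed.

Definition Zn sp n := Iv p e sp n / Ev p sp n.

Let X1 : 1 - X != 0. Proof. exact: X_neq1. Qed.
Let X2 : 1 + X != 0. Proof. rewrite gt_eqF // ltr_pwDl ?ltr01 //; exact: X_ge0. Qed.
Let wE : w = q * X. Proof. by rewrite /X mulrC divfK. Qed.

Definition kap (sp : bool) := (if sp then 2%:R else 0) : R.

Lemma dvalSS sp v : dval p e (kap sp) v.+2 = 1 - X ^+ 2 + q * X ^+ 2 * dval p e (kap sp) v.
Proof.
have -> : X = (q ^+ e.+1)^-1 by rewrite /X /w exprSr exprVn invfM.
by [].
Qed.

Lemma dvalXE (k : R) : dval p e k 0 = 1 - X + X * k /\ dval p e k 1 = 1 - X ^+ 2.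
Proof.
have -> : X = (q ^+ e.+1)^-1 by rewrite /X /w exprSr exprVn invfM.
by [].
Qed.

(** The lower index is at least 1, where the normalising volume is always [1 - 1/q]; at index 0 it
    is different. *)
Lemma ZnS sp n : Zn sp n.+3 = 1 + X * w * Zn sp n.+1.
Proof. by rewrite /Zn /= -/q -/w -/X; field; rewrite q0 q1. Qed.

Definition Fsum sp v := \sum_(k < (v./2).+1) X ^+ k * (1 - X) * Zn sp (v - 2 * k)%N.

Lemma FsumSS sp v : Fsum sp v.+2 = (1 - X) * Zn sp v.+2 + X * Fsum sp v.
Proof.
rewrite /Fsum /= big_ord_recl /= expr0 mul1r muln0 subn0; congr (_ + _).
rewrite mulr_sumr; apply: eq_bigr => i _; rewrite /bump /= add1n exprS !mulrA mulnS.
by rewrite subnDA subn2.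
Qed.

Lemma sum_zeta sp v : Fsum sp v = dval p e (kap sp) v / (1 - X ^+ 2).
Proof.
have XX : 1 - X ^+ 2 = (1 - X) * (1 + X) by ring.
have [d0 _] := dvalXE (kap sp); have [_ d1] := dvalXE (kap sp).
have F0 : Fsum sp 0 = (1 - X) * Zn sp 0 by rewrite /Fsum big_ord1 expr0 mul1r.
have F1 : Fsum sp 1 = (1 - X) * Zn sp 1 by rewrite /Fsum big_ord1 expr0 mul1r.
have f0 : Fsum sp 0 = dval p e (kap sp) 0 / (1 - X ^+ 2).
  rewrite F0 d0 XX /Zn /= -/q -/w -/X /kap; case: sp {d0 d1 F0 F1}; rewrite ?XX;
  by field; rewrite ?X1 ?X2 ?q0 ?q1 ?q2 ?q3.
have f1 : Fsum sp 1 = dval p e (kap sp) 1 / (1 - X ^+ 2).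
  rewrite F1 d1 XX /Zn /= -/q -/w -/X.
  by field; rewrite ?X1 ?X2 ?q0 ?q1 ?q2 ?q3.
(* As [ZnS] stops at index 1, four base cases are computed directly. Afterwards [Zn] is eliminated
   by expressing [(1 - X) Zn sp v.+2] through two earlier orbit sums. *)
elim/ltn_ind: v => -[|[|[|[|v]]]] IH //.
- rewrite FsumSS f0 dvalSS d0 XX /Zn /= -/q -/w -/X /kap; case: sp {d0 d1 F0 F1 f0 f1 IH}; rewrite ?XX wE;
  by field; rewrite ?X1 ?X2 ?q0 ?q1 ?q2 ?q3.
- rewrite FsumSS f1 dvalSS d1 XX /Zn /= -/q -/w -/X wE.
  by field; rewrite ?X1 ?X2 ?q0 ?q1 ?q2 ?q3.
rewrite FsumSS ZnS.
have h2 := IH v.+2 (ltnW (ltnSn v.+3)); have h0 := IH v (leq_trans (leqW (leqnSn v.+1)) (leqnSn _)).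
have Zv : (1 - X) * Zn sp v.+2 = Fsum sp v.+2 - X * Fsum sp v by rewrite FsumSS addrK.
rewrite mulrDr mulrCA Zv h2 h0 !dvalSS wE; move: (dval _ _ _ _) => D.
rewrite XX; field.
by rewrite X1 X2.
Qed.

End OrbitSumIdentity.

(** * Orbits of vectors of a given determinant *)

Section Orbits.

Variable p : nat.
Hypothesis p_pr : prime p.
Hypothesis p_odd : p <> 2%N.

Notation mat g n := (mxk 3 3 g n).
Notation vec S n := (vk 3 S n).
Let G : 'M[int]_3 := GLH 3.

Definition qQ (v : 'cV[int]_3) : int := v 0 0 * v 1 0 - v 2%:R 0 * v 2%:R 0.

Lemma bG (v u : 'cV[int]_3) :
  (v^T *m G *m u) 0 0 = v 0 0 * u 1 0 + v 1 0 * u 0 0 - 2%:R * (v 2%:R 0 * u 2%:R 0).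
Proof.
have ordE : (lift 0 0 = 1 :> 'I_3) * (lift 0 (lift 0 0) = 2%:R :> 'I_3).
  by split; apply: val_inj.
rewrite mxE !big_ord_recl big_ord0 !mxE !big_ord_recl !big_ord0 !mxE /gLH /cLH /=.
rewrite !ordE; ring.
Qed.

Lemma qfE (v : 'cV[int]_3) : qf (coefLH_int 0) v = qQ v.
Proof.
apply: (mulfI (_ : 2%:R != 0 :> int)) => //; rewrite -bf_diag /bf.
have -> : gramI (coefLH_int 0) 3 = G := gramI_LH 0.
rewrite bG /qQ; ring.
Qed.

Lemma QLE S n : QL p S n = red p n (qQ (vec S n)).
Proof. by rewrite /QL /coefLH qevalE // qfE. Qed.

Lemma BLE S T n : BL p S T n = red p n (((vec S n)^T *m G *m vec T n) 0 0).
Proof.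
rewrite /BL /coefLH bevalE // /bf.
by have -> : gramI (coefLH_int 0) 3 = G := gramI_LH 0.
Qed.

Lemma matvecE g S (i : 'I_3) n : matvec p 3 g S i n = red p n ((mat g n *m vec S n) i 0).
Proof.
rewrite /matvec mxE; congr (red p n _); apply: eq_bigr => j _.
by rewrite !mxE.
Qed.

Definition acts g S S' := forall n, eqM (p ^ n)%N (mat g n *m vec S n) (vec S' n).

Lemma SOequivE S S' : inL p S' -> SOequiv p S S' <-> exists g, SOset p 0 g /\ acts g S S'.
Proof.
move=> zS'; split=> -[g [sg H]]; exists g; split=> //.
  move=> n; apply/eqM_entry => i j; rewrite !ord1 [RHS in (_ = RHS %[mod _])%Z]mxE.
  by have := H i (ltn_ord i) n; rewrite matvecE => <-; apply/esym/red_id.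
move=> i i3 n; rewrite -[i]/(val (Ordinal i3)) matvecE.
have /eqM_entry/(_ (Ordinal i3) 0) := H n; rewrite [vec S' n _ _]mxE /= => e.
by rewrite -[RHS](zp_red _ (zS' _ i3)); exact: e.
Qed.

Lemma SO_intro (X : nat -> 'M[int]_3) : (forall n, eqM (p ^ n)%N (X n.+1) (X n)) ->
  (forall n, eqM (p ^ n)%N ((X n)^T *m G *m X n) G) -> (forall n, red p n (\det (X n)) = red p n 1) ->
  SOset p 0 (toP p X).
Proof.
move=> cX iX dX; apply/SOsetP => //; split; first exact: zmat_toP.
  by move=> n; rewrite (isoK_eqM (t := 0) (mxk_toP p X n)); apply: iX.
move=> n; rewrite -dX; apply: eqM_det; exact: mxk_toP.
Qed.

Lemma SO_elim g : SOset p 0 g -> [/\ zmat p 3 3 g, forall n, eqM (p ^ n)%N ((mat g n)^T *m G *m mat g n) G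
  & forall n, red p n (\det (mat g n)) = red p n 1].
Proof. by move/SOsetP => []. Qed.

Lemma SO_mul g h : SOset p 0 g -> SOset p 0 h ->
  exists2 k, SOset p 0 k & forall n, eqM (p ^ n)%N (mat k n) (mat g n *m mat h n).
Proof.
move=> /SO_elim[zg ig dg] /SO_elim[zh ih dh].
exists (toP p (fun n => mat g n *m mat h n)); last by move=> n; apply: mxk_toP.
apply: SO_intro => n.
- by apply: eqM_mul; apply: zmat_coh.
- rewrite trmx_mul -!mulmxA (mulmxA _ G) (mulmxA (_ *m G)).
  apply: (eqM_trans (B := (mat h n)^T *m (G *m mat h n))); last by rewrite mulmxA; apply: ih.
  rewrite !mulmxA -(mulmxA _ _ G) -(mulmxA _ (_ *m G)); apply: (eqM_mul _ (eqM_refl _ _)).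
  apply: (eqM_mul (eqM_refl _ _)); exact: ig.
- rewrite det_mulmx -[1]mulr1; exact: red_mul.
Qed.

Lemma SO_inv g : SOset p 0 g -> exists2 k, SOset p 0 k &
  forall n, eqM (p ^ n)%N (mat k n *m mat g n) 1%:M.
Proof.
move=> /SO_elim[zg ig dg]; exists (toP p (fun n => \adj (mat g n))).
  have dadj n : red p n (\det (\adj (mat g n))) = red p n 1.
    have := congr1 determinant (mul_adj_mx (mat g n)); rewrite det_mulmx det_scalar.
    move/(congr1 (red p n)) => H; rewrite -[\det (\adj _)]mulr1.
    have e1 : red p n (\det (\adj (mat g n)) * 1) = red p n (\det (\adj (mat g n)) * \det (mat g n)).
      by apply: red_mul.
    rewrite e1 H (_ : (1 : int) = 1 * (1 * 1)) // !exprS expr0 mulr1.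
    by apply: (red_mul (dg n)); apply: red_mul.
  apply: SO_intro => // n; first by apply: eqM_adj; apply: zmat_coh.
  have gg : eqM (p ^ n)%N (mat g n *m \adj (mat g n)) 1%:M.
    rewrite mul_mx_adj; apply/eqM_entry => i j; rewrite !mxE; case: (i == j) => //; exact: dg.
  apply: (eqM_trans (B := (\adj (mat g n))^T *m ((mat g n)^T *m G *m mat g n) *m \adj (mat g n))).
    apply: (eqM_mul _ (eqM_refl _ _)); apply: (eqM_mul (eqM_refl _ _)); rewrite eqM_sym; exact: ig.
  rewrite !mulmxA -trmx_mul -(mulmxA _ (mat g n)).
  rewrite -[X in eqM _ _ X]mulmx1 -[X in eqM _ _ (X *m _)]mul1mx -[X in eqM _ _ (X *m _ *m _)]trmx1.
  exact: (eqM_mul (eqM_mul (eqM_tr gg) (eqM_refl _ _)) gg).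
move=> n; apply: (eqM_trans (B := \adj (mat g n) *m mat g n)).
  by apply: (eqM_mul _ (eqM_refl _ _)); apply: mxk_toP.
rewrite mul_adj_mx; apply/eqM_entry => i j; rewrite !mxE; case: (i == j) => //; exact: dg.
Qed.

Definition equivSO S S' := exists g, SOset p 0 g /\ acts g S S'.

Lemma equivSO_sym S S' : equivSO S S' -> equivSO S' S.
Proof.
move=> [g [sg H]]; have [k sk kg] := SO_inv sg; exists k; split=> // n.
apply: (eqM_trans (B := mat k n *m (mat g n *m vec S n))).
  by apply: (eqM_mul (eqM_refl _ _)); rewrite eqM_sym; apply: H.
rewrite mulmxA -[X in eqM _ _ X]mul1mx; exact: (eqM_mul (kg n) (eqM_refl _ _)).
Qed.

Lemma equivSO_trans S S' S'' : equivSO S S' -> equivSO S' S'' -> equivSO S S''.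
Proof.
move=> [g [sg H]] [h [sh H']]; have [k sk kg] := SO_mul sh sg; exists k; split=> // n.
apply: (eqM_trans (B := mat h n *m mat g n *m vec S n)).
  exact: (eqM_mul (kg n) (eqM_refl _ _)).
rewrite -mulmxA; apply: eqM_trans (H' n).
exact: (eqM_mul (eqM_refl _ _) (H n)).
Qed.

End Orbits.

Section Representatives.

Variable p : nat.
Hypothesis p_pr : prime p.
Hypothesis p_odd : p <> 2%N.

Notation mat g n := (mxk 3 3 g n).
Notation vec S n := (vk 3 S n).
Let G : 'M[int]_3 := GLH 3.

Definition mx3 (a b c d e f g h i : int) : 'M[int]_3 := \matrix_(x, y)
  nth 0 (nth [::] [:: [:: a; b; c]; [:: d; e; f]; [:: g; h; i]] x) y.
Definition cv3 (a b c : int) : 'cV[int]_3 := \col_x nth 0 [:: a; b; c] x.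

Lemma cv3E (v : 'cV[int]_3) : v = cv3 (v 0 0) (v 1 0) (v 2%:R 0).
Proof.
apply/matrixP=> i j; rewrite !ord1 mxE.
by case: i => [[|[|[|//]]] l] /=; congr (v _ _); apply: val_inj.
Qed.

Lemma mx3_cv3 a b c d e f g h i x y z :
  mx3 a b c d e f g h i *m cv3 x y z = cv3 (a * x + b * y + c * z) (d * x + e * y + f * z) (g * x + h * y + i * z).
Proof.
apply/matrixP=> r s; rewrite !mxE !big_ord_recl big_ord0 !mxE /=.
by case: r => [[|[|[|//]]] l] /=; ring.
Qed.

Lemma det_mx3 a b c d e f g h i :
  \det (mx3 a b c d e f g h i) = a * (e * i - f * h) - b * (d * i - f * g) + c * (d * h - e * g).
Proof.
rewrite (expand_det_row _ 0) !big_ord_recl big_ord0 /cofactor !(expand_det_row _ 0).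
rewrite !big_ord_recl !big_ord0 /cofactor !det_mx11 !mxE /=.
rewrite /bump /= !expr0 ?addn0 ?add0n ?expr1 ?mulr1; ring.
Qed.

Definition mcong (m m' : int) n := red p n m = red p n m'.

Lemma eqM_mx3 n a b c d e f g h i a' b' c' d' e' f' g' h' i' :
  mcong a a' n -> mcong b b' n -> mcong c c' n -> mcong d d' n -> mcong e e' n -> mcong f f' n ->
  mcong g g' n -> mcong h h' n -> mcong i i' n ->
  eqM (p ^ n)%N (mx3 a b c d e f g h i) (mx3 a' b' c' d' e' f' g' h' i').
Proof.
move=> *; apply/eqM_entry => x y; rewrite !mxE.
by case: x => [[|[|[|//]]] l] /=; case: y => [[|[|[|//]]] l'] /=.
Qed.

Lemma eqM_cv3 n a b c a' b' c' : mcong a a' n -> mcong b b' n -> mcong c c' n ->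
  eqM (p ^ n)%N (cv3 a b c) (cv3 a' b' c').
Proof.
move=> *; apply/eqM_entry => x y; rewrite !mxE.
by case: x => [[|[|[|//]]] l] /=.
Qed.

Lemma tr_mx3_G a b c d e f g h i :
  (mx3 a b c d e f g h i)^T *m G *m mx3 a b c d e f g h i =
  mx3 (2%:R * (a * d - g * g)) (a * e + d * b - 2%:R * (g * h)) (a * f + d * c - 2%:R * (g * i))
      (a * e + d * b - 2%:R * (g * h)) (2%:R * (b * e - h * h)) (b * f + e * c - 2%:R * (h * i))
      (a * f + d * c - 2%:R * (g * i)) (b * f + e * c - 2%:R * (h * i)) (2%:R * (c * f - i * i)).
Proof.
apply/matrixP=> x y; rewrite !mxE !big_ord_recl !big_ord0 !mxE.
rewrite !big_ord_recl !big_ord0 !mxE /gLH /cLH /=.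
by case: x => [[|[|[|//]]] l] /=; case: y => [[|[|[|//]]] l'] /=; ring.
Qed.

Lemma G_mx3 : G = mx3 0 1 0 1 0 0 0 0 (- 2%:R).
Proof.
apply/matrixP=> x y; rewrite !mxE /gLH /cLH.
by case: x => [[|[|[|//]]] l]; case: y => [[|[|[|//]]] l'].
Qed.

(** The action [A] to [g A g^T] of [g = [[0, 1], [-1, 0]]]; in the next lemma, that of [g = [[1, 1],
    [0, 1]]]. *)
Lemma SO_swap : SOset p 0 (toP p (fun _ => mx3 0 1 0 1 0 0 0 0 (-1))).
Proof.
apply: SO_intro => // n; first exact: eqM_refl.
  by rewrite tr_mx3_G -/G G_mx3; apply: eqM_refl.
by rewrite det_mx3.
Qed.

Lemma SO_shear : SOset p 0 (toP p (fun _ => mx3 1 1 2%:R 0 1 0 0 1 1)).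
Proof.
apply: SO_intro => // n; first exact: eqM_refl.
  by rewrite tr_mx3_G -/G G_mx3; apply: eqM_refl.
by rewrite det_mx3.
Qed.

(* The action of the matrix [[a, 0], [c, 1]] on symmetric matrices, divided by its determinant. *)
Lemma SO_lower (a c u : nat -> int) : coh p a -> coh p c -> coh p u ->
  (forall n, red p n (a n * u n) = red p n 1) ->
  SOset p 0 (toP p (fun n => mx3 (a n) 0 0 (c n * c n * u n) (u n) (2%:R * (c n * u n)) (c n) 0 1)).
Proof.
move=> ca cc cu au; apply: SO_intro => // n.
- apply: eqM_mx3 => //.
  + by apply: red_mul => //; apply: red_mul.
  + by apply: red_mul => //; apply: red_mul.
- rewrite tr_mx3_G -/G G_mx3.
  have r1 x : mcong (a n * u n * x) x n by rewrite /mcong -[x in RHS]mul1r; apply: red_mul.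
  have r0 x : mcong (a n * u n * x - x) 0 n.
    by rewrite /mcong -(subrr x); apply: red_add => //; apply: r1.
  apply: eqM_mx3 => //.
  + rewrite (_ : _ * _ = a n * u n * (2%:R * (c n * c n)) - 2%:R * (c n * c n)) //; ring.
  + rewrite (_ : _ - _ = a n * u n * 1); [exact: r1 | ring].
  + rewrite (_ : _ - _ = a n * u n * (2%:R * c n) - 2%:R * c n); [exact: r0 | ring].
  + rewrite (_ : _ - _ = a n * u n * 1); [exact: r1 | ring].
  + by rewrite (_ : _ * _ = 0) //; ring.
  + by rewrite (_ : _ - _ = 0) //; ring.
  + rewrite (_ : _ - _ = a n * u n * (2%:R * c n) - 2%:R * c n); [exact: r0 | ring].
  + by rewrite (_ : _ - _ = 0) //; ring.
  + by rewrite (_ : _ * _ = - 2%:R) //; ring.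
- by rewrite det_mx3 -au; congr red; ring.
Qed.

Variable x : padic.
Hypothesis zx : is_zp p x.
Variable v : nat.
Hypothesis xv : x v = 0.
Hypothesis xv1 : x v.+1 != 0.

Definition qk k : padic := shift p (2 * k) x.

(* The matrix [diag (p^k, x / p^k)]. *)
Definition repT k : nat -> padic := fun i n =>
  if i == 0%N then red p n (p ^ k)%N%:Z else if i == 1%N then red p n ((p ^ k)%N%:Z * qk k n) else 0.

Lemma qk_zp k : (2 * k <= v)%N -> is_zp p (qk k).
Proof. by move=> kv; apply: is_zp_shift => //; apply: zp_val0 kv. Qed.

Lemma repT_vec k n : eqM (p ^ n)%N (vec (repT k) n) ((p ^ k)%N%:Z *: cv3 1 (qk k n) 0).
Proof.
apply/eqM_entry => i j; rewrite !ord1 !mxE /repT.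
by case: i => [[|[|[|//]]] l] /=; rewrite ?mulr1 ?mulr0 //; apply: red_id.
Qed.

Lemma repT_inL k : (2 * k <= v)%N -> inL p (repT k).
Proof.
move=> kv [|[|[|//]]] _ n; rewrite /repT /=.
- by rewrite red_le.
- rewrite red_le //; apply: red_mul => //; exact/esym/(zp_coh (qk_zp kv)).
- by rewrite /red mod0z.
Qed.

Lemma qQ_eqM n (a b : 'cV[int]_3) : eqM (p ^ n)%N a b -> red p n (qQ a) = red p n (qQ b).
Proof. by rewrite -!qfE; apply: qf_mod. Qed.

Lemma qQ_scale c (a : 'cV[int]_3) : qQ (c *: a) = c * c * qQ a.
Proof. by rewrite /qQ !mxE; ring. Qed.

Lemma qQ_cv3 a b c : qQ (cv3 a b c) = a * b - c * c.
Proof. by rewrite /qQ !mxE. Qed.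

Lemma repT_QL k : (2 * k <= v)%N -> zeq (QL p (repT k)) x.
Proof.
move=> kv n; rewrite QLE // (qQ_eqM (repT_vec k n)) qQ_scale qQ_cv3 mul1r mulr0 subr0.
rewrite -PoszM -expnD addnn -mul2n; apply: shift_red => //; exact: zp_val0 kv.
Qed.

(** If the entry [a] of [S] is a unit, the matrix of [SO_lower] sends [diag(1, d)], with
    [d = det S], to [S], because [b = (c^2 + d)/a]. A swap handles a unit [b]. If [p] divides both,
    then [c] is a unit and the shear produces the unit [a + b + 2c]. *)
Lemma primitive_orbit S k : inL p S -> (2 * k <= v)%N ->
  (forall n, red p n (qQ (vec S n)) = red p n (qk k n)) ->
  ~~ ((p%:Z %| S 0%N 1%N)%Z && (p%:Z %| S 1%N 1%N)%Z && (p%:Z %| S 2%N 1%N)%Z) ->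
  exists g, SOset p 0 g /\ forall n, eqM (p ^ n)%N (mat g n *m cv3 1 (qk k n) 0) (vec S n).
Proof.
move=> zS kv QS nS.
pose A n := S 0%N n; pose B n := S 1%N n; pose C n := S 2%N n.
have cA : coh p A by apply/zp_coh/zS. have cB : coh p B by apply/zp_coh/zS.
have cC : coh p C by apply/zp_coh/zS.
have vS n : vec S n = cv3 (A n) (B n) (C n).
  by rewrite [LHS]cv3E !mxE.
have QE n : red p n (A n * B n - C n * C n) = red p n (qk k n) by rewrite -QS vS qQ_cv3.
have key (a b c : nat -> int) (X : 'M[int]_3) : coh p a -> coh p c -> ~~ (p%:Z %| a 1%N)%Z ->
    (forall n, red p n (a n * b n - c n * c n) = red p n (qk k n)) ->
    SOset p 0 (toP p (fun _ => X)) -> (forall n, X *m vec S n = cv3 (a n) (b n) (c n)) ->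
  exists g, SOset p 0 g /\ forall n, eqM (p ^ n)%N (mat g n *m cv3 1 (qk k n) 0) (vec S n).
  move=> ca cc na Qn sX XS.
  have [u cu au] := inv_coh p_pr ca na.
  have sl := SO_lower ca cc cu au; set h := toP p _ in sl.
  have [Y sY YX] := SO_inv p_pr p_odd sX; have [g sg gE] := SO_mul p_pr p_odd sY sl.
  exists g; split=> // n.
  have h1 : eqM (p ^ n)%N (mat h n *m cv3 1 (qk k n) 0) (cv3 (a n) (b n) (c n)).
    apply: (eqM_trans (eqM_mul (mxk_toP _ _ _) (eqM_refl _ _))); rewrite mx3_cv3; apply: eqM_cv3.
    - by rewrite /mcong; congr red; ring.
    - rewrite /mcong; apply: (@etrans _ _ (red p n (c n * c n * u n + u n * (a n * b n - c n * c n)))).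
        rewrite mulr1 mulr0 addr0; apply: red_add => //; apply: red_mul => //; exact/esym.
      rewrite (_ : _ + _ = a n * u n * b n); last by ring.
      by rewrite -[b n in RHS]mul1r; apply: red_mul.
    - by rewrite /mcong; congr red; ring.
  apply: (eqM_trans (eqM_mul (gE n) (eqM_refl _ _))); rewrite -mulmxA.
  apply: (eqM_trans (eqM_mul (eqM_refl _ _) h1)); rewrite -XS mulmxA -[X in eqM _ _ X]mul1mx.
  apply: (eqM_mul _ (eqM_refl _ _)); apply: eqM_trans (YX n).
  apply: (eqM_mul (eqM_refl _ _)); rewrite eqM_sym; exact: mxk_toP.
have [nA|nA] := boolP (p%:Z %| A 1%N)%Z; last first.
  apply: (key A B C 1%:M) => //; last by move=> n; rewrite mul1mx.
  apply: SO_intro => // n; first exact: eqM_refl.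
    by rewrite trmx1 mul1mx mulmx1; apply: eqM_refl.
  by rewrite det1.
have [nB|nB] := boolP (p%:Z %| B 1%N)%Z; last first.
  apply: (key B A (fun n => - C n) _ _ _ _ _ SO_swap) => //.
  - exact: coh_opp.
  - by move=> n; rewrite mulrNN mulrC; apply: QE.
  - by move=> n; rewrite vS mx3_cv3; congr cv3; ring.
have nC : ~~ (p%:Z %| C 1%N)%Z by apply: contra nS => nC; rewrite -!andbA; apply/and3P.
apply: (key (fun n => A n + B n + 2%:R * C n) B (fun n => B n + C n) _ _ _ _ _ SO_shear).
- by apply: coh_add; [apply: coh_add | apply: coh_mul].
- exact: coh_add.
- by rewrite rpredDl ?rpredD //; have := dvd_two p_pr p_odd 1 (C 1%N); rewrite expn1 => ->.
- by move=> n; rewrite -(QE n); congr red; ring.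
- by move=> n; rewrite vS mx3_cv3; congr cv3; ring.
Qed.

Lemma qk_shift k : (2 * k.+1 <= v)%N -> forall n, qk k n.+2 = (p ^ 2)%N%:Z * qk k.+1 n.
Proof.
move=> kv n; have kv' : (2 * k <= v)%N by lia.
have pk0 : (p ^ (2 * k))%N%:Z != 0 by rewrite eqz_nat -lt0n expn_gt0 prime_gt0.
apply: (mulfI pk0); rewrite -shiftE //; last exact: zp_val0 kv'.
have -> : (n.+2 + 2 * k = n + 2 * k.+1)%N by lia.
rewrite (shiftE _ zx (zp_val0 zx xv kv)).
by rewrite mulrA -PoszM -expnD; congr (_%:Z * _); congr (p ^ _)%N; lia.
Qed.

(* Content induction: strip factors p from S until it is primitive. *)
Lemma orbit_exists_aux j k S : (v - 2 * k < j)%N -> inL p S -> (2 * k <= v)%N ->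
  (forall n, red p n (qQ (vec S n)) = red p n (qk k n)) ->
  exists2 l, (2 * l <= v)%N & exists g, SOset p 0 g /\
    forall n, eqM (p ^ n)%N ((p ^ k)%N%:Z *: vec S n) ((p ^ l)%N%:Z *: (mat g n *m cv3 1 (qk l n) 0)).
Proof.
elim: j k S => // j IH k S vj zS kv QS.
have zs i : (i < 3)%N -> is_zp p (S i) by apply: zS.
have [/andP[/andP[d0 d1] d2]|nS] := boolP ((p%:Z %| S 0%N 1%N)%Z && (p%:Z %| S 1%N 1%N)%Z && (p%:Z %| S 2%N 1%N)%Z); last first.
  have [g [sg gE]] := primitive_orbit zS kv QS nS.
  exists k => //; exists g; split=> // n; apply: eqM_scale; rewrite eqM_sym; exact: gE.
have s1 i : (i < 3)%N -> S i 1%N = 0.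
  move=> i3; rewrite -(zp_red 1 (zs _ i3)); apply/dvdz_mod0P; rewrite /pk expn1.
  by case: i i3 => [|[|[|]]].
pose S' i := shift p 1 (S i).
have zS' : inL p S' by move=> i i3; apply: is_zp_shift => //; [apply: zs | apply: s1].
have SS n : vec S n.+1 = p%:Z *: vec S' n.
  apply/matrixP=> i l; rewrite !mxE; have := shiftE n (zs _ (ltn_ord i)) (s1 _ (ltn_ord i)).
  by rewrite addn1 expn1.
have QS2 n : red p n.+1 (p%:Z * p%:Z * qQ (vec S' n)) = red p n.+1 (qk k n.+1).
  by rewrite -qQ_scale -SS QS.
(* If [p] divides [S], then [p^2] divides its determinant, whose valuation is [v - 2k]. *)
have k2 : (2 * k.+1 <= v)%N.
  rewrite leqNgt; apply/negP => vk.
  have zq := qk_zp kv.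
  have q2 : qk k 2%N != 0.
    rewrite /qk shift_eq0 //; last exact: zp_val0 kv.
    by apply: (zp_valn0 zx xv1); lia.
  move/negP: q2; apply; have := QS2 1%N; rewrite (zp_red _ zq) => <-.
  apply/eqP/dvdz_mod0P; rewrite /pk -mulrA.
  by rewrite expnS expn1 PoszM mulrA dvdz_mulr.
have QS' n : red p n (qQ (vec S' n)) = red p n (qk k.+1 n).
  have pp0 : p%:Z * p%:Z != 0 by rewrite mulf_neq0 // eqz_nat -lt0n prime_gt0.
  have e : red p n (qQ (vec S' n.+1)) = red p n (qQ (vec S' n)).
    apply: qQ_eqM; apply/eqM_entry => i l; rewrite !mxE; exact: (zp_coh (zS' _ (ltn_ord i))).
  rewrite -e; have := QS2 n.+1; rewrite qk_shift // => /eqP; rewrite red_dvd.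
  rewrite -[(p ^ 2)%N%:Z]/((p * p)%N%:Z) PoszM -mulrBr !expnS !PoszM mulrA dvdz_mul2l //.
  by rewrite -red_dvd => /eqP.
have h : (v - 2 * k.+1 < j)%N by lia.
have [l lv [g [sg gE]]] := IH k.+1 S' h zS' k2 QS'.
exists l => //; exists g; split=> // n.
apply: eqM_trans (gE n); rewrite expnSr PoszM -scalerA -SS; apply: eqM_scale.
by apply/eqM_entry => i r; rewrite !mxE; apply/esym/(zp_coh (zs _ (ltn_ord i))).
Qed.

Lemma orbit_exists S : inL p S -> zeq (QL p S) x ->
  exists2 l, (2 * l <= v)%N & equivSO p (repT l) S.
Proof.
move=> zS QS; have QS' n : red p n (qQ (vec S n)) = red p n (qk 0 n).
  by rewrite -QLE // QS /qk muln0 /shift addn0 expn0 divz1 zp_red.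
have [l lv [g [sg gE]]] := orbit_exists_aux (ltnSn _) zS (leq0n v : (2 * 0 <= v)%N) QS'.
exists l => //; exists g; split=> // n.
apply: (eqM_trans (eqM_mul (eqM_refl _ _) (repT_vec l n))).
rewrite -scalemxAr eqM_sym; have := gE n; by rewrite expn0 scale1r.
Qed.

(** Divisibility by [p^k] is preserved by integral matrices, and the first entry of [repT l] is
    [p^l]. *)
Lemma repT_le k l : equivSO p (repT k) (repT l) -> (k <= l)%N.
Proof.
move=> [g [sg H]].
have : eqM (p ^ k)%N 0 ((p ^ l)%N%:Z *: cv3 1 (qk l k) 0).
  apply: eqM_trans (repT_vec l k); apply: eqM_trans (H k); rewrite eqM_sym.
  apply: (eqM_trans (eqM_mul (eqM_refl _ _) (repT_vec k k))).
  by rewrite -scalemxAr; apply/eqMP; eexists; rewrite add0r.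
move/eqM_entry/(_ 0 0); rewrite !mxE /= mulr1 mod0z => /esym/dvdz_mod0P.
by rewrite dvdzE /= dvdn_Pexp2l // prime_gt1.
Qed.

Lemma repT_inj k l : equivSO p (repT k) (repT l) -> k = l.
Proof.
move=> kl; apply/eqP; rewrite eqn_leq repT_le //=; apply: repT_le.
exact: equivSO_sym.
Qed.

End Representatives.

(** * Orthogonal complements *)

Section PerpBasis.

Variable p : nat.
Hypothesis p_pr : prime p.
Hypothesis p_odd : p <> 2%N.

Notation mat g n := (mxk 3 3 g n).
Notation vec S n := (vk 3 S n).
Let G : 'M[int]_3 := GLH 3.
Let q : R := p%:R.

Variable x : padic.
Hypothesis zx : is_zp p x.
Variable v : nat.
Hypothesis xv : x v = 0.
Hypothesis xv1 : x v.+1 != 0.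
Variable l : nat.
Hypothesis lv : (2 * l <= v)%N.
Variable S : nat -> padic.
Hypothesis zS : inL p S.
Hypothesis eS : equivSO p (repT p x l) S.

Let ql := qk p x l.
Let zql : is_zp p ql. Proof. exact: qk_zp lv. Qed.

(** [e1] and [e2] span the orthogonal complement of [diag(1, ql)]; their norms are [- ql] and
    [-1]. *)
Definition e1 n : 'cV[int]_3 := cv3 1 (- ql n) 0.
Definition e2 (n : nat) : 'cV[int]_3 := cv3 0 0 1.

Lemma equiv_inverse : exists g h, [/\ SOset p 0 g, SOset p 0 h,
  forall n, eqM (p ^ n)%N (mat g n *m mat h n) 1%:M,
  forall n, eqM (p ^ n)%N (mat h n *m mat g n) 1%:M &
  forall n, eqM (p ^ n)%N ((p ^ l)%N%:Z *: (mat g n *m cv3 1 (ql n) 0)) (vec S n)].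
Proof.
have [g [sg gS]] := eS; have [h sh hg] := SO_inv p_pr p_odd sg; have [k sk kh] := SO_inv p_pr p_odd sh.
exists g, h; split=> // n.
  apply: eqM_trans (kh n); apply: (eqM_mul _ (eqM_refl _ _)).
  apply: (eqM_trans (B := mat k n *m mat h n *m mat g n)); last first.
    rewrite -mulmxA -[X in eqM _ _ X]mulmx1; exact: (eqM_mul (eqM_refl _ _) (hg n)).
  rewrite -[X in eqM _ X _]mul1mx eqM_sym; exact: (eqM_mul (kh n) (eqM_refl _ _)).
apply: eqM_trans (gS n); rewrite scalemxAr; apply: (eqM_mul (eqM_refl _ _)); rewrite eqM_sym.
exact: repT_vec.
Qed.

(** The p-adic integers have no torsion: to cancel [p^m] modulo [p^n], the hypothesis is used at
    level [n + m]. *)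
Lemma red_scale_cancel m (f : nat -> int) : coh p f ->
  (forall n, red p n ((p ^ m)%N%:Z * f n) = 0) -> forall n, red p n (f n) = 0.
Proof.
move=> cf H n.
have e j : red p n (f (n + j)%N) = red p n (f n).
  elim: j => [|j IH]; first by rewrite addn0.
  by rewrite addnS -IH -(red_le _ _ (leq_addr j n)) cf red_le // leq_addr.
rewrite -(e m); have /dvdz_mod0P := H (n + m)%N.
rewrite /pk expnD PoszM mulrC dvdz_mul2r; last by rewrite eqz_nat -lt0n expn_gt0 prime_gt0.
by move/dvdz_mod0P.
Qed.

Lemma inPerpE A : inPerp p S A <-> inL p A /\ forall n, red p n (((vec A n)^T *m G *m vec S n) 0 0) = 0.
Proof. by split=> -[zA H]; split=> // n; [rewrite -BLE // H | rewrite BLE // H]. Qed.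

Definition gen (g : nat -> nat -> padic) (c : nat -> 'cV[int]_3) : nat -> padic :=
  fun i => toP p (fun n => mat g n *m c n) i 0%N.

Lemma gen_vec g c n : eqM (p ^ n)%N (vec (gen g c) n) (mat g n *m c n).
Proof.
apply/eqM_entry => i j; rewrite !ord1 mxE /gen -[0%N]/(val (0 : 'I_1)) toPE; exact: red_id.
Qed.

Lemma gen_inL g c : SOset p 0 g -> (forall n, eqM (p ^ n)%N (c n.+1) (c n)) -> inL p (gen g c).
Proof.
move=> /(SO_elim p_pr p_odd)[zg _ _] cc i i3; apply: (zmat_toP _ i3) => // n.
by apply: eqM_mul => //; apply: zmat_coh.
Qed.

Lemma coh_e1 n : eqM (p ^ n)%N (e1 n.+1) (e1 n).
Proof. by apply: eqM_cv3 => //; apply: red_opp; apply: zp_coh. Qed.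

Lemma iso_bil g n (a b : 'cV[int]_3) : SOset p 0 g ->
  red p n (((mat g n *m a)^T *m G *m (mat g n *m b)) 0 0) = red p n ((a^T *m G *m b) 0 0).
Proof.
move=> /(SO_elim p_pr p_odd)[_ ig _].
have : eqM (p ^ n)%N ((mat g n *m a)^T *m G *m (mat g n *m b)) (a^T *m G *m b).
  have -> : (mat g n *m a)^T *m G *m (mat g n *m b) = a^T *m ((mat g n)^T *m G *m mat g n) *m b.
    by rewrite trmx_mul !mulmxA.
  exact: (eqM_mul (eqM_mul (eqM_refl _ _) (ig n)) (eqM_refl _ _)).
by move/eqM_entry/(_ 0 0).
Qed.

Lemma red_bil n (a a' b b' : 'cV[int]_3) : eqM (p ^ n)%N a a' -> eqM (p ^ n)%N b b' ->
  red p n ((a^T *m G *m b) 0 0) = red p n ((a'^T *m G *m b') 0 0).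
Proof.
move=> aa bb; have := eqM_mul (eqM_mul (eqM_tr aa) (eqM_refl _ G)) bb.
by move/eqM_entry/(_ 0 0).
Qed.

Lemma gen_perp g c : SOset p 0 g -> (forall n, eqM (p ^ n)%N (c n.+1) (c n)) ->
  (forall n, eqM (p ^ n)%N ((p ^ l)%N%:Z *: (mat g n *m cv3 1 (ql n) 0)) (vec S n)) ->
  (forall n, ((c n)^T *m G *m cv3 1 (ql n) 0) 0 0 = 0) -> inPerp p S (gen g c).
Proof.
move=> sg cc gS c0; apply/inPerpE; split; first exact: gen_inL.
move=> n; have := gS n; rewrite eqM_sym => gS'.
rewrite (red_bil (gen_vec g c n) gS') scalemxAr iso_bil //.
by rewrite -scalemxAr mxE c0 mulr0 /red mod0z.
Qed.

Lemma std_basis : exists g h, [/\ SOset p 0 g, forall n, eqM (p ^ n)%N (mat h n *m mat g n) 1%:M &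
  isBasis p S (gen g e1) (gen g e2)].
Proof.
have [g [h [sg sh gh hg gS]]] := equiv_inverse; exists g, h; split=> //.
have [zg _ _] := SO_elim p_pr p_odd sg; have [zh _ _] := SO_elim p_pr p_odd sh.
have linE a c i n : (i < 3)%N -> lin p a (gen g e1) c (gen g e2) i n =
    red p n ((mat g n *m (a n *: e1 n + c n *: e2 n)) (inord i) 0).
  move=> i3; have ii : i = (inord i : 'I_3) by rewrite inordK.
  rewrite /lin mulmxDr -!scalemxAr.
  have -> : gen g e1 i n = red p n ((mat g n *m e1 n) (inord i) 0).
    by rewrite /gen {1}ii -[0%N]/(val (0 : 'I_1)) toPE.
  have -> : gen g e2 i n = red p n ((mat g n *m e2 n) (inord i) 0).
    by rewrite /gen {1}ii -[0%N]/(val (0 : 'I_1)) toPE.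
  set Y := mat g n *m _; set Z := mat g n *m _; rewrite !mxE.
  apply: red_add; apply: red_mul => //; exact: red_id.
split.
- apply: gen_perp => //; first exact: coh_e1.
  by move=> n; rewrite bG !mxE /=; ring.
- apply: gen_perp => //; first by move=> n; apply: eqM_refl.
  by move=> n; rewrite bG !mxE /=; ring.
- move=> A /inPerpE[zA AS].
  have zA' : zmat p 3 1 (fun i _ => A i) by move=> i j i3 _; apply: zA.
  pose A' n := mat h n *m vec A n.
  have cA' n : eqM (p ^ n)%N (A' n.+1) (A' n).
    apply: eqM_mul; first exact: zmat_coh.
    apply/eqM_entry => i j; rewrite !mxE; exact: (zp_coh (zA _ (ltn_ord i))).
  have cA i : coh p (fun n => A' n i 0) by move=> n; move/eqM_entry: (cA' n); apply.
  have gA n : eqM (p ^ n)%N (mat g n *m A' n) (vec A n).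
    by rewrite mulmxA -[X in eqM _ _ X]mul1mx; apply: (eqM_mul (gh n) (eqM_refl _ _)).
  (* Pulled back to the standard position, orthogonality to [p^l diag(1, ql)] determines the second
     coordinate, so the first and third are the coordinates with respect to [e1] and [e2]. *)
  have A1 n : red p n (A' n 1 0) = red p n (- (ql n * A' n 0 0)).
    have cf : coh p (fun n => A' n 0 0 * ql n + A' n 1 0).
      by apply: coh_add => //; apply: coh_mul => //; apply: zp_coh.
    have := red_scale_cancel (m := l) cf.
    have H m : red p m ((p ^ l)%N%:Z * (A' m 0 0 * ql m + A' m 1 0)) = 0.
      rewrite -(AS m); have := gA m; have := gS m; rewrite eqM_sym => gS' gA'.
      rewrite eqM_sym in gA'; rewrite (red_bil gA' gS') scalemxAr iso_bil // -scalemxAr [in RHS]mxE bG.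
      by rewrite !mxE /=; congr red; ring.
    move=> /(_ H n) hz.
    have -> : A' n 1 0 = (A' n 0 0 * ql n + A' n 1 0) + - (ql n * A' n 0 0) by ring.
    rewrite -[- (ql n * _) in RHS]add0r; apply: red_add => //.
    by rewrite hz /red mod0z.
  exists (fun n => red p n (A' n 0 0)), (fun n => red p n (A' n 2%:R 0)).
  split; first by apply: coh_zp.
  split; first by apply: coh_zp.
  move=> i i3 n; rewrite linE //.
  have ii : i = (inord i : 'I_3) by rewrite inordK.
  have : eqM (p ^ n)%N (mat g n *m (red p n (A' n 0 0) *: e1 n + red p n (A' n 2%:R 0) *: e2 n)) (vec A n).
    apply: eqM_trans (gA n); apply: (eqM_mul (eqM_refl _ _)).
    rewrite [A' n in X in eqM _ _ X]cv3E.
    have -> : red p n (A' n 0 0) *: e1 n + red p n (A' n 2%:R 0) *: e2 n =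
      cv3 (red p n (A' n 0 0)) (- (ql n * red p n (A' n 0 0))) (red p n (A' n 2%:R 0)).
      apply/matrixP=> r c; rewrite !mxE; by case: r => [[|[|[|//]]] r3] /=; ring.
    apply: eqM_cv3; [exact: red_id | | exact: red_id].
    by rewrite /mcong A1; apply: red_opp; apply: red_mul => //; apply: red_id.
  move/eqM_entry/(_ (inord i) 0); rewrite [vec A n _ _]mxE -ii => e.
  by rewrite -[LHS](zp_red _ (zA _ i3)); exact/esym.
move=> a c a' c' za zc za' zc' H.
have key n : eqM (p ^ n)%N (a n *: e1 n + c n *: e2 n) (a' n *: e1 n + c' n *: e2 n).
  have gg : eqM (p ^ n)%N (mat g n *m (a n *: e1 n + c n *: e2 n)) (mat g n *m (a' n *: e1 n + c' n *: e2 n)).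
    apply/eqM_entry => i j; rewrite !ord1; have := H i (ltn_ord i) n; rewrite !linE // inord_val.
    exact.
  have := eqM_mul (eqM_refl _ (mat h n)) gg; rewrite !mulmxA => h1.
  have hc (y : 'cV[int]_3) : eqM (p ^ n)%N (mat h n *m mat g n *m y) y.
    rewrite -[X in eqM _ _ X]mul1mx; exact: (eqM_mul (hg n) (eqM_refl _ _)).
  apply: eqM_trans (hc _); apply: eqM_trans h1; rewrite eqM_sym; exact: hc.
split=> n; have /eqM_entry H' := key n.
  have := H' 0 0; rewrite !mxE /= !mulr1 !mulr0 !addr0 => e.
  by rewrite -[LHS](zp_red _ za) -[RHS](zp_red _ za'); exact: e.
have := H' 2%:R 0; rewrite !mxE /= !mulr1 !mulr0 !add0r => e.
by rewrite -[LHS](zp_red _ zc) -[RHS](zp_red _ zc'); exact: e.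
Qed.

End PerpBasis.

Section ZetaValue.

Variable p : nat.
Hypothesis p_pr : prime p.
Hypothesis p_odd : p <> 2%N.

Notation mat g n := (mxk 3 3 g n).
Notation vec S n := (vk 3 S n).
Let G : 'M[int]_3 := GLH 3.
Let q : R := p%:R.

Variable x : padic.
Hypothesis zx : is_zp p x.
Variable v : nat.
Hypothesis xv : x v = 0.
Hypothesis xv1 : x v.+1 != 0.
Variable l : nat.
Hypothesis lv : (2 * l <= v)%N.
Variable S : nat -> padic.
Hypothesis zS : inL p S.
Hypothesis eS : equivSO p (repT p x l) S.

Let ql := qk p x l.
Let zql : is_zp p ql. Proof. exact: qk_zp lv. Qed.
Let q0 : q != 0. Proof. by rewrite pnatr_eq0 -lt0n prime_gt0. Qed.

Let u := (perpBasis p S).1.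
Let w := (perpBasis p S).2.

Lemma perpBasisP : isBasis p S u w.
Proof.
have [g [h [_ _ B]]] := std_basis p_pr p_odd zx xv lv eS.
have ex : exists uw : (nat -> padic) * (nat -> padic), isBasis p S uw.1 uw.2.
  by exists (gen p g (e1 p x l), gen p g e2).
exact: epsilon_spec ex.
Qed.

Definition pmx (a b : nat -> padic) n : 'M[int]_(3, 1 + 1) := row_mx (vec a n) (vec b n).
Definition Smx n : 'M[int]_(3, 1 + 1) := row_mx (e1 p x l n) (e2 n).

Lemma lin_vec a (s : nat -> padic) b (t : nat -> padic) (A : nat -> padic) n :
  (forall i, (i < 3)%N -> zeq (A i) (lin p a s b t i)) ->
  eqM (p ^ n)%N (vec A n) (pmx s t n *m vec2 (a n) (b n)).
Proof.
move=> H; rewrite /pmx /vec2 mul_row_col !mul_mx_scalar; apply/eqM_entry => i j.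
by rewrite !ord1 !mxE H //; apply: red_id.
Qed.

Lemma pmx_change (s t : nat -> padic) (A C : nat -> padic) :
  (exists a b, is_zp p a /\ is_zp p b /\ forall i, (i < 3)%N -> zeq (A i) (lin p a s b t i)) ->
  (exists a b, is_zp p a /\ is_zp p b /\ forall i, (i < 3)%N -> zeq (C i) (lin p a s b t i)) ->
  exists2 M : nat -> 'M[int]_(1 + 1), (forall n, eqM (p ^ n)%N (M n.+1) (M n)) &
    forall n, eqM (p ^ n)%N (pmx A C n) (pmx s t n *m M n).
Proof.
move=> [a [b [za [zb H]]]] [c [d [zc [zd H']]]].
exists (fun n => row_mx (vec2 (a n) (b n)) (vec2 (c n) (d n))) => n.
  have z f : is_zp p f -> red p n (f n.+1) = red p n (f n) by move=> /zp_coh.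
  apply/eqM_entry => i j; rewrite -(splitK i) -(splitK j).
  case: (split j) => j' /=; rewrite ?row_mxEl ?row_mxEr; case: (split i) => i' /=;
    rewrite /vec2 ?col_mxEu ?col_mxEd !ord1 !mxE !mulr1n; exact: z.
rewrite mul_mx_row; have h1 := lin_vec n H; have h2 := lin_vec n H'.
apply/eqM_entry => i j; rewrite -(splitK j); case: (split j) => j' /=.
  by rewrite /pmx !row_mxEl; move/eqM_entry: h1; apply.
by rewrite [pmx A C n]/pmx !row_mxEr; move/eqM_entry: h2; apply.
Qed.

Definition Dmx n : 'M[int]_(1 + 1) := block_mx (- (2%:R * ql n))%:M 0 0 (- 2%:R)%:M.

Lemma Smx_gram n : (Smx n)^T *m G *m Smx n = Dmx n.
Proof.
rewrite /Smx tr_row_mx mul_col_mx mul_col_row /Dmx.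
by congr block_mx; rewrite [LHS]mx11_scalar bG !mxE /=; rewrite -?(raddf0 (@scalar_mx int 1)); congr _%:M; rewrite /ql; ring.
Qed.

(** The definitions use a basis chosen by [epsilon], about which only the basis property is known.
    This unimodular change of coordinates transfers every computation to [e1], [e2]. *)
Lemma perp_change : exists B : nat -> 'M[int]_(1 + 1), exists A : nat -> 'M[int]_(1 + 1),
  [/\ forall n, eqM (p ^ n)%N (B n.+1) (B n), forall n, eqM (p ^ n)%N (B n *m A n) 1%:M &
      exists2 g, SOset p 0 g & forall n, eqM (p ^ n)%N (pmx u w n) (mat g n *m Smx n *m B n)].
Proof.
have [g [h [sg hg [p1 p2 sp _]]]] := std_basis p_pr p_odd zx xv lv eS.
have [pu pw sp' _] := perpBasisP.
have [B cB PB] := pmx_change (sp _ pu) (sp _ pw).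
have [A _ PA] := pmx_change (sp' _ p1) (sp' _ p2).
have PE n : eqM (p ^ n)%N (pmx (gen p g (e1 p x l)) (gen p g e2) n) (mat g n *m Smx n).
  rewrite /pmx /Smx mul_mx_row; apply/eqM_entry => i j; rewrite -(splitK j).
  case: (split j) => j' /=; rewrite ?row_mxEl ?row_mxEr.
    by move/eqM_entry: (gen_vec p g (e1 p x l) n); apply.
  by move/eqM_entry: (gen_vec p g e2 n); apply.
exists B, A; split=> //; last first.
  exists g => // n; apply: eqM_trans (PB n) _.
  exact: (eqM_mul (PE n) (eqM_refl _ _)).
move=> n.
have e : eqM (p ^ n)%N (mat g n *m Smx n *m (B n *m A n)) (mat g n *m Smx n).
  apply: eqM_trans (PE n); rewrite eqM_sym; apply: eqM_trans (PA n) _.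
  rewrite mulmxA; apply: (eqM_mul _ (eqM_refl _ _)); apply: eqM_trans (PB n) _.
  exact: (eqM_mul (PE n) (eqM_refl _ _)).
(* Reading off the first and third coordinates is a left inverse of [Smx]; composed with [h] it
   cancels the standard basis and leaves [B A = 1]. *)
pose Linv : 'M[int]_(1 + 1, 3) := col_mx (cv3 1 0 0)^T (cv3 0 0 1)^T.
have LE : Linv *m Smx n = 1%:M.
  rewrite /Linv /Smx mul_col_row scalar_mx_block; congr block_mx;
  by rewrite [LHS]mx11_scalar mxE !big_ord_recl big_ord0 !mxE /= -?(raddf0 (@scalar_mx int 1)); congr _%:M; ring.
have := eqM_mul (eqM_refl _ (Linv *m mat h n)) e.
have hE (Y : 'M[int]_(3, 1 + 1)) : eqM (p ^ n)%N (Linv *m mat h n *m (mat g n *m Y)) (Linv *m Y).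
  rewrite -mulmxA; apply: (eqM_mul (eqM_refl _ _)); rewrite mulmxA -[X in eqM _ _ X]mul1mx.
  exact: (eqM_mul (hg n) (eqM_refl _ _)).
rewrite -[mat g n *m Smx n *m _]mulmxA => h1.
have h2 := hE (Smx n *m (B n *m A n)); have h3 := hE (Smx n); rewrite LE in h3.
rewrite [Linv *m (Smx n *m _)]mulmxA LE mul1mx in h2.
by rewrite eqM_sym in h2; apply: eqM_trans h2 (eqM_trans h1 h3).
Qed.

Let m := (v - 2 * l)%N.
Let sh := shift p m ql.
Definition un n := - sh n.
Definition minus1 (n : nat) : int := -1.

Lemma ql_m : ql m = 0.
Proof. by apply/eqP; rewrite /ql /qk shift_eq0 //; [rewrite /m subnK // xv | exact: zp_val0 lv]. Qed.

Lemma ql_m1 : ql m.+1 != 0.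
Proof. by rewrite /ql /qk shift_eq0 //; [rewrite /m addSn subnK | exact: zp_val0 lv]. Qed.

Lemma un_coh : coh p un.
Proof. by apply: coh_opp; apply: zp_coh; apply: is_zp_shift => //; exact: ql_m. Qed.

Lemma zp_unit1 y : is_zp p y -> y 1%N != 0 -> ~~ (p%:Z %| y 1%N)%Z.
Proof.
move=> zy; apply: contra => /dvdz_mod0P d; rewrite -(zp_red 1 zy); apply/eqP.
by rewrite /red /pk expn1.
Qed.

Lemma un_unit : ~~ (p%:Z %| un 1%N)%Z.
Proof.
rewrite /un rpredN; apply: zp_unit1; first by apply: is_zp_shift => //; exact: ql_m.
by rewrite shift_eq0 ?ql_m1 //; exact: ql_m.
Qed.

Lemma m1_coh : coh p minus1. Proof. by []. Qed.

Lemma m1_unit : ~~ (p%:Z %| minus1 1%N)%Z.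
Proof. by rewrite /minus1 rpredN dvdzE /= dvdn1 gtn_eqF // prime_gt1. Qed.

Lemma iso_q g n y : SOset p 0 g -> red p n (qQ (mat g n *m y)) = red p n (qQ y).
Proof.
move=> sg; have n2 : ~~ (p%:Z %| 2%:R)%Z.
  by rewrite dvdzE /= dvdn_prime2 //; apply/eqP.
apply: (red_unit_cancel p_pr n2).
have tq y' : 2%:R * qQ y' = (y'^T *m G *m y') 0 0 by rewrite bG /qQ; ring.
by rewrite !tq; apply: iso_bil.
Qed.

Definition emb (z : 'cV[int]_(1 + 1)) : nat -> padic :=
  fun i => oapp (fun j : 'I_2 => zint p (z j 0)) zero (insub i).

Definition Qv (xy : nat -> padic) : padic := QL p (lin p (xy 0%N) u (xy 1%N) w).

Definition form n (z : 'cV[int]_(1 + 1)) : int :=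
  (p ^ m)%N%:Z * un n * usubmx z 0 0 ^+ 2 + minus1 n * dsubmx z 0 0 ^+ 2.

Lemma form_E n z : red p n (qQ (Smx n *m z)) = red p n (form n z).
Proof.
rewrite -[z]vsubmxK /Smx mul_row_col [usubmx z]mx11_scalar [dsubmx z]mx11_scalar !mul_mx_scalar.
rewrite /form col_mxKu col_mxKd /e1 /e2 /qQ !mxE /= !mulr1n.
set a := z _ _; set b := z _ _.
have -> : (a * 1 + b * 0) * (a * - qk p x l n + b * 0) - (a * 0 + b * 1) * (a * 0 + b * 1) =
  - (ql n * a ^+ 2) + - b ^+ 2 by rewrite /ql; ring.
apply: red_add; last by rewrite /minus1 mulN1r.
rewrite -mulNr; apply: red_mul => //; rewrite /un mulrN; apply: red_opp.
by rewrite -(shift_red n zql ql_m) red_id.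
Qed.

Lemma vec2E (z : 'cV[int]_(1 + 1)) : z = vec2 (z 0 0) (z 1 0).
Proof.
rewrite /vec2 -[LHS]vsubmxK [usubmx z]mx11_scalar [dsubmx z]mx11_scalar !mxE.
by congr (col_mx (z _ _)%:M (z _ _)%:M); apply: val_inj.
Qed.

Lemma emb0 z n : emb z 0%N n = red p n (z 0 0).
Proof. by rewrite /emb -[0%N]/(val (0 : 'I_2)) valK. Qed.
Lemma emb1 z n : emb z 1%N n = red p n (z 1 0).
Proof. by rewrite /emb -[1%N]/(val (1 : 'I_2)) valK. Qed.

Lemma zp_emb z i : is_zp p (emb z i).
Proof.
rewrite /emb; case: insub => [j|] /=; first exact: is_zp_zint.
by move=> k; rewrite /zero /red mod0z.
Qed.

Lemma lin_zp a b : is_zp p a -> is_zp p b -> zvec p 3 (lin p a u b w).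
Proof.
move=> za zb i i3; have [[zu _] [zw _] _ _] := perpBasisP.
by apply: coh_zp; apply: coh_add; apply: coh_mul; apply: zp_coh; [|apply: zu| |apply: zw].
Qed.

Lemma Qv_zp z : is_zp p (Qv (emb z)).
Proof.
move=> n; rewrite /Qv !QLE // red_le // ; apply: qQ_eqM; rewrite eqM_sym.
by apply/eqM_entry => i j; rewrite !mxE; apply: (zp_coh (lin_zp (zp_emb z 0) (zp_emb z 1) (ltn_ord i))).
Qed.

Lemma Qv_form : exists B : nat -> 'M[int]_(1 + 1), exists A : nat -> 'M[int]_(1 + 1),
  [/\ forall n, eqM (p ^ n)%N (B n *m A n) 1%:M,
      forall n, eqM (p ^ n)%N (B n.+1) (B n) &
      forall n z, Qv (emb z) n = red p n (form n (B n *m z))].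
Proof.
have [B [A [cB BA [g sg PB]]]] := perp_change; exists B, A; split=> // n z.
rewrite /Qv QLE // -form_E -[in RHS](iso_q n _ sg); apply: qQ_eqM.
apply: (eqM_trans (B := pmx u w n *m z)); last first.
  by rewrite !mulmxA; exact: (eqM_mul (PB n) (eqM_refl _ z)).
have h : eqM (p ^ n)%N (vec (lin p (emb z 0) u (emb z 1) w) n) (pmx u w n *m vec2 (emb z 0 n) (emb z 1 n)).
  by apply: lin_vec.
apply: (eqM_trans h); apply: (eqM_mul (eqM_refl _ _)); rewrite [X in eqM _ _ X]vec2E.
apply/eqM_entry => i j; rewrite /vec2 -(splitK i); case: (split i) => i' /=;
  by rewrite ?col_mxEu ?col_mxEd !ord1 !mxE !mulr1n ?emb0 ?emb1; apply: red_id.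
Qed.

Lemma haarV_sum F : haarV p 2 F = Rlim (fun r => sumM (p ^ r) (fun z => F (emb z)) / q ^+ (2 * r)).
Proof.
rewrite /haarV; congr Rlim; apply: functional_extensionality => r.
rewrite !RealsE mulrC -expnM mulnC natrX; congr (_ / _).
rewrite /sumM (reindex (fun y : {ffun 'I_2 -> 'I_(p ^ r)} => (\col_i y i) : 'M['I_(p ^ r)]_(1 + 1, 1))) /=.
  apply: eq_bigr => y _; congr F; apply: functional_extensionality => i.
  apply: functional_extensionality => k; rewrite /emb.
  by case: insub => // j /=; rewrite !mxE.
apply: onW_bij; exists (fun M : 'M['I_(p ^ r)]_(1 + 1, 1) => [ffun i => M i 0]) => [y|M].
  by apply/ffunP => i; rewrite ffunE mxE.
by apply/matrixP => i j; rewrite mxE ffunE ord1.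
Qed.

Section Exponent.

Variable e : nat.
Local Notation W := (W p e).

(** The two terms agree unless [y] vanishes modulo [p^r]; then both lie between 0 and [q^(-r e)].
    For [e = 0] both are 1, even at [y = 0]. The bound is uniform in [y], so Riemann sums of [|Q|^e]
    may be replaced by sums of [W]. *)
Lemma absp_close y r : is_zp p y -> `|absp p y ^+ e - W r (y r)| <= (q^-1) ^+ r.
Proof.
move=> zy; rewrite /(W _ _) zp_red //.
have qi : q^-1 ^+ r = (p ^ r)%:R^-1 by rewrite exprVn natrX.
have [y0|yr0] := eqVneq (y r) 0; last first.
  have [w' [yw yw1]] : exists v', y v' = 0 /\ y v'.+1 != 0.
    by apply: zp_val => // z0; move: yr0; rewrite z0 eqxx.
  have wr : (w' < r)%N by rewrite ltnNge; apply/negP => rw; move: yr0; rewrite (zp_val0 zy yw rw).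
  by rewrite (absp_val p_pr zy yw yw1) (absk_val p_pr zy yw yw1 wr) subrr normr0 exprn_ge0 // invr_ge0 ler0n.
have ak : absk p r (y r) = (q^-1) ^+ r by rewrite /absk y0 eqxx qi.
have [ap0 ap1] : 0 <= absp p y /\ absp p y <= (q^-1) ^+ r.
  have [zz|nz] := ClassicalEpsilon.excluded_middle_informative (zeq y zero).
    have -> : absp p y = 0.
      rewrite abspE; apply: Rlim_of_cvg => eps eps0.
      have q1 : q^-1 < 1 by rewrite invf_lt1 ?ltr1n ?ltr0n ?prime_gt0 ?prime_gt1.
      have qi0 : 0 <= q^-1 by rewrite invr_ge0 ler0n.
      have [j H] := geom_small 1 qi0 q1 eps0; exists j => n jn.
      rewrite zz /absk eqxx subr0 ger0_norm ?invr_ge0 ?ler0n //.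
      by have := H n jn; rewrite mulr1 exprVn natrX.
    by split=> //; rewrite exprn_ge0 // invr_ge0 ler0n.
  have [w' [yw yw1]] := zp_val zy nz.
  have rw : (r <= w')%N by rewrite leqNgt; apply/negP => wr; have := zp_valn0 zy yw1 wr; rewrite y0 eqxx.
  rewrite (absp_val p_pr zy yw yw1); split; first by rewrite invr_ge0 ler0n.
  by rewrite qi lef_pV2 ?posrE ?ltr0n ?expn_gt0 ?prime_gt0 // ler_nat leq_exp2l ?prime_gt1.
rewrite ak; case: e => [|e']; first by rewrite !expr0 subrr normr0 exprn_ge0 // invr_ge0 ler0n.
have b0 : 0 <= (q^-1) ^+ r by rewrite exprn_ge0 // invr_ge0 ler0n.
have b1 : (q^-1) ^+ r <= 1 by rewrite qi invf_le1 ?ltr0n ?ler1n ?expn_gt0 ?prime_gt0.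
move: b0 b1 ap1; move: ((q^-1) ^+ r) => b b0 b1 ap1.
rewrite ler0_norm ?subr_le0 ?lerXn2r // opprB; apply: (@le_trans _ _ (b ^+ e'.+1)).
  by rewrite gerBl exprn_ge0.
by rewrite exprS ler_piMr // exprn_ile1.
Qed.

Lemma form_mod n y z : eqM (p ^ n)%N y z -> red p n (form n y) = red p n (form n z).
Proof.
move=> /eqM_entry H; rewrite /form !mxE.
by apply: red_add; apply: red_mul => //; rewrite !expr2; apply: red_mul; apply: H.
Qed.

Lemma sum_form (f : int -> R) n (B A : 'M[int]_(1 + 1)) :
  (forall y z, red p n y = red p n z -> f y = f z) -> eqM (p ^ n)%N (B *m A) 1%:M ->
  sumM (p ^ n) (fun z => f (form n (B *m z))) = S2 p f n ((p ^ m)%N%:Z * un n) (minus1 n).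
Proof.
move=> fm BA; rewrite (@sumM_lin _ (p ^ n)%N B A (fun z => f (form n z))) //.
- rewrite sumM2; apply: eq_bigr => a _; apply: eq_bigr => c _.
  by rewrite /form /vec2 col_mxKu col_mxKd !mxE !mulr1n.
- by rewrite expn_gt0 prime_gt0.
- by move=> y z yz; apply/fm/form_mod.
Qed.

Lemma zeta_num : haarV p 2 (fun xy => absp p (Qv xy) ^+ e) = Iv p e (splits p un minus1) m.
Proof.
rewrite haarV_sum; apply: Rlim_of_cvg.
have [B [A [BA cB QB]]] := Qv_form.
have J := J_cvg p_pr p_odd e m un_coh m1_coh un_unit m1_unit.
have JE r : Jseq p e m un minus1 r = sumM (p ^ r) (fun z => W r (Qv (emb z) r)) / q ^+ (2 * r).
  rewrite /Jseq; congr (_ / _); rewrite -(sum_form (B := B r) (A := A r)) //; last exact: W_mod.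
  by apply: eq_sumM => z; rewrite QB; apply: W_mod; rewrite red_id.
have d r : `|sumM (p ^ r) (fun z => absp p (Qv (emb z)) ^+ e) / q ^+ (2 * r) - Jseq p e m un minus1 r|
    <= (q^-1) ^+ r.
  have qr : 0 < q ^+ (2 * r) by rewrite exprn_gt0 // ltr0n prime_gt0.
  rewrite JE -mulrBl normrM (gtr0_norm (_ : 0 < (q ^+ (2 * r))^-1)) ?invr_gt0 //.
  rewrite ler_pdivrMr // /sumM -sumrB; apply: le_trans (ler_norm_sum _ _ _) _.
  apply: (@le_trans _ _ (\sum_(y : 'M['I_(p ^ r)]_(1 + 1, 1)) (q^-1) ^+ r)).
    by apply: ler_sum => y _; apply: absp_close; apply: Qv_zp.
  by rewrite sumr_const card_mx card_ord -expnM muln1 -mulr_natr natrX [(r * _)%N]mulnC.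
move=> eps eps0; have h0 : 0 < eps / 2%:R by rewrite divr_gt0 ?ltr0n.
have [n0 H] := J _ h0.
have q1 : q^-1 < 1 by rewrite invf_lt1 ?ltr1n ?ltr0n ?prime_gt0 ?prime_gt1.
have qi0 : 0 <= q^-1 by rewrite invr_ge0 ler0n.
have [j Hj] := geom_small 1 qi0 q1 h0.
exists (maxn n0 j) => n; rewrite geq_max => /andP[n0n jn].
set a := (X in `|X - _|); set l0 := (X in `|_ - X|).
rewrite -(subrK (Jseq p e m un minus1 n) a) -addrA.
apply: le_trans (ler_normD _ _) _; rewrite [leRHS]splitr lerD //; last exact: H.
by apply: le_trans (d n) _; have := Hj n jn; rewrite mulr1.
Qed.

End Exponent.

Lemma zeta_den : haarV p 2 (fun xy => if Qv xy 1%N != 0 then 1 else 0) = Ev p (splits p un minus1) m.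
Proof.
rewrite haarV_sum; have [B [A [BA cB QB]]] := Qv_form.
have E := E_val p_pr p_odd m un_coh m1_coh un_unit m1_unit.
have ndm y z : red p 1 y = red p 1 z -> nd p y = nd p z by apply: nd_mod.
have FE z : (if Qv (emb z) 1%N != 0 then 1 else 0 : R) = nd p (form 1 (B 1%N *m z)).
  rewrite QB /nd /ind.
  have -> : (red p 1 (form 1 (B 1%N *m z)) == 0) = (p%:Z %| form 1 (B 1%N *m z))%Z.
    by apply/eqP/dvdz_mod0P; rewrite /red /pk expn1.
  by case: (p%:Z %| _)%Z.
(* Being a unit is a condition modulo [p], so these Riemann sums are constant from level 1 on. *)
apply: (@Rlim_ev _ _ 1) => r r1; rewrite (eq_sumM _ FE).
rewrite -[in sumM _](subnKC r1) expnD sumM_periodic; last first.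
  apply: periodic_mxk => y z yz; apply/ndm/form_mod.
  exact: (eqM_mul (eqM_refl _ _) yz).
rewrite (sum_form (A := A 1%N)) // -E.
have -> : q ^+ (2 * r) = q ^+ 2 * ((p ^ (r - 1)) ^ ((1 + 1) * 1))%:R.
  by rewrite -expnM natrX -exprD; congr (_ ^+ _); lia.
have n0 : ((p ^ (r - 1)) ^ ((1 + 1) * 1))%:R != 0 :> R by rewrite pnatr_eq0 -lt0n !expn_gt0 prime_gt0.
have aux (a b c : R) : a != 0 -> b != 0 -> a * c / (b * a) = c / b.
  by move=> a0 b0; field; rewrite a0 b0.
by rewrite aux // expf_neq0.
Qed.

Lemma det2 (M : 'M[int]_(1 + 1)) : \det M =
  ulsubmx M 0 0 * drsubmx M 0 0 - ursubmx M 0 0 * dlsubmx M 0 0.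
Proof.
rewrite (expand_det_row _ (lshift 1 0)) big_split_ord /= !big_ord1 /cofactor !det_mx11 !mxE /=.
have o1 (a : 'I_1) (b : 'I_(1 + 1).-1) : lift (lshift 1 a) b = rshift 1 (0 : 'I_1).
  by apply: val_inj; case: a => [[]// i]; case: b => [[]// j].
have o2 (a : 'I_1) (b : 'I_(1 + 1).-1) : lift (rshift 1 a) b = lshift 1 (0 : 'I_1).
  by apply: val_inj; case: a => [[]// i]; case: b => [[]// j].
rewrite !o1 !o2 /= -![ord0]/(0 : 'I_1); ring.
Qed.

Lemma det_gram_perp n : red p n (BL p u u n * BL p w w n - BL p u w n * BL p w u n) =
  red p n (\det ((pmx u w n)^T *m G *m pmx u w n)).
Proof.
rewrite det2 /pmx tr_row_mx mul_col_mx mul_col_row block_mxKul block_mxKdr block_mxKur block_mxKdl.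
by rewrite !BLE //; apply: red_add; [|apply: red_opp]; apply: red_mul; apply: red_id.
Qed.

(** The Gram determinant is [4 ql] times the square of [det B]; only [ql] is not a unit, and its
    valuation is [m]. *)
Lemma absd_val : absd p S = (q ^+ m)^-1.
Proof.
have [B [A [cB BA [g sg PB]]]] := perp_change.
pose d n := red p n (BL p u u n * BL p w w n - BL p u w n * BL p w u n).
have dE n : d n = red p n (4%:R * (\det (B n) * \det (B n)) * ql n).
  rewrite /d det_gram_perp.
  have h : eqM (p ^ n)%N ((pmx u w n)^T *m G *m pmx u w n) ((B n)^T *m Dmx n *m B n).
    apply: (eqM_trans (eqM_mul (eqM_mul (eqM_tr (PB n)) (eqM_refl _ _)) (PB n))).
    have [_ ig _] := SO_elim p_pr p_odd sg.
    have -> : (mat g n *m Smx n *m B n)^T *m G *m (mat g n *m Smx n *m B n) =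
      (Smx n *m B n)^T *m ((mat g n)^T *m G *m mat g n) *m (Smx n *m B n).
      by rewrite !trmx_mul !mulmxA.
    apply: (eqM_trans (eqM_mul (eqM_mul (eqM_refl _ _) (ig n)) (eqM_refl _ _))).
    rewrite -Smx_gram !trmx_mul !mulmxA; exact: eqM_refl.
  have -> : red p n (\det ((pmx u w n)^T *m G *m pmx u w n)) = red p n (\det ((B n)^T *m Dmx n *m B n)).
    exact: eqM_det h.
  rewrite !det_mulmx det_tr det_ublock !det_scalar1.
  by congr red; ring.
have cd : is_zp p d.
  move=> n; rewrite !dE red_le //; apply/esym.
  have db : red p n (\det (B n.+1)) = red p n (\det (B n)) by apply: eqM_det; apply: cB.
  by apply: red_mul; [apply: red_mul => //; apply: red_mul | apply: zp_coh].
have -> : absd p S = absp p d by [].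
rewrite (absp_val p_pr cd (v := m)) ?natrX //.
  by rewrite dE ql_m mulr0 /red mod0z.
rewrite dE; apply/eqP => /dvdz_mod0P; rewrite /pk.
have du : ~~ (p%:Z %| 4%:R * (\det (B m.+1) * \det (B m.+1)))%Z.
  rewrite -!(intr_Fp_eq0 _ p_pr) !rmorphM /= !mulf_eq0 orbb.
  have -> : ((\det (B m.+1))%:~R == 0 :> 'F_p) = false.
    apply/negbTE; have := eqM_det (BA m.+1); rewrite det_mulmx det1 => /(red_le1 p_pr (ltn0Sn m)).
    by rewrite rmorphM /=; apply: contra_eq_neq => ->; rewrite mul0r eq_sym oner_eq0.
  rewrite orbF rmorph_nat (_ : 4%:R = 2%:R * 2%:R :> 'F_p); last by rewrite -natrM.
  by rewrite mulf_eq0 orbb; apply: Fp_two_neq0.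
rewrite Gauss_dvdzr; last first.
  by rewrite coprimezE /= coprimeXl // prime_coprime.
move/dvdz_mod0P => h; have := ql_m1; rewrite -(zp_red _ zql) /red /pk h eqxx //.
Qed.

End ZetaValue.

Lemma In_nth (T : Type) (d a : T) (s : seq T) : List.In a s -> exists2 i, (i < size s)%N & nth d s i = a.
Proof.
elim: s => // b s IH /= [->|/IH[i im <-]]; first by exists 0%N.
by exists i.+1.
Qed.

Lemma nth_In (T : Type) (d : T) (s : seq T) i : (i < size s)%N -> List.In (nth d s i) s.
Proof. by elim: s i => // b s IH [|i] /= im; [left | right; apply: IH]. Qed.

(** * The sum over the orbits *)

Section RealPowers.

Variable q : R.
Hypothesis q_gt0 : 0 < q.

Lemma Rpower_Vexp (a : R) n y : 0 < a -> Rpower ((a ^+ n)^-1) y = Rpower a (- (n%:R * y))%R.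
Proof.
move=> a0; rewrite /Rpower; congr exp.
have an : 0 < a ^+ n by rewrite exprn_gt0.
rewrite -RinvE ln_Rinv; last exact/RltP.
rewrite -RpowE ln_pow; last exact/RltP.
by rewrite !RealsE; ring.
Qed.

Lemma Rpower_sum y z : Rpower q (y + z)%R = Rpower q y * Rpower q z.
Proof. exact: Rpower_plus. Qed.

Lemma Rpower_nat n : Rpower q (- n%:R)%R = (q ^+ n)^-1.
Proof.
have -> : - n%:R = Ropp (INR n) by rewrite INRE.
rewrite Rpower_Ropp Rpower_pow; last exact/RltP.
by rewrite !RealsE.
Qed.

End RealPowers.

Section OrbitSum.

Variable p : nat.
Hypothesis p_pr : prime p.
Hypothesis p_odd : p <> 2%N.
Variable x : padic.
Hypothesis zx : is_zp p x.
Variable v : nat.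
Hypothesis xv : x v = 0.
Hypothesis xv1 : x v.+1 != 0.
Variable e : nat.
Let q : R := p%:R.
Let w := (q^-1) ^+ e.
Let X := w / q.

Definition spl : bool := [exists z : 'F_p, - 1 * z ^+ 2 - (shift p v x 1)%:~R == 0].

(** Dividing by [p^(2l)] does not change the unit part, so all complements share the same splitting
    behaviour. *)
Lemma un1 l : (2 * l <= v)%N -> un p x v l 1 = - shift p v x 1.
Proof.
move=> lv; rewrite /un; congr (- _).
have x2 := zp_val0 zx xv lv.
have zq := is_zp_shift p_pr zx x2.
have pv0 : (p ^ v)%N%:Z != 0 by rewrite eqz_nat -lt0n expn_gt0 prime_gt0.
have q0 : qk p x l (v - 2 * l)%N = 0 by apply/eqP; rewrite /qk shift_eq0 // subnK // xv.
apply: (mulfI pv0); rewrite -(shiftE 1 zx xv) -{1}(subnK lv) expnD mulnC PoszM -mulrA.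
by rewrite -(shiftE 1 zq q0) -shiftE // -addnA subnK.
Qed.

Lemma splE l : (2 * l <= v)%N -> splits p (un p x v l) minus1 = spl.
Proof.
move=> lv; rewrite /splits /spl; apply: eq_existsb => z.
by rewrite un1 // /minus1 !rmorphN /=.
Qed.

(** The bridge between the two sides: for the unit part [c] of [x], both the point count and the
    splitting of the complement ask whether [z^2 = -c] is solvable, which has two solutions or
    none. *)
Lemma kappaE : kappa p v x = kap spl.
Proof.
set c : 'F_p := (shift p v x 1)%:~R.
have two0 := Fp_two_neq0 p_pr p_odd.
have cE z : ((2%:R * shift p v x 1)%:~R == - 2%:R * z ^+ 2 :> 'F_p) = (z ^+ 2 == - c).
  rewrite rmorphM rmorph_nat -/c -subr_eq0 (_ : _ - _ = 2%:R * (z ^+ 2 + c)); last by ring.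
  by rewrite mulf_eq0 (negbTE two0) addr_eq0.
have c0 : c != 0.
  rewrite intr_Fp_eq0 //; apply: zp_unit1; first exact: is_zp_shift.
  by rewrite shift_eq0.
have sE z : (- 1 * z ^+ 2 - c == 0) = (z ^+ 2 == - c).
  by rewrite mulN1r -opprD oppr_eq0 addr_eq0.
rewrite /kappa /sqc /kap /spl -/c.
case: existsP => [[z0]|nz].
  rewrite sE => /eqP z0E.
  rewrite (eq_card (B := [set z0; - z0])) => [|z]; last first.
    by rewrite !inE cE -z0E eqf_sqr.
  rewrite cards2 (_ : z0 != - z0) // -addr_eq0 -mulr2n -mulr_natl mulf_neq0 //.
  by apply: contra c0 => /eqP z00; rewrite -oppr_eq0 -z0E z00 expr0n.
rewrite eq_card0 // => z; rewrite !inE cE; apply/negbTE/negP => h.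
by apply: nz; exists z; rewrite sE.
Qed.

Let q_gt0 : 0 < q. Proof. by rewrite ltr0n prime_gt0. Qed.

Lemma XE : X = (q ^+ e.+1)^-1.
Proof. by rewrite /X /w exprSr exprVn invfM. Qed.

Lemma term_val l S : (2 * l <= v)%N -> equivSO p (repT p x l) S ->
  Rmult (Rmult (Rpower (absd p S) (- INR e.+1 / 2)) (Rminus 1 (Rinv (INR (p ^ e.+1)))))
            (zeta_perp p S e.+1) =
  Rpower q (- (v%:R * (- e.+1%:R / 2%:R)))%R * (X ^+ l * (1 - X) * Zn p e spl (v - 2 * l)).
Proof.
move=> lv eS.
have num := zeta_num p_pr p_odd zx xv xv1 lv eS e.
have den := zeta_den p_pr p_odd zx xv xv1 lv eS.
rewrite splE // in num den.
have -> : zeta_perp p S e.+1 = Zn p e spl (v - 2 * l).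
  rewrite /Zn -num -den /zeta_perp subn1 /= RdivE; congr (_ / _).
  by congr haarV; apply: functional_extensionality => xy; rewrite RpowE.
rewrite (absd_val p_pr p_odd zx xv xv1 lv eS) Rpower_Vexp // !RealsE natrX -XE.
rewrite !mulrA; congr (_ * _ * _).
(* Since the discriminant has valuation [v - 2l], its power [-s/2] is [q^(vs/2)] times [X^l]; the
   first factor is common to all orbits. *)
have -> : X ^+ l = Rpower q (- (e.+1 * l)%N%:R)%R by rewrite Rpower_nat // XE exprM exprVn.
rewrite -Rpower_sum; congr (Rpower _ _ * _); rewrite ?[nat_of_pos 2]/= natrB // !natrM.
by field.
Qed.

Variable reps : seq (nat -> padic).
Hypothesis reps_x : orbit_reps p x reps.
Let S0 : nat -> padic := fun _ => zero.

(** An arbitrary list of representatives is matched with the indices [l <= v/2]: inequivalence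
    within the list gives injectivity, and surjectivity holds because each [repT p x l] is
    equivalent to a member of the list. *)
Lemma sum_reps (f : (nat -> padic) -> R) (g : nat -> R) :
  (forall l S, (2 * l <= v)%N -> equivSO p (repT p x l) S -> f S = g l) ->
  \sum_(S <- reps) f S = \sum_(k < v./2.+1) g k.
Proof.
move=> fg; have [r1 r2 r3] := reps_x.
have lev (k : 'I_v./2.+1) : (2 * k <= v)%N.
  by have := ltn_ord k; have := odd_double_half v; lia.
rewrite (big_nth S0) big_mkord.
have ex (i : 'I_(size reps)) : exists k : 'I_v./2.+1, equivSO p (repT p x k) (nth S0 reps i).
  have [zS QS] := r1 _ (nth_In S0 (ltn_ord i)).
  have [l lv eS] := orbit_exists p_pr p_odd zx xv xv1 zS QS.
  have lt : (l < v./2.+1)%N by have := odd_double_half v; lia.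
  by exists (Ordinal lt).
have [h hP] := fin_all_exists ex.
have hinj : injective h.
  move=> i j hij; apply: val_inj => /=; case: (eqVneq (i : nat) j) => // /eqP ne.
  case: (r3 i j (ltn_ord i) (ltn_ord j) ne).
  apply/SOequivE; first by case: (r1 _ (nth_In S0 (ltn_ord j))).
  apply: (equivSO_trans p_pr p_odd (S' := repT p x (h i))); last by rewrite hij; apply: hP.
  by apply: equivSO_sym => //; apply: hP.
have hsurj k : exists i, h i = k.
  have zT := repT_inL p_pr zx xv (lev k).
  have [S [inS eS]] := r2 _ zT (repT_QL zx xv (lev k)).
  have [i im iS] := In_nth S0 inS; rewrite -iS in eS; move/(SOequivE _ zT): eS => eS.
  exists (Ordinal im); apply: val_inj; apply: (repT_inj p_pr p_odd (x := x)).
  exact: (equivSO_trans p_pr p_odd (hP (Ordinal im)) eS).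
rewrite [RHS](reindex h) /=; last first.
  apply: onW_bij; have [h' h'K] := fin_all_exists hsurj.
  by exists h' => // i; apply: hinj; rewrite h'K.
by apply: eq_bigr => i _; apply: fg (hP i); apply: lev.
Qed.

Lemma main_val :
  \sum_(S <- reps)
      Rmult (Rmult (Rpower (absd p S) (- INR e.+1 / 2)) (Rminus 1 (Rinv (INR (p ^ e.+1)))))
            (zeta_perp p S e.+1)
  = Rmult (Rmult (Rpower (absp p x) ((INR e.+1 - 1) / 2)) (Rinv (lambda_p p e))) (mu_p p x e).
Proof.
rewrite (sum_reps (g := fun l => Rpower q (- (v%:R * (- e.+1%:R / 2%:R)))%R *
  (X ^+ l * (1 - X) * Zn p e spl (v - 2 * l)))); last exact: term_val.
rewrite -mulr_sumr -/(Fsum p e spl v) sum_zeta // -kappaE.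
rewrite (mu_val p_pr p_odd _ zx xv xv1) (lambda_val p_pr p_odd) (absp_val p_pr zx xv xv1).
rewrite natrX -/q !Rpower_Vexp // !RealsE -/w -/X.
have -> : (q ^+ (2 * e.+1))^-1 = X ^+ 2 by rewrite XE exprVn -exprM mulnC.
rewrite /dimLH natrD natrM [nat_of_pos 2]/=.
set a := (X in Rpower q X * _); set b := (X in _ = Rpower q X / _ * _).
set c := (X in _ = _ * (Rpower q X / _ * _)); set d := (X in _ = _ * (_ / Rpower q X * _)).
(* The exponents are [vs/2] for the discriminants, [-v(s-1)/2] for [|q|], and [v(2s+1)/2] and [v]
   for the density factors of the homomorphisms and of the forms. Both sides add up to
   [v(s+2)/2]. *)
have adbc : Rpower q a * Rpower q d = Rpower q b * Rpower q c.
  by rewrite -!Rpower_sum; congr (Rpower _ _); rewrite /a /b /c /d -addn1 natrD; field.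
have d0 : Rpower q d != 0 by apply/eqP/Rgt_not_eq/exp_pos.
have aux (A B C D Y Z : R) : D != 0 -> A * D = B * C -> A * (Z / Y) = B / Y * (C / D * Z).
  move=> D0 h; have -> : A = B * C / D by rewrite -h mulfK.
  by ring.
exact: aux.
Qed.

End OrbitSum.

Local Close Scope ring_scope.

Theorem mainTheorem17 (p : nat) (q : padic) (s : nat)
  (reps : seq (nat -> padic)) :
  prime p -> p <> 2%N -> is_zp p q -> ~ zeq q (zero) -> (1 <= s)%N ->
  orbit_reps p q reps ->
  (\sum_(S <- reps)
      Rmult (Rmult (Rpower (absd p S) (- INR s / 2))
                   (Rminus 1 (Rinv (INR (p ^ s)))))
            (zeta_perp p S s))%R
  = Rmult (Rmult (Rpower (absp p q) ((INR s - 1) / 2))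
                 (Rinv (lambda_p p (s - 1))))
          (mu_p p q (s - 1)).
Proof.
move=> p_pr p_odd zq nzq; case: s => // e _ Hreps; rewrite [(e.+1 - 1)%N]subn1.
have [v [qv qv1]] := zp_val zq nzq.
exact: (main_val p_pr p_odd zq qv qv1 e Hreps).
Qed.
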